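(* Let $m\in H^\infty$ be inner, $H=H^2\ominus mH^2$ with $\dim H\ge2$, and $T=P_HS|_H$. Then $T^2$ is multiplicity free (has a cyclic vector) if and only if $m$ has no nonconstant inner divisor $p\in H^\infty$ satisfying $p(\lambda)=p(-\lambda)$ for all $\lambda\in\mathbb D$.
   Context: $S$ is the unilateral shift $(Sh)(z)=zh(z)$ on the Hardy space $H^2$ of the unit disc $\mathbb D$; $P_H$ is the orthogonal projection onto $H$. An inner divisor of $m$ is an inner function $p$ with $m/p\in H^\infty$. *)

(* Defs.v *)
From HB Require Import structures.
From mathcomp Require Import all_boot all_order all_algebra.
From mathcomp Require Import all_classical all_reals all_analysis.
From mathcomp.real_closed Require Import complex.
Import Order.TTheory GRing.Theory Num.Theory.
Import numFieldTopology.Exports numFieldNormedType.Exports.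
Set Implicit Arguments. Unset Strict Implicit. Unset Printing Implicit Defensive.
Local Open Scope ring_scope.
Local Open Scope classical_set_scope.

(* metric (norm) topology on the complex numbers R[i] *)
HB.instance Definition _ (R : rcfType) := PseudoPointedMetric.copy R[i] (R[i])^o.

Section Hardy.
Variable R : realType.
Local Notation C := R[i].

Definition disc (z : C) : Prop := Normc.normc (z) < 1.

Definition expi (t : R) : C := (cos t +i* sin t)%C.

(* H^2 is realised as the space of Taylor coefficient sequences a with
   sum |a_n|^2 < oo; h(z) = sum a_n z^n. *)
Definition H2 : set (nat -> C) :=
  [set a : nat -> C | exists l : R, series (fun n => Normc.normc (a n) ^+ 2) @ \oo --> l].

Definition psum (a : nat -> C) (z : C) : C :=
  limn (series (fun n => a n * z ^+ n)).

Definition h2inner (a b : nat -> C) : C :=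
  limn (series (fun n => a n * (b n)^*%C)).
Definition h2norm (a : nat -> C) : R :=
  Num.sqrt (limn (series (fun n => Normc.normc (a n) ^+ 2))).

Definition analytic_disc (f : C -> C) : Prop :=
  exists a : nat -> C, forall z, disc z ->
    series (fun n => a n * z ^+ n) @ \oo --> f z.

Definition Hinf (f : C -> C) : Prop :=
  analytic_disc f /\ exists M : R, forall z, disc z -> Normc.normc (f z) <= M.

Definition inner (f : C -> C) : Prop :=
  Hinf f /\
  {ae (@lebesgue_measure R), forall t : R, exists w : C,
      Normc.normc (w) = 1 /\ f ((r%:C)%C * expi t) @[r --> (1 : R)^'-] --> w}.

Definition inner_divisor (p m : C -> C) : Prop :=
  inner p /\ exists q : C -> C, Hinf q /\ forall z, disc z -> m z = p z * q z.

Definition mult_space (m : C -> C) : set (nat -> C) :=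
  [set b : nat -> C | H2 b /\ exists f, H2 f /\ forall z, disc z -> psum b z = m z * psum f z].

Definition model_space (m : C -> C) : set (nat -> C) :=
  [set a : nat -> C | H2 a /\ forall b, mult_space m b -> h2inner a b = 0].

Definition dim_ge2 (H : set (nat -> C)) : Prop :=
  exists a b, H a /\ H b /\
    forall c d : C, (forall n, c * a n + d * b n = 0) -> c = 0 /\ d = 0.

(* unilateral shift (Sh)(z) = z h(z) *)
Definition shift (a : nat -> C) : nat -> C :=
  fun n => if n is k.+1 then a k else 0.

Definition projH (H : set (nat -> C)) (a : nat -> C) : nat -> C :=
  xget (fun _ => 0)
    [set g : nat -> C | H g /\ forall k, H k -> h2inner (fun n => a n - g n) k = 0].

Definition compressed_shift (m : C -> C) (a : nat -> C) : nat -> C :=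
  projH (model_space m) (shift a).

Definition cyclic_vector (A : (nat -> C) -> nat -> C) (H : set (nat -> C))
    (x : nat -> C) : Prop :=
  H x /\ forall h, H h -> forall eps : R, 0 < eps ->
    exists (N : nat) (c : nat -> C),
      h2norm (fun n => h n - \sum_(k < N) c k * iter k A x n) < eps.

Definition multiplicity_free (A : (nat -> C) -> nat -> C) (H : set (nat -> C)) : Prop :=
  exists x, cyclic_vector A H x.

End Hardy.

(* Main.v *)
Require Import Defs.
From HB Require Import structures.
From mathcomp Require Import all_boot all_order all_algebra.
From mathcomp Require Import all_classical all_reals all_analysis.
From mathcomp.real_closed Require Import complex.
From mathcomp Require Import measurable_realfun.
From mathcomp Require Import ring lra zify.
Import Order.TTheory GRing.Theory Num.Theory.
Import numFieldTopology.Exports numFieldNormedType.Exports.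
Set Implicit Arguments. Unset Strict Implicit. Unset Printing Implicit Defensive.
Local Open Scope ring_scope.
Local Open Scope classical_set_scope.

(** Identify H^2 with square-summable Taylor coefficients, and write S for the shift.
    Parseval on circles and dominated convergence show that the coefficient sequence u of
    an inner function has orthonormal shifts S^k u, so that multiplication by u is an
    isometry and H^2 - uH^2 is the set of sequences orthogonal to all S^k u.

    If p is a nonconstant even inner divisor of m and x is any vector, the sequence
    y_k = (-1)^k <p, S^(k+1) x> lies in H(p), hence in H(m), and is orthogonal to all
    S^(2j) x, because its pairing with S^(2j) x is an antisymmetric double sum.  If y = 0,
    the backward shift of p does the job instead.  So x is not cyclic for T^2.

    Conversely, the projection of 1 is cyclic for T^2 unless H(m) contains a nonzero odd
    function.  In that case let L be the set of even f such that zf is orthogonal to all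
    odd functions of H(m): it is closed, invariant under z^2, and contains f and g when
    m = f + zg with f and g even.  Beurling's extremal argument gives L = pH^2 for an even
    p with orthonormal shifts, so p divides m, and p is not constant since 1 is not in L.
    That p is inner in the sense of radial limits is Fatou's theorem: a primitive of the
    boundary series of p is differentiable almost everywhere by Lebesgue's theorem, and the
    Poisson kernel turns its derivative into a radial limit; the limit is unimodular
    because |m| <= |p| <= 1. *)

(** * Limits and absolutely convergent series of complex numbers *)

Section ComplexSequences.
Variable R : realType.
Local Notation C := R[i].
Local Notation normc := (@Normc.normc R).
Implicit Types (z w : C).

(** The notion [inner] speaks of radial limits, while the Hilbert space arguments need only the
    orthonormality of the shifts $S^ku$, the coefficient form of $|u|=1$ on the circle. Radial
    limits therefore occur at the two ends alone: where a given inner function is turned into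
    orthonormal shifts, and where the constructed divisor has to be shown inner. The second passage
    is the costly one. The divisor arises as a mere square-summable sequence, whose boundary series
    need not converge absolutely; division of the coefficients by $n$ makes it do so, and this is
    why a primitive is differentiated instead of summing the series itself.

    Odd functions enter because $\langle T^{2j}P1,y\rangle=\overline{y_{2j}}$ for $y\in H(m)$, with
    $P$ the projection onto $H(m)$: the vectors of $H(m)$ orthogonal to all $T^{2j}P1$ are exactly
    its odd functions. The factor $z$ in the definition of $L$ has its origin in parity: for odd $y$
    only the odd parts of $m$ and $zm$ matter, and these are $zg$ and $zf$. *)

Lemma normc_ge0 z : 0 <= normc z.
Proof. by case: z => x y; rewrite /= sqrtr_ge0. Qed.

Lemma sqr_normcE z : normc z ^+ 2 = complex.Re z ^+ 2 + complex.Im z ^+ 2.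
Proof. by case: z => x y /=; rewrite sqr_sqrtr// addr_ge0 ?sqr_ge0. Qed.

Lemma normcB z w : normc (z - w) = normc (w - z).
Proof. by rewrite -opprB normcN. Qed.

Lemma normc_dist z w : normc z <= normc w + normc (z - w).
Proof. by rewrite -{1}(subrK w z) addrC (le_normcD w (z - w)). Qed.

Lemma normc_real (x : R) : normc x%:C%C = `|x|.
Proof. by rewrite /= expr0n /= addr0 sqrtr_sqr. Qed.

Lemma normc_conj z : normc z^*%C = normc z.
Proof. by case: z => x y /=; rewrite sqrrN. Qed.

Lemma normcX z n : normc (z ^+ n) = normc z ^+ n.
Proof.
by elim: n => [|n IH]; rewrite ?expr0 ?Normc.normc1// !exprS Normc.normcM IH.
Qed.

Lemma normc_eq0 z : (normc z == 0) = (z == 0).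
Proof.
by apply/eqP/eqP => [/Normc.eq0_normc//|->]; rewrite Normc.normc0.
Qed.

Lemma mulc_conj z : z * z^*%C = (normc z ^+ 2)%:C%C.
Proof. by rewrite -sqr_normc rmorphXn. Qed.

Lemma norm_Re_le z : `|complex.Re z| <= normc z.
Proof.
rewrite -(@ler_pXn2r _ 2)// ?nnegrE ?normr_ge0 ?normc_ge0//.
by rewrite sqr_normcE real_normK ?num_real// lerDl sqr_ge0.
Qed.

Lemma norm_Im_le z : `|complex.Im z| <= normc z.
Proof.
rewrite -(@ler_pXn2r _ 2)// ?nnegrE ?normr_ge0 ?normc_ge0//.
by rewrite sqr_normcE real_normK ?num_real// lerDr sqr_ge0.
Qed.

Lemma normc_leReIm z : normc z <= `|complex.Re z| + `|complex.Im z|.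
Proof.
rewrite -(@ler_pXn2r _ 2)// ?nnegrE ?normc_ge0 ?addr_ge0//.
rewrite sqr_normcE sqrrD !real_normK ?num_real//.
by rewrite [leRHS]addrAC lerDl mulrn_wge0// mulr_ge0.
Qed.

Lemma normc_sum (I : Type) (r : seq I) (P : pred I) (F : I -> C) :
  normc (\sum_(i <- r | P i) F i) <= \sum_(i <- r | P i) normc (F i).
Proof.
elim/big_rec2: _ => [|i x y _ h]; first by rewrite Normc.normc0.
by rewrite (le_trans (le_normcD _ _))// lerD2l.
Qed.

Lemma normcM_le_sqr z w : normc (z * w) <= normc z ^+ 2 + normc w ^+ 2.
Proof.
rewrite Normc.normcM; have := sqr_ge0 (normc z - normc w).
have := sqr_ge0 (normc z); have := sqr_ge0 (normc w); nra.
Qed.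

Lemma sqr_normcD_le z w : normc (z + w) ^+ 2 <= 2 * normc z ^+ 2 + 2 * normc w ^+ 2.
Proof.
have := le_normcD z w; have := normc_ge0 (z + w).
have := sqr_ge0 (normc z - normc w); nra.
Qed.

(** The topology on [C] comes from [C^o], whose norm is complex-valued, so its epsilons are positive
    elements of [C]. These have zero imaginary part, and this is the bridge to epsilons in [R] used
    by all later estimates. *)
Lemma cvg_complexP (T : Type) (F : set_system T) {FF : Filter F} (f : T -> C) (l : C) :
  f @ F --> l <-> forall e : R, 0 < e -> \forall x \near F, normc (l - f x) < e.
Proof.
split => h.
- move=> e e0.
  have := @cvgr_dist_lt _ (C^o) T F FF f l h (e%:C)%C.
  by rewrite ltcR => /(_ e0); apply: filterS => x; rewrite ltcR.
- apply: (@cvgrPdist_lt _ (C^o) _ _ _ f l).2 => -[e1 e2].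
  rewrite ltcE /= => /andP[/eqP -> e10].
  by have := h _ e10; apply: filterS => x; rewrite -ltcR.
Qed.

Lemma cvg_complex_ReIm (T : Type) (F : set_system T) {FF : Filter F} (f : T -> C) (l : C) :
  f @ F --> l <->
  ((fun x => complex.Re (f x)) @ F --> complex.Re l) /\
  ((fun x => complex.Im (f x)) @ F --> complex.Im l).
Proof.
split.
  move=> /cvg_complexP h; split; apply/cvgrPdist_lt => e e0;
    have := h e e0; apply: filterS => x; apply: le_lt_trans.
    by have := norm_Re_le (l - f x); case: (l) (f x) => ? ? [].
  by have := norm_Im_le (l - f x); case: (l) (f x) => ? ? [].
move=> [/cvgrPdist_lt hr /cvgrPdist_lt hi]; apply/cvg_complexP => e e0.
have e20 : 0 < e / 2 by rewrite divr_gt0.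
have := hr _ e20; have := hi _ e20; apply: filterS2 => x h1 h2.
apply: le_lt_trans (normc_leReIm _) _.
rewrite [ltRHS](splitr e).
move: h1 h2; case: (l) (f x) => ? ? [] ? ? /= h1 h2; exact: ltrD.
Qed.

Lemma complex_cvg_lim (T : Type) (F : set_system T) {FF : ProperFilter F} (f : T -> C) (l : C) :
  f @ F --> l -> lim (f @ F) = l.
Proof. by move=> h; apply: (@cvg_lim C^o) h; exact: norm_hausdorff. Qed.

Lemma complex_cvg_unique (T : Type) (F : set_system T) {FF : ProperFilter F}
    (f : T -> C) (l l' : C) : f @ F --> l -> f @ F --> l' -> l = l'.
Proof. by move=> /complex_cvg_lim <- /complex_cvg_lim <-. Qed.

Lemma cvg_complexD (T : Type) (F : set_system T) {FF : Filter F} (f g : T -> C) (a b : C) :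
  f @ F --> a -> g @ F --> b -> (fun x => f x + g x) @ F --> a + b.
Proof. exact: (@cvgD _ C^o). Qed.

Lemma cvg_complexM (T : Type) (F : set_system T) {FF : Filter F} (f g : T -> C) (a b : C) :
  f @ F --> a -> g @ F --> b -> (fun x => f x * g x) @ F --> a * b.
Proof. exact: (@cvgM C). Qed.

Lemma cvg_complex_cst (T : Type) (F : set_system T) {FF : Filter F} (k : C) :
  (fun=> k) @ F --> k.
Proof.
by apply/cvg_complexP => e e0; apply: nearW => x; rewrite subrr Normc.normc0.
Qed.

Lemma cvg_complexZ (T : Type) (F : set_system T) {FF : Filter F} (f : T -> C) (k a : C) :
  f @ F --> a -> (fun x => k * f x) @ F --> k * a.
Proof.
have hk : (fun=> k) @ F --> k by exact: cvg_complex_cst.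
by move=> h; exact: (cvg_complexM hk h).
Qed.

Lemma cvg_complex_ext (T : Type) (F : set_system T) (f g : T -> C) (a b : C) :
  f @ F --> a -> f =1 g -> a = b -> g @ F --> b.
Proof. by move=> h /funext <- <-. Qed.

Lemma cvg_complexX (T : Type) (F : set_system T) {FF : Filter F} (f : T -> C) (a : C) n :
  f @ F --> a -> (fun x => f x ^+ n) @ F --> a ^+ n.
Proof.
move=> h; elim: n => [|n IH]; first exact: cvg_complex_cst.
apply: (cvg_complex_ext (cvg_complexM h IH)) => [x|]; exact/esym/exprS.
Qed.

Lemma cvg_complex_conj (T : Type) (F : set_system T) {FF : Filter F} (f : T -> C) (a : C) :
  f @ F --> a -> (fun x => (f x)^*%C) @ F --> a^*%C.
Proof.
move=> /cvg_complexP h; apply/cvg_complexP => e /h; apply: filterS => x.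
by rewrite -rmorphB normc_conj.
Qed.

Lemma cvg_normc (T : Type) (F : set_system T) {FF : Filter F} (f : T -> C) (a : C) :
  f @ F --> a -> (fun x => normc (f x)) @ F --> normc a.
Proof.
move=> /cvg_complexP h; apply/cvgrPdist_lt => e /h; apply: filterS => x.
apply: le_lt_trans; rewrite ler_norml.
have h1 := normc_dist a (f x); have := normc_dist (f x) a; rewrite normcB => h2.
by apply/andP; split; lra.
Qed.

Lemma cvg_complex_sum (T : Type) (F : set_system T) {FF : Filter F} N
    (f : nat -> T -> C) (l : nat -> C) : (forall k, f k @ F --> l k) ->
  (fun x => \sum_(k < N) f k x) @ F --> \sum_(k < N) l k.
Proof.
move=> h; elim: N => [|N IH].
  rewrite big_ord0 (_ : (fun x => _) = fun=> 0); first exact: cvg_complex_cst.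
  by apply/funext => x; rewrite big_ord0.
rewrite big_ord_recr /= (_ : (fun x => _) = fun x => \sum_(k < N) f k x + f N x).
  exact: (cvg_complexD IH (h N)).
by apply/funext => x; rewrite big_ord_recr.
Qed.

Lemma cvg_real_sum (T : Type) (F : set_system T) {FF : Filter F} N
    (f : nat -> T -> R) (l : nat -> R) : (forall k, f k @ F --> l k) ->
  (fun x => \sum_(k < N) f k x) @ F --> \sum_(k < N) l k.
Proof.
move=> h; elim: N => [|N IH].
  rewrite big_ord0 (_ : (fun x => _) = fun=> 0); first exact: cvg_cst.
  by apply/funext => x; rewrite big_ord0.
rewrite big_ord_recr /= (_ : (fun x => _) = fun x => \sum_(k < N) f k x + f N x).
  exact: (cvgD IH (h N)).
by apply/funext => x; rewrite big_ord_recr.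
Qed.

Lemma Re_sum (I : Type) (r : seq I) (P : pred I) (F : I -> C) :
  complex.Re (\sum_(i <- r | P i) F i) = \sum_(i <- r | P i) complex.Re (F i).
Proof. by elim/big_rec2: _ => // i x y _ <-; case: (F i) y => ? ? []. Qed.

Lemma Im_sum (I : Type) (r : seq I) (P : pred I) (F : I -> C) :
  complex.Im (\sum_(i <- r | P i) F i) = \sum_(i <- r | P i) complex.Im (F i).
Proof. by elim/big_rec2: _ => // i x y _ <-; case: (F i) y => ? ? []. Qed.

Lemma real_sum (I : Type) (r : seq I) (P : pred I) (F : I -> R) :
  (\sum_(i <- r | P i) F i)%:C%C = \sum_(i <- r | P i) (F i)%:C%C.
Proof. exact: rmorph_sum. Qed.

Lemma conj_sum (I : Type) (r : seq I) (P : pred I) (F : I -> C) :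
  ((\sum_(i <- r | P i) F i)^*)%C = \sum_(i <- r | P i) (F i)^*%C.
Proof. exact: rmorph_sum. Qed.

Lemma ge0_series_bounded_cvg (u : nat -> R) (M : R) :
  (forall n, 0 <= u n) -> (forall n, \sum_(k < n) u k <= M) -> cvgn (series u).
Proof.
move=> u0 uM; apply: nondecreasing_is_cvgn; first exact: nondecreasing_series.
by exists M => _ [n _ <-]; rewrite seriesEord; exact: uM.
Qed.

Lemma ge0_sum_le_lim (u : nat -> R) n :
  (forall n, 0 <= u n) -> cvgn (series u) -> \sum_(k < n) u k <= limn (series u).
Proof.
move=> u0 cu; have := nondecreasing_cvgn_le _ cu n; rewrite seriesEord; apply.
by rewrite -seriesEord; exact: nondecreasing_series.
Qed.

Lemma lim_series_le_bound (u : nat -> R) (M : R) : cvgn (series u) ->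
  (forall n, \sum_(k < n) u k <= M) -> limn (series u) <= M.
Proof. by move=> cu h; apply: limr_le => //; apply: nearW => n; rewrite seriesEord; exact: h. Qed.

Lemma abs_summable_cvg (u : nat -> C) : cvgn (series (fun n => normc (u n))) ->
  series u @ \oo --> limn (series u).
Proof.
move=> cu.
have cr : cvgn (series (fun n => complex.Re (u n))).
  apply: normed_cvg; apply: series_le_cvg cu => n; rewrite /= ?normc_ge0//.
  exact: norm_Re_le.
have ci : cvgn (series (fun n => complex.Im (u n))).
  apply: normed_cvg; apply: series_le_cvg cu => n; rewrite /= ?normc_ge0//.
  exact: norm_Im_le.
have h : series u @ \oo --> (limn (series (fun n => complex.Re (u n))) +i*
    limn (series (fun n => complex.Im (u n))))%C.
  apply/cvg_complex_ReIm => /=; split.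
    rewrite (_ : (fun n => complex.Re (series u n)) = series (fun n => complex.Re (u n)))//.
    by apply/funext => n; rewrite !seriesEord/= Re_sum.
  rewrite (_ : (fun n => complex.Im (series u n)) = series (fun n => complex.Im (u n)))//.
    by apply/funext => n; rewrite !seriesEord/= Im_sum.
by rewrite (complex_cvg_lim h).
Qed.

End ComplexSequences.

(** * The Hilbert space of square-summable coefficient sequences *)

Section SquareSummable.
Variable R : realType.
Local Notation C := R[i].
Local Notation normc := (@Normc.normc R).
Local Notation S := (@Defs.shift R).
Implicit Types (a b c : nat -> C) (z w : C).

(** The square of [h2norm]; without the root, expansions of sums and Parseval identities stay
    polynomial. *)
Definition sqnorm a : R := limn (series (fun n => normc (a n) ^+ 2)).
Definition scale z a : nat -> C := fun n => z * a n.

Lemma H2_cvg a : H2 a -> cvgn (series (fun n => normc (a n) ^+ 2)).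
Proof. by case=> l; exact: cvgP. Qed.

Lemma H2_bounded (M : R) a : (forall N, \sum_(n < N) normc (a n) ^+ 2 <= M) ->
  H2 a /\ sqnorm a <= M.
Proof.
move=> h; have cv : cvgn (series (fun n => normc (a n) ^+ 2)).
  by apply: ge0_series_bounded_cvg h => n; exact: sqr_ge0.
by split; [exists (sqnorm a)|exact: (lim_series_le_bound cv h)].
Qed.

Lemma sum_le_sqnorm N a : H2 a -> \sum_(n < N) normc (a n) ^+ 2 <= sqnorm a.
Proof. by move=> /H2_cvg; apply: ge0_sum_le_lim => n; exact: sqr_ge0. Qed.

Lemma sqnorm_ge0 a : H2 a -> 0 <= sqnorm a.
Proof. by move=> /(sum_le_sqnorm 0); rewrite big_ord0. Qed.

Lemma coef_le_sqnorm n a : H2 a -> normc (a n) ^+ 2 <= sqnorm a.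
Proof.
move=> /(sum_le_sqnorm n.+1); rewrite big_ord_recr /=; apply: le_trans.
by rewrite lerDr sumr_ge0// => i _; exact: sqr_ge0.
Qed.

Lemma sqnorm_eq0 a : H2 a -> sqnorm a <= 0 -> a = 0.
Proof.
move=> Ha h; apply/funext => n; apply/eqP; rewrite -normc_eq0 -sqrf_eq0.
by apply/eqP/le_anti; rewrite sqr_ge0 (le_trans (coef_le_sqnorm n Ha)).
Qed.

Lemma H2_scale z a : H2 a -> H2 (scale z a).
Proof.
move=> Ha; apply: (H2_bounded (M := normc z ^+ 2 * sqnorm a) _).1 => N.
under eq_bigr do rewrite Normc.normcM exprMn.
by rewrite -mulr_sumr ler_wpM2l ?sqr_ge0 ?sum_le_sqnorm.
Qed.

Lemma H2_add a b : H2 a -> H2 b -> H2 (a + b).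
Proof.
move=> Ha Hb; apply: (H2_bounded (M := 2 * sqnorm a + 2 * sqnorm b) _).1 => N.
apply: (le_trans (y := \sum_(n < N) (2 * normc (a n) ^+ 2 + 2 * normc (b n) ^+ 2))).
  by apply: ler_sum => i _; exact: sqr_normcD_le.
by rewrite big_split /= -!mulr_sumr lerD// ler_wpM2l// sum_le_sqnorm.
Qed.

Lemma H2_opp a : H2 a -> H2 (- a).
Proof. by case=> l h; exists l; under eq_fun do rewrite normcN. Qed.

Lemma H2_sub a b : H2 a -> H2 b -> H2 (a - b).
Proof. by move=> ? ?; apply: H2_add => //; exact: H2_opp. Qed.

Lemma H2_finite N a : (forall n, (N <= n)%N -> a n = 0) -> H2 a.
Proof.
move=> h; apply: (H2_bounded (M := \sum_(n < N) normc (a n) ^+ 2) _).1 => K.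
rewrite -(big_mkord xpredT (fun n => normc (a n) ^+ 2)).
rewrite -(big_mkord xpredT (fun n => normc (a n) ^+ 2)).
apply: (le_trans (y := \sum_(0 <= n < maxn K N) normc (a n) ^+ 2)).
  rewrite (big_cat_nat (n := K) _ (leq_maxl _ _))//= lerDl.
  by apply: sumr_ge0 => i _; exact: sqr_ge0.
rewrite (big_cat_nat (n := N) _ (leq_maxr _ _))//= gerDl big_nat_cond big1//.
by move=> i /andP[/andP[iN _] _]; rewrite h// Normc.normc0 expr0n.
Qed.

Lemma H2_zero : H2 (0 : nat -> C).
Proof. exact: (@H2_finite 0). Qed.

Lemma H2_shift a : H2 a -> H2 (S a).
Proof.
move=> Ha; apply: (H2_bounded (M := sqnorm a) _).1 => -[|N].
  by rewrite big_ord0 sqnorm_ge0.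
rewrite big_ord_recl (_ : S a ord0 = 0)// Normc.normc0 expr0n add0r.
exact: sum_le_sqnorm.
Qed.

Lemma H2_iter_shift k a : H2 a -> H2 (iter k S a).
Proof. by move=> Ha; elim: k => //= k IH; exact: H2_shift. Qed.

Definition backshift a : nat -> C := fun n => a n.+1.

Lemma H2_backshift a : H2 a -> H2 (backshift a).
Proof.
move=> Ha; apply: (H2_bounded (M := sqnorm a) _).1 => N.
apply: le_trans (sum_le_sqnorm N.+1 Ha).
by rewrite big_ord_recl /= lerDr sqr_ge0.
Qed.

Lemma H2_iter_backshift k a : H2 a -> H2 (iter k backshift a).
Proof. by move=> Ha; elim: k => //= k IH; exact: H2_backshift. Qed.

Lemma H2_sum (I : Type) (r : seq I) (F : I -> nat -> C) :
  (forall i, H2 (F i)) -> H2 (\sum_(i <- r) F i).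
Proof.
by move=> h; elim/big_ind: _ => //; [exact: H2_zero|exact: H2_add].
Qed.

Lemma h2inner_cvg a b : H2 a -> H2 b ->
  series (fun n => a n * (b n)^*%C) @ \oo --> h2inner a b.
Proof.
move=> Ha Hb; apply: abs_summable_cvg.
apply: (@ge0_series_bounded_cvg _ _ (sqnorm a + sqnorm b)) => [n|N].
  exact: normc_ge0.
apply: (le_trans (y := \sum_(n < N) (normc (a n) ^+ 2 + normc (b n)^*%C ^+ 2))).
  by apply: ler_sum => i _; exact: normcM_le_sqr.
rewrite big_split /= lerD ?sum_le_sqnorm//.
by under eq_bigr do rewrite normc_conj; exact: sum_le_sqnorm.
Qed.

Lemma h2innerE a b l : series (fun n => a n * (b n)^*%C) @ \oo --> l -> h2inner a b = l.
Proof. exact: complex_cvg_lim. Qed.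

Lemma h2innerDl a a' b : H2 a -> H2 a' -> H2 b ->
  h2inner (a + a') b = h2inner a b + h2inner a' b.
Proof.
move=> Ha Ha' Hb; apply: h2innerE.
rewrite (_ : series _ = fun n => series (fun n => a n * (b n)^*%C) n +
                                 series (fun n => a' n * (b n)^*%C) n).
  by apply: cvg_complexD; exact: h2inner_cvg.
apply/funext => n; rewrite !seriesEord /= -big_split.
by apply: eq_bigr => i _; rewrite mulrDl.
Qed.

Lemma h2innerZl z a b : H2 a -> H2 b -> h2inner (scale z a) b = z * h2inner a b.
Proof.
move=> Ha Hb; apply: h2innerE.
rewrite (_ : series _ = fun n => z * series (fun n => a n * (b n)^*%C) n).
  by apply: cvg_complexZ; exact: h2inner_cvg.
apply/funext => n; rewrite !seriesEord /= mulr_sumr.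
by apply: eq_bigr => i _; rewrite mulrA.
Qed.

Lemma h2innerC a b : H2 a -> H2 b -> h2inner a b = (h2inner b a)^*%C.
Proof.
move=> Ha Hb; apply: h2innerE.
rewrite (_ : series _ = fun n => (series (fun n => b n * (a n)^*%C) n)^*%C).
  by apply: cvg_complex_conj; exact: h2inner_cvg.
apply/funext => n; rewrite !seriesEord /= conj_sum.
by apply: eq_bigr => i _; rewrite rmorphM /= conjcK mulrC.
Qed.

Lemma oppE_scale a : - a = scale (- 1) a.
Proof. by apply/funext => n; rewrite /scale mulN1r. Qed.

Lemma h2innerNl a b : H2 a -> H2 b -> h2inner (- a) b = - h2inner a b.
Proof. by move=> Ha Hb; rewrite oppE_scale h2innerZl// mulN1r. Qed.

Lemma h2innerBl a a' b : H2 a -> H2 a' -> H2 b ->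
  h2inner (a - a') b = h2inner a b - h2inner a' b.
Proof. by move=> *; rewrite h2innerDl ?h2innerNl//; exact: H2_opp. Qed.

Lemma h2innerDr a b b' : H2 a -> H2 b -> H2 b' ->
  h2inner a (b + b') = h2inner a b + h2inner a b'.
Proof.
move=> Ha Hb Hb'; rewrite h2innerC//; last exact: H2_add.
by rewrite h2innerDl// rmorphD /= -!h2innerC.
Qed.

Lemma h2innerZr z a b : H2 a -> H2 b -> h2inner a (scale z b) = z^*%C * h2inner a b.
Proof.
move=> Ha Hb; rewrite h2innerC//; last exact: H2_scale.
by rewrite h2innerZl// rmorphM /= -h2innerC.
Qed.

Lemma h2innerNr a b : H2 a -> H2 b -> h2inner a (- b) = - h2inner a b.
Proof. by move=> Ha Hb; rewrite oppE_scale h2innerZr// rmorphN1 mulN1r. Qed.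

Lemma h2innerBr a b b' : H2 a -> H2 b -> H2 b' ->
  h2inner a (b - b') = h2inner a b - h2inner a b'.
Proof. by move=> *; rewrite h2innerDr ?h2innerNr//; exact: H2_opp. Qed.

Lemma h2inner0l b : h2inner 0 b = 0.
Proof.
apply: h2innerE; rewrite (_ : series _ = fun=> 0).
  exact: cvg_complex_cst.
by apply/funext => n; rewrite seriesEord /= big1// => i _; rewrite mul0r.
Qed.

Lemma h2inner_suml (I : Type) (r : seq I) (F : I -> nat -> C) b :
  (forall i, H2 (F i)) -> H2 b ->
  h2inner (\sum_(i <- r) F i) b = \sum_(i <- r) h2inner (F i) b.
Proof.
move=> HF Hb; elim: r => [|i r IH]; first by rewrite !big_nil h2inner0l.
by rewrite !big_cons h2innerDl ?IH//; exact: H2_sum.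
Qed.

Lemma h2inner_self a : H2 a -> h2inner a a = (sqnorm a)%:C%C.
Proof.
move=> Ha; apply: h2innerE; apply/cvg_complex_ReIm => /=.
have E n : series (fun n => a n * (a n)^*%C) n =
    (series (fun n => normc (a n) ^+ 2) n)%:C%C.
  by rewrite !seriesEord /= real_sum; apply: eq_bigr => i _; rewrite mulc_conj.
split; under eq_fun do rewrite E /=; last exact: cvg_cst.
exact: H2_cvg.
Qed.

Lemma sqnormE a : H2 a -> sqnorm a = complex.Re (h2inner a a).
Proof. by move=> /h2inner_self ->. Qed.

Lemma h2inner_shift_backshift a b : H2 a -> H2 b ->
  h2inner (S a) b = h2inner a (backshift b).
Proof.
move=> Ha Hb; apply: h2innerE.
rewrite -(@cvg_shiftS C).
have -> : [sequence series (fun n => S a n * (b n)^*%C) n.+1]_n =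
  series (fun n => a n * (backshift b n)^*%C).
  apply/funext => n; rewrite !seriesEord /= big_ord_recl /= mul0r add0r.
  by apply: eq_bigr.
by apply: h2inner_cvg => //; exact: H2_backshift.
Qed.

Lemma h2inner_shift a b : H2 a -> H2 b -> h2inner (S a) (S b) = h2inner a b.
Proof. by move=> Ha Hb; rewrite h2inner_shift_backshift//; exact: H2_shift. Qed.

Lemma h2inner_iter_shift k a b : H2 a -> H2 b ->
  h2inner (iter k S a) (iter k S b) = h2inner a b.
Proof.
move=> Ha Hb; elim: k => //= k IH.
by rewrite h2inner_shift ?IH//; exact: H2_iter_shift.
Qed.

Lemma h2inner_iter_backshift k a b : H2 a -> H2 b ->
  h2inner (iter k S a) b = h2inner a (iter k backshift b).
Proof.
move=> Ha; elim: k b => //= k IH b Hb.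
rewrite h2inner_shift_backshift//; last exact: H2_iter_shift.
by rewrite IH -?iterSr ?iterS//; exact: H2_backshift.
Qed.

Lemma sqnorm_shift k a : H2 a -> sqnorm (iter k S a) = sqnorm a.
Proof.
by move=> Ha; rewrite !sqnormE ?h2inner_iter_shift//; exact: H2_iter_shift.
Qed.

Lemma sqnorm_scale z a : H2 a -> sqnorm (scale z a) = normc z ^+ 2 * sqnorm a.
Proof.
move=> Ha; have Hs := H2_scale z Ha.
rewrite sqnormE// h2innerZl// h2innerZr// mulrA mulc_conj h2inner_self//.
by rewrite -rmorphM.
Qed.

Lemma sqnormN a : H2 a -> sqnorm (- a) = sqnorm a.
Proof.
move=> Ha; rewrite oppE_scale sqnorm_scale// -[-1]/(- (1 : C)) normcN Normc.normc1.
by rewrite expr1n mul1r.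
Qed.

Lemma sqnormD a b : H2 a -> H2 b ->
  sqnorm (a + b) = sqnorm a + sqnorm b + 2 * complex.Re (h2inner a b).
Proof.
move=> Ha Hb; have Hab := H2_add Ha Hb.
rewrite (sqnormE Hab) h2innerDl// !h2innerDr// !h2inner_self// (h2innerC Hb Ha).
case: (h2inner a b) => x y /=; ring.
Qed.

Lemma sqnormB a b : H2 a -> H2 b ->
  sqnorm (a - b) = sqnorm a + sqnorm b - 2 * complex.Re (h2inner a b).
Proof.
move=> Ha Hb; rewrite sqnormD// ?h2innerNr//; last exact: H2_opp.
rewrite sqnormN//; case: (h2inner a b) => x y /=; ring.
Qed.

Lemma Cauchy_Schwarz a b : H2 a -> H2 b ->
  normc (h2inner a b) ^+ 2 <= sqnorm a * sqnorm b.
Proof.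
move=> Ha Hb; have [b0|b0] := eqVneq (sqnorm b) 0.
  have -> : b = 0 by apply: sqnorm_eq0 => //; rewrite b0.
  rewrite h2innerC ?h2inner0l ?conjc0//; last exact: H2_zero.
  rewrite Normc.normc0 expr0n mulr_ge0//; apply: sqnorm_ge0 => //.
  exact: H2_zero.
have bp : 0 < sqnorm b by rewrite lt_def b0 sqnorm_ge0.
pose k := h2inner a b * ((sqnorm b)^-1)%:C%C.
have := sqnorm_ge0 (H2_sub Ha (H2_scale k Hb)).
have Hs := H2_scale k Hb.
rewrite sqnormB// sqnorm_scale// h2innerZr//.
have kE : normc k = normc (h2inner a b) / sqnorm b.
  by rewrite Normc.normcM normc_real gtr0_norm// invr_gt0.
have -> : k^*%C * h2inner a b = (normc (h2inner a b) ^+ 2 / sqnorm b)%:C%C.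
  have -> : k^*%C = (h2inner a b)^*%C * ((sqnorm b)^-1)%:C%C.
    by rewrite /k rmorphM; congr (_ * _); exact: conjc_real.
  by rewrite mulrAC [X in X * _]mulrC mulc_conj -rmorphM.
rewrite kE /= exprMn exprVn.
set x := _ ^+ 2; move=> h.
have {h} : 0 <= sqnorm a - x / sqnorm b.
  by apply: le_trans h _; rewrite le_eqVlt; apply/orP; left; apply/eqP; field.
by rewrite subr_ge0 ler_pdivrMr.
Qed.

Lemma h2normE a : h2norm a = Num.sqrt (sqnorm a). Proof. by []. Qed.

Lemma normc_h2inner_le a b : H2 a -> H2 b -> normc (h2inner a b) <= h2norm a * h2norm b.
Proof.
move=> Ha Hb; rewrite -(@ler_pXn2r _ 2)// ?nnegrE ?normc_ge0//; last first.
  by rewrite mulr_ge0 ?sqrtr_ge0.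
by rewrite exprMn !h2normE !sqr_sqrtr ?sqnorm_ge0//; exact: Cauchy_Schwarz.
Qed.

Lemma sqr_h2norm a : H2 a -> h2norm a ^+ 2 = sqnorm a.
Proof. by move=> Ha; rewrite h2normE sqr_sqrtr// sqnorm_ge0. Qed.

End SquareSummable.

(** * Completeness of $H^2$ and orthogonal projection *)

Section Completeness.
Variable R : realType.
Local Notation C := R[i].
Local Notation normc := (@Normc.normc R).
Local Notation S := (@Defs.shift R).
Implicit Types (a b c : nat -> C) (z w : C).

(** The rate $4^{-n}$ bounds the increments of each coordinate by $2^{-n}$, so coordinatewise limits
    exist as sums of absolutely convergent series. The norm bounds pass to the limit on finite
    sections. *)
Lemma H2_fast_cauchy_cvg (x : nat -> nat -> C) : (forall n, H2 (x n)) ->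
  (forall n m, (n <= m)%N -> sqnorm (x m - x n) <= 4^-1 ^+ n) ->
  exists2 l, H2 l & forall n, sqnorm (l - x n) <= 4^-1 ^+ n.
Proof.
move=> Hx hx.
have step k j : normc (x j.+1 k - x j k) <= 2^-1 ^+ j.
  rewrite -(@ler_pXn2r _ 2)// ?nnegrE ?normc_ge0 ?exprn_ge0//.
  rewrite -exprM mulnC exprM (_ : 2^-1 ^+ 2 = 4^-1 :> R); last by field.
  apply: le_trans (hx j j.+1 (leqnSn j)).
  exact: (coef_le_sqnorm k (H2_sub (Hx _) (Hx _))).
have cvx k : exists w, (fun n => x n k) @ \oo --> w.
  have cv : cvgn (series (fun j => normc (x j.+1 k - x j k))).
    apply: (@series_le_cvg _ _ (geometric 1 2^-1)) => [j|j|j|].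
    - exact: normc_ge0.
    - by rewrite /= mul1r exprn_ge0.
    - by rewrite /= mul1r.
    - by apply: is_cvg_geometric_series; rewrite gtr0_norm ?invf_lt1//; lra.
  have hc : (fun=> x 0%N k) @ \oo --> x 0%N k by exact: cvg_complex_cst.
  have h := cvg_complexD hc (abs_summable_cvg cv).
  eexists; rewrite (_ : (fun n => x n k) =
    fun n => x 0%N k + series (fun j => x j.+1 k - x j k) n); first exact: h.
  apply/funext => n; rewrite seriesEord /=.
  elim: n => [|n IH]; first by rewrite big_ord0 addr0.
  by rewrite big_ord_recr /= addrA -IH addrC subrK.
have [l hl] := choice cvx.
have bnd n : H2 (l - x n) /\ sqnorm (l - x n) <= 4^-1 ^+ n.
  apply: H2_bounded => N.
  have cvs : (fun m => \sum_(k < N) normc (x m k - x n k) ^+ 2) @ \oo -->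
      \sum_(k < N) normc ((l - x n) k) ^+ 2.
    apply: (cvg_real_sum (f := fun k m => normc (x m k - x n k) ^+ 2)
      (l := fun k => normc ((l - x n) k) ^+ 2)) => k.
    rewrite expr2; under eq_fun do rewrite expr2.
    have h : (fun m => normc (x m k - x n k)) @ \oo --> normc ((l - x n) k).
      apply: cvg_normc; apply: cvg_complexD => //.
      exact: cvg_complex_cst.
    exact: (cvgM h h).
  have h := cvg_lim (@Rhausdorff R) cvs; rewrite -h.
  apply: limr_le; first by apply/cvg_ex; eexists; exact: cvs.
  exists n => // m /= nm; apply: le_trans (hx _ _ nm).
  exact: (sum_le_sqnorm N (H2_sub (Hx _) (Hx _))).
exists l; last by move=> n; have [] := bnd n.
rewrite -[l](subrK (x 0%N)); apply: H2_add => //; exact: (bnd 0%N).1.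
Qed.

Definition lin_subspace (V : set (nat -> C)) : Prop :=
  [/\ V `<=` @H2 R, V 0, (forall a b, V a -> V b -> V (a + b))
    & forall z a, V a -> V (scale z a)].

(** Subtracting the best multiple [k] of [v] lowers the squared norm of [a] by $|\langle
    a,v\rangle|^2/\|v\|^2$, which cannot exceed the slack [e]. A true minimiser is the case [e = 0];
    the slack permits working along a minimising sequence. *)
Lemma near_minimal_orth (V : set (nat -> C)) a (d e : R) v : lin_subspace V ->
  H2 a -> (forall v, V v -> d <= sqnorm (a - v)) -> sqnorm a <= d + e -> V v ->
  normc (h2inner a v) ^+ 2 <= e * sqnorm v.
Proof.
move=> [VH V0 VD VZ] Ha hd hae Vv; have Hv := VH _ Vv.
have [q0|q0] := eqVneq (sqnorm v) 0.
  by have := Cauchy_Schwarz Ha Hv; rewrite q0 !mulr0.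
have qp : 0 < sqnorm v by rewrite lt_def q0 sqnorm_ge0.
set w := h2inner a v; pose k := w * ((sqnorm v)^-1)%:C%C.
have := hd _ (VZ k _ Vv); rewrite sqnormB//; last exact: H2_scale.
rewrite sqnorm_scale// h2innerZr// -/w.
have -> : k^*%C * w = (normc w ^+ 2 / sqnorm v)%:C%C.
  have -> : k^*%C = w^*%C * ((sqnorm v)^-1)%:C%C.
    by rewrite /k rmorphM; congr (_ * _); exact: conjc_real.
  by rewrite mulrAC [X in X * _]mulrC mulc_conj -rmorphM.
have -> : normc k ^+ 2 * sqnorm v = normc w ^+ 2 / sqnorm v.
  rewrite Normc.normcM normc_real gtr0_norm ?invr_gt0// exprMn.
  by field.
move=> /= h; rewrite -ler_pdivrMr//; lra.
Qed.

(** [V] need not be closed, so the projection itself may lie outside [V]: the result gives the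
    orthogonal component [y] and only says that [h - y] is a norm limit of elements of [V]. *)
Lemma projection_exists (V : set (nat -> C)) h : lin_subspace V -> H2 h ->
  exists y, [/\ H2 y, forall v, V v -> h2inner y v = 0
    & forall e : R, 0 < e -> exists2 v, V v & sqnorm (h - y - v) < e].
Proof.
move=> sV Hh; have [VH V0 VD VZ] := sV.
have VN v : V v -> V (- v) by rewrite oppE_scale; exact: VZ.
pose D := [set sqnorm (h - v) | v in V].
have D0 : D !=set0 by exists (sqnorm (h - 0)), 0.
have lD : has_lbound D.
  by exists 0 => _ [v Vv <-]; apply: sqnorm_ge0; apply: H2_sub => //; exact: VH.
pose d := inf D.
have dle v : V v -> d <= sqnorm (h - v) by move=> Vv; apply: ge_inf => //; exists v.
(* With these slacks the parallelogram law gives $\|x_m-x_n\|^2\le(4^{-n}+4^{-m})/2\le4^{-n}$ for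
   $n\le m$, the rate that [H2_fast_cauchy_cvg] asks for. *)
have exv n : exists v, V v /\ sqnorm (h - v) <= d + 4^-1 ^+ n / 4.
  have e0 : 0 < 4^-1 ^+ n / 4 :> R by rewrite divr_gt0// exprn_gt0.
  have [_ [v Vv <-] hv] := inf_adherent e0 (conj D0 lD).
  by exists v; split => //; exact: ltW.
have [x xP] := choice exv.
have Vx n : V (x n) by have [] := xP n.
have Hx n := VH _ (Vx n).
have [n m nm|l Hl hl] := H2_fast_cauchy_cvg Hx.
  have Ha := H2_sub Hh (Hx n); have Hb := H2_sub Hh (Hx m).
  have -> : x m - x n = (h - x n) - (h - x m).
    by rewrite opprB [RHS]addrC addrA subrK.
  have mid := dle _ (VZ (2^-1)%:C%C _ (VD _ _ (Vx n) (Vx m))).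
  have E : h - scale (2^-1)%:C%C (x n + x m) =
      scale (2^-1)%:C%C ((h - x n) + (h - x m)).
    apply/funext => k; rewrite /scale /= !fctE.
    have E2 : h k = (2^-1)%:C%C * (h k + h k).
      rewrite mulrDr -mulrDl -rmorphD /= (_ : 2^-1 + 2^-1 = 1 :> R) ?mul1r//.
      by field.
    by rewrite {1}E2; ring.
  move: mid; rewrite E sqnorm_scale; last exact: H2_add.
  rewrite normc_real (sqnormD Ha Hb) (sqnormB Ha Hb) gtr0_norm ?invr_gt0//.
  have [_ hn] := xP n; have [_ hm] := xP m.
  have : 4^-1 ^+ m <= 4^-1 ^+ n :> R.
    by apply: ler_wiXn2l => //; lra.
  rewrite (_ : 2^-1 ^+ 2 = 4^-1 :> R); last by field.
  move: (sqnorm (h - x n)) hn => A hn; move: (sqnorm (h - x m)) hm => B hm.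
  move: (complex.Re _) => r; move: (4^-1 ^+ m) hm => em hm.
  move: (4^-1 ^+ n) hn => en hn ? ?. lra.
exists (h - l); split; first exact: H2_sub.
- move=> v Vv; have Hv := VH _ Vv.
  have bd n : normc (h2inner (h - l) v) ^+ 2 <= (4 * sqnorm v) * 4^-1 ^+ n.
    have E : h - l = (h - x n) + (x n - l).
      by rewrite addrA subrK.
    have Ha := H2_sub Hh (Hx n); have Hb := H2_sub (Hx n) Hl.
    rewrite E h2innerDl//; apply: le_trans (sqr_normcD_le _ _) _.
    have h1 : normc (h2inner (h - x n) v) ^+ 2 <= 4^-1 ^+ n / 4 * sqnorm v.
      apply: (near_minimal_orth (V := V) (d := d)) => //; last by have [] := xP n.
      move=> v' Vv'; rewrite -addrA -opprD; apply: dle; exact: VD.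
    have h2 : normc (h2inner (x n - l) v) ^+ 2 <= 4^-1 ^+ n * sqnorm v.
      apply: (le_trans (Cauchy_Schwarz Hb Hv)); apply: ler_wpM2r.
        exact: sqnorm_ge0.
      by rewrite -opprB sqnormN//; exact: H2_sub.
    have : 0 <= 4^-1 ^+ n * sqnorm v by rewrite mulr_ge0 ?exprn_ge0 ?sqnorm_ge0.
    by move: (4^-1 ^+ n) h1 h2 => q; lra.
  apply/eqP; rewrite -normc_eq0 -sqrf_eq0; apply/eqP.
  apply/le_anti; rewrite sqr_ge0 andbT.
  have cv : (fun n => 4 * sqnorm v * 4^-1 ^+ n) @ \oo --> (0 : R).
    rewrite -(mulr0 (4 * sqnorm v)); apply: cvgMl_tmp.
    by apply: cvg_expr; rewrite gtr0_norm ?invf_lt1//; lra.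
  rewrite -(cvg_lim (@Rhausdorff R) cv).
  by apply: limr_ge; [exact: cvgP cv|exact: nearW].
- move=> e e0; have cv : (fun n => 4^-1 ^+ n) @ \oo --> (0 : R).
    by apply: cvg_expr; rewrite gtr0_norm ?invf_lt1//; lra.
  have /cvgrPdist_lt/(_ e e0)[N _ /(_ N (leqnn N))/=] := cv.
  rewrite sub0r normrN ger0_norm ?exprn_ge0// => hN.
  exists (x N) => //; rewrite subKr; apply: le_lt_trans (hl N) hN.
Qed.

End Completeness.

(** * Multiplication operators and sequences with orthonormal shifts *)

Section Multipliers.
Variable R : realType.
Local Notation C := R[i].
Local Notation normc := (@Normc.normc R).
Local Notation S := (@Defs.shift R).
Implicit Types (a b c d u : nat -> C) (z w : C).

Lemma iter_shiftE k a n : iter k S a n = if (n < k)%N then 0 else a (n - k)%N.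
Proof.
elim: k n => [|k IH] n; first by rewrite subn0.
by case: n => [|n] //=; rewrite IH ltnS subSS.
Qed.

Definition unit_seq : nat -> C := fun n => (n == 0%N)%:R.

Lemma H2_unit_seq : H2 unit_seq.
Proof. by apply: (@H2_finite _ 1) => -[]. Qed.

Lemma h2inner_delta k b : H2 b -> h2inner (iter k S unit_seq) b = (b k)^*%C.
Proof.
move=> Hb; apply: h2innerE.
apply/cvg_complexP => e e0; exists k.+1 => // n /= kn.
rewrite seriesEord /= (bigD1 (Ordinal kn))//= iter_shiftE ltnn subnn /unit_seq eqxx mul1r.
rewrite big1 ?addr0 ?subrr ?Normc.normc0// => i ik; rewrite iter_shiftE.
case: ltnP => [|ki]; first by rewrite mul0r.
have ik' : (k < i)%N by rewrite ltn_neqAle ki andbT eq_sym; exact: ik.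
by rewrite subn_eq0 leqNgt ik' mul0r.
Qed.

Lemma h2inner_finite N a b : (forall k, (N <= k)%N -> a k = 0) ->
  h2inner a b = \sum_(k < N) a k * (b k)^*%C.
Proof.
move=> a0; apply: h2innerE; apply/cvg_complexP => e e0; exists N => // n /= Nn.
rewrite seriesEord /= -!(big_mkord xpredT (fun k => a k * (b k)^*%C)).
rewrite (big_cat_nat (n := N) _ Nn)//=.
rewrite (_ : \sum_(N <= k < n) _ = 0) ?addr0 ?subrr ?Normc.normc0//.
by rewrite big_nat big1// => k /andP[Nk _]; rewrite a0// mul0r.
Qed.

Lemma h2inner_deltar k b : H2 b -> h2inner b (iter k S unit_seq) = b k.
Proof.
move=> Hb; rewrite h2innerC ?h2inner_delta ?conjcK//.
by apply: H2_iter_shift; exact: H2_unit_seq.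
Qed.

Lemma sqnorm_unit_seq : sqnorm unit_seq = 1.
Proof. by rewrite (sqnormE H2_unit_seq) (h2inner_delta 0 H2_unit_seq) conjc1. Qed.

Definition lincomb b c N : nat -> C := \sum_(k < N) scale (c k) (iter k S b).

Lemma lincombE b c N n : lincomb b c N n = \sum_(k < N) c k * iter k S b n.
Proof. by rewrite /lincomb fct_sumE. Qed.

Definition cauchy_prod b c : nat -> C := fun n => \sum_(k < n.+1) c k * b (n - k)%N.

(** The coefficient of order [n] of a product sees only the [c k] with $k\le n$, so replacing [c] by
    a polynomial truncation is exact there. *)
Lemma conv_lincomb b c N n : (n < N)%N -> cauchy_prod b c n = lincomb b c N n.
Proof.
move=> nN; rewrite lincombE /cauchy_prod (big_ord_widen_cond N xpredT (fun k => c k * b (n - k)%N))//.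
rewrite big_mkcond /=; apply: eq_bigr => k _; rewrite iter_shiftE ltnS leqNgt.
by case: ltnP => //= _; rewrite mulr0.
Qed.

Definition tail c N : nat -> C := fun k => if (k < N)%N then 0 else c k.

Lemma lincomb_tail b c N K : (N <= K)%N ->
  lincomb b (tail c N) K = lincomb b c K - lincomb b c N.
Proof.
move=> NK; apply/funext => n; rewrite -[RHS]/(lincomb b c K n - lincomb b c N n).
rewrite !lincombE -!(big_mkord xpredT (fun k => c k * iter k S b n)).
rewrite (big_cat_nat (n := N) _ NK)//= addrAC subrr add0r.
rewrite -(big_mkord xpredT (fun k => tail c N k * iter k S b n)).
rewrite (big_cat_nat (n := N) _ NK)//= (_ : \sum_(0 <= k < N) tail c N k * _ = 0) ?add0r.
  rewrite big_nat [RHS]big_nat; apply: eq_bigr => k /andP[Nk _].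
  by rewrite /tail ltnNge Nk.
by rewrite big_nat big1// => k /andP[_ kN]; rewrite /tail kN mul0r.
Qed.

Lemma tail_bound c N : H2 c ->
  H2 (tail c N) /\ sqnorm (tail c N) <= sqnorm c - \sum_(k < N) normc (c k) ^+ 2.
Proof.
move=> Hc; apply: H2_bounded => K; rewrite lerBrDr.
apply: le_trans (sum_le_sqnorm (maxn K N) Hc).
rewrite -!(big_mkord xpredT (fun k => normc (c k) ^+ 2)).
rewrite -(big_mkord xpredT (fun k => normc (tail c N k) ^+ 2)).
apply: (@le_trans _ _ (\sum_(0 <= k < maxn K N) normc (tail c N k) ^+ 2 +
    \sum_(0 <= k < N) normc (c k) ^+ 2)).
  rewrite lerD2r (big_cat_nat (n := K) _ (leq_maxl _ _))//= lerDl.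
  by apply: sumr_ge0 => i _; exact: sqr_ge0.
rewrite (big_cat_nat (n := N) _ (leq_maxr K N))//=.
rewrite [leRHS](big_cat_nat (n := N) _ (leq_maxr K N))//=.
rewrite (_ : \sum_(0 <= k < N) normc (tail c N k) ^+ 2 = 0).
  rewrite add0r [leLHS]addrC lerD2l big_nat [leRHS]big_nat; apply: ler_sum => k /andP[Nk _].
  by rewrite /tail ltnNge Nk.
by rewrite big_nat big1// => k /andP[_ kN]; rewrite /tail kN Normc.normc0 expr0n.
Qed.

Lemma H2_tail c N : H2 c -> H2 (tail c N).
Proof. by case/(tail_bound N). Qed.

Lemma sqnorm_tail_cvg c : H2 c -> sqnorm (tail c N) @[N --> \oo] --> (0 : R).
Proof.
move=> Hc; apply: (@squeeze_cvgr _ _ _ _ (fun=> 0)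
  (fun N => sqnorm c - series (fun k => normc (c k) ^+ 2) N)).
- apply: nearW => N; rewrite sqnorm_ge0 ?seriesEord; last exact: H2_tail.
  by have [] := tail_bound N Hc.
- exact: cvg_cst.
- by rewrite -(subrr (sqnorm c)); apply: cvgB; [exact: cvg_cst|exact: H2_cvg].
Qed.

Lemma cvg_h2inner (x : nat -> nat -> C) a d : (forall n, H2 (x n)) -> H2 a -> H2 d ->
  sqnorm (a - x n) @[n --> \oo] --> (0 : R) ->
  h2inner (x n) d @[n --> \oo] --> h2inner a d.
Proof.
move=> Hx Ha Hd h; apply/cvg_complexP => e e0.
have h0 : sqnorm (a - x n) * sqnorm d @[n --> \oo] --> (0 : R).
  by rewrite -(mul0r (sqnorm d)); exact: cvgMr_tmp.
have /cvgrPdist_lt/(_ (e ^+ 2))/(_ (exprn_gt0 _ e0)) := h0.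
apply: filterS => n; rewrite sub0r normrN => hn.
rewrite -(@ltr_pXn2r _ 2)// ?nnegrE ?normc_ge0 ?ltW//.
rewrite -h2innerBl//; apply: le_lt_trans hn.
apply: le_trans (ler_norm _); apply: Cauchy_Schwarz => //; exact: H2_sub.
Qed.

(** Boundedness of multiplication by [b], with squared norm at most [K], tested on polynomials only:
    there it is a statement about finite sums. [conv_bound] extends it to all of $H^2$. *)
Definition multiplier b (K : R) : Prop := 0 <= K /\
  forall c N, H2 (lincomb b c N) /\
    sqnorm (lincomb b c N) <= K * \sum_(k < N) normc (c k) ^+ 2.

Lemma H2_lincomb b c N : H2 b -> H2 (lincomb b c N).
Proof. by move=> Hb; apply: H2_sum => k; apply: H2_scale; exact: H2_iter_shift. Qed.

Lemma h2inner_lincomb b c d N : H2 b -> H2 d ->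
  h2inner (lincomb b c N) d = \sum_(k < N) c k * h2inner (iter k S b) d.
Proof.
move=> Hb Hd; have Hs k := H2_iter_shift k Hb.
rewrite /lincomb h2inner_suml//; last by move=> k; exact: H2_scale.
by apply: eq_bigr => k _; rewrite h2innerZl.
Qed.

Section Multiplier.
Variables (b : nat -> C) (K : R).
Hypothesis bK : multiplier b K.

Lemma multiplier_H2 : H2 b.
Proof.
have := (bK.2 unit_seq 1%N).1; rewrite /lincomb big_ord1 /=.
have -> // : scale (unit_seq 0) b = b.
by apply/funext => n; rewrite /scale /unit_seq mul1r.
Qed.

Lemma conv_bound c : H2 c -> H2 (cauchy_prod b c) /\ sqnorm (cauchy_prod b c) <= K * sqnorm c.
Proof.
move=> Hc; apply: H2_bounded => N.
under eq_bigr => n _ do rewrite (@conv_lincomb _ _ N)//.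
have [H h] := bK.2 c N.
apply: le_trans (sum_le_sqnorm N H) _; apply: le_trans h _.
by apply: ler_wpM2l; [exact: bK.1|exact: sum_le_sqnorm].
Qed.

Lemma H2_conv c : H2 c -> H2 (cauchy_prod b c).
Proof. by case/conv_bound. Qed.

Lemma conv_subE c N : cauchy_prod b c - lincomb b c N = cauchy_prod b (tail c N).
Proof.
apply/funext => n; rewrite -[LHS]/(cauchy_prod b c n - lincomb b c N n).
rewrite !(@conv_lincomb _ _ (maxn n.+1 N)) ?leq_maxl//.
by rewrite lincomb_tail ?leq_maxr.
Qed.

Lemma sqnorm_conv_cvg c : H2 c ->
  sqnorm (cauchy_prod b c - lincomb b c N) @[N --> \oo] --> (0 : R).
Proof.
move=> Hc; apply: (@squeeze_cvgr _ _ _ _ (fun=> 0) (fun N => K * sqnorm (tail c N))).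
- apply: nearW => N; rewrite conv_subE; have HT := H2_tail N Hc.
  by rewrite sqnorm_ge0 ?(conv_bound HT).2//; exact: H2_conv.
- exact: cvg_cst.
- by rewrite -(mulr0 K); apply: cvgMl_tmp; exact: sqnorm_tail_cvg.
Qed.

Lemma cvg_h2inner_conv c d : H2 c -> H2 d ->
  h2inner (lincomb b c N) d @[N --> \oo] --> h2inner (cauchy_prod b c) d.
Proof.
move=> Hc Hd; apply: cvg_h2inner => //; [|exact: H2_conv|].
  by move=> N; apply: H2_lincomb; exact: multiplier_H2.
exact: sqnorm_conv_cvg.
Qed.

Lemma h2inner_conv_eq0 c d : H2 c -> H2 d ->
  (forall k, h2inner (iter k S b) d = 0) -> h2inner (cauchy_prod b c) d = 0.
Proof.
move=> Hc Hd h0; apply: complex_cvg_unique (cvg_h2inner_conv Hc Hd) _.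
rewrite (_ : (fun N => _) = fun=> 0); first exact: cvg_complex_cst.
apply/funext => N; rewrite (h2inner_lincomb _ _ multiplier_H2)// big1// => k _.
by rewrite h0 mulr0.
Qed.

End Multiplier.

(** The numbers $\langle S^ku,u\rangle$ are the Fourier coefficients of $|u|^2$ on the circle, so
    these conditions encode $|u|=1$ almost everywhere. One-sided indices suffice, since the pairing
    of two shifts depends only on the difference of their orders, up to conjugation. *)
Definition shift_orthonormal u : Prop :=
  [/\ H2 u, sqnorm u = 1 & forall k, h2inner (iter k.+1 S u) u = 0].

Section Orthonormal.
Variable u : nat -> C.
Hypothesis ou : shift_orthonormal u.

Lemma orthonormal_H2 k : H2 (iter k S u).
Proof. by case: ou => Hu _ _; exact: H2_iter_shift. Qed.

Lemma orthonormalE j k : h2inner (iter j S u) (iter k S u) = (j == k)%:R.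
Proof.
case: ou => Hu u1 u0.
have lt i l : h2inner (iter (i + l.+1) S u) (iter i S u) = 0.
  by rewrite iterD h2inner_iter_shift//; exact: H2_iter_shift.
case: (ltngtP j k) => [jk|kj|->].
- rewrite h2innerC; [|exact: orthonormal_H2..].
  by rewrite -(subnKC jk) addSnnS lt conjc0.
- by rewrite -(subnKC kj) addSnnS lt.
- by rewrite h2inner_iter_shift// h2inner_self// u1.
Qed.

Lemma orthonormal_lincomb c N :
  H2 (lincomb u c N) /\ sqnorm (lincomb u c N) = \sum_(k < N) normc (c k) ^+ 2.
Proof.
have HF (k : 'I_N) : H2 (scale (c k) (iter k S u)).
  by apply: H2_scale; exact: orthonormal_H2.
have HL : H2 (lincomb u c N) by exact: H2_sum.
have ipl d : H2 d -> h2inner (lincomb u c N) d = \sum_(k < N) c k * h2inner (iter k S u) d.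
  move=> Hd; rewrite h2inner_suml//; apply: eq_bigr => k _.
  by rewrite h2innerZl//; exact: orthonormal_H2.
split => //; rewrite sqnormE// ipl// Re_sum; apply: eq_bigr => k _.
rewrite h2innerC//; last exact: orthonormal_H2.
rewrite ipl; last exact: orthonormal_H2.
rewrite (bigD1 k)//= orthonormalE eqxx mulr1 big1 ?addr0 ?mulc_conj// => i ik.
by rewrite orthonormalE val_eqE (negbTE ik) mulr0.
Qed.

Lemma orthonormal_multiplier : multiplier u 1.
Proof.
by split=> // c N; have [H ->] := orthonormal_lincomb c N; rewrite mul1r.
Qed.

Let uK := orthonormal_multiplier.

Lemma h2inner_lincomb_shift c N j :
  h2inner (lincomb u c N) (iter j S u) = if (j < N)%N then c j else 0.
Proof.
rewrite (h2inner_lincomb _ _ (multiplier_H2 uK)); last exact: orthonormal_H2.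
case: ltnP => jN.
  rewrite (bigD1 (Ordinal jN))//= orthonormalE eqxx mulr1 big1 ?addr0// => i ij.
  by rewrite orthonormalE (_ : (_ == _) = false) ?mulr0//; apply/negbTE.
rewrite big1// => i _; rewrite orthonormalE (_ : (_ == _) = false) ?mulr0//.
by rewrite ltn_eqF// (leq_trans (ltn_ord i)).
Qed.

Lemma h2inner_conv_shift c j : H2 c -> h2inner (cauchy_prod u c) (iter j S u) = c j.
Proof.
move=> Hc; apply: complex_cvg_unique (cvg_h2inner_conv uK Hc (orthonormal_H2 j)) _.
apply/cvg_complexP => e e0; exists j.+1 => // N /= jN.
by rewrite h2inner_lincomb_shift jN subrr Normc.normc0.
Qed.

Lemma h2inner_conv a c : H2 a -> H2 c -> h2inner (cauchy_prod u a) (cauchy_prod u c) = h2inner a c.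
Proof.
move=> Ha Hc; have Hua := H2_conv uK Ha; have Huc := H2_conv uK Hc.
rewrite h2innerC// [RHS]h2innerC//; congr (_^*)%C.
apply: complex_cvg_unique (cvg_h2inner_conv uK Hc Hua) _.
rewrite (_ : (fun N => _) = series (fun n => c n * (a n)^*%C)).
  exact: h2inner_cvg.
apply/funext => N; rewrite seriesEord /= (h2inner_lincomb _ _ (multiplier_H2 uK))//.
apply: eq_bigr => k _; rewrite h2innerC//; last exact: orthonormal_H2.
by rewrite h2inner_conv_shift.
Qed.

Lemma Bessel b : H2 b ->
  H2 (fun k => h2inner b (iter k S u)) /\ sqnorm (fun k => h2inner b (iter k S u)) <= sqnorm b.
Proof.
move=> Hb; apply: H2_bounded => N; pose d k := h2inner b (iter k S u).
have [HL hL] := orthonormal_lincomb d N.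
have := sqnorm_ge0 (H2_sub Hb HL); rewrite sqnormB// hL.
have -> : h2inner b (lincomb u d N) = (\sum_(k < N) normc (d k) ^+ 2)%:C%C.
  rewrite h2innerC// (h2inner_lincomb _ _ (multiplier_H2 uK))// conj_sum real_sum.
  apply: eq_bigr => k _; rewrite rmorphM /= -h2innerC//; last exact: orthonormal_H2.
  by rewrite mulc_conj /d (h2innerC Hb (orthonormal_H2 k)) normc_conj.
rewrite /= -/(d _); under [X in _ -> X <= _]eq_bigr do rewrite -/(d _).
by lra.
Qed.

(* The coefficients <S^i t, S^N u>, i < I, are the coefficients of S^I t against
   S^(N + I - i) u. *)
Lemma Bessel_reverse t N I : H2 t ->
  \sum_(i < I) normc (h2inner (iter i S t) (iter N S u)) ^+ 2 <= sqnorm t.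
Proof.
move=> Ht; have HI := H2_iter_shift I Ht.
have [HB hB] := Bessel HI; rewrite -(sqnorm_shift I Ht).
apply: le_trans hB; apply: le_trans (sum_le_sqnorm (N.+1 + I) HB).
rewrite big_split_ord /=.
apply: (@le_trans _ _ (\sum_(i < I) normc (h2inner (iter I S t) (iter (N.+1 + i) S u)) ^+ 2)).
  rewrite (reindex_inj rev_ord_inj) /=; apply: ler_sum => i _.
  have iI := ltn_ord i.
  rewrite -(h2inner_iter_shift i.+1 (H2_iter_shift _ Ht) (orthonormal_H2 N)).
  by rewrite -!iterD subnKC// addSnnS addnC.
by rewrite lerDr sumr_ge0// => i _; exact: sqr_ge0.
Qed.

(* Against the truncation of f, the coefficients <S^(n+1) f, S^N u> are those of u times
   the reversed polynomial, so their square sum is that of the truncation; against f itself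
   they vanish, so they are opposite to those against the tail. *)
Lemma uncorrelated_eq0 f : H2 f ->
  (forall n k, h2inner (iter n S f) (iter k S u) = 0) -> f = 0.
Proof.
move=> Hf h0; apply: sqnorm_eq0 => //.
(* Each partial sum of the squares will be at most the squared norm of the corresponding tail, hence
   at most [sqnorm f] minus that same partial sum; this is the origin of the factor 2. *)
suff : sqnorm f <= sqnorm f / 2 by have := sqnorm_ge0 Hf; lra.
apply: (lim_series_le_bound (H2_cvg Hf)) => N.
pose G : nat -> C := fun i => (f (N - i.+1)%N)^*%C.
have [HL hL] := orthonormal_lincomb G N.
have [HT hT] := tail_bound N Hf.
have EG : \sum_(k < N) normc (G k) ^+ 2 = \sum_(k < N) normc (f k) ^+ 2.
  rewrite (reindex_inj rev_ord_inj) /=; apply: eq_bigr => i _.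
  by rewrite /G normc_conj subnSK// subKn// ltnW.
suff : sqnorm (lincomb u G N) <= sqnorm (tail f N).
  by rewrite hL EG => hh; rewrite ler_pdivlMr// mulrDr mulr1; lra.
apply: (lim_series_le_bound (H2_cvg HL)) => I.
apply: le_trans (Bessel_reverse N I.+1 HT).
rewrite big_ord_recl /=.
apply: (@le_trans _ _ (\sum_(i < I) normc (h2inner (iter i.+1 S (tail f N)) (iter N S u)) ^+ 2)); last first.
  by rewrite lerDr sqr_ge0.
apply: ler_sum => n _.
pose h := f - tail f N.
have Hh : H2 h by exact: H2_sub.
have hE k : h k = if (k < N)%N then f k else 0.
  by rewrite /h /tail !fctE; case: ifP => _; rewrite ?subr0 ?subrr.
have E : h2inner (iter n.+1 S (tail f N)) (iter N S u) =
         - h2inner (iter n.+1 S h) (iter N S u).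
  have Hu := orthonormal_H2 N; have Hn := H2_iter_shift n.+1.
  apply/eqP; rewrite -addr_eq0 -h2innerDl//; [|exact: Hn..].
  rewrite -(h0 n.+1 N) (_ : _ + _ = iter n.+1 S f)//.
  apply/funext => k; rewrite !fctE !iter_shiftE; case: ifP => _; rewrite ?addr0//.
  by rewrite /h !fctE addrC subrK.
rewrite E normcN le_eqVlt; apply/orP; left; apply/eqP; congr (_ ^+ 2).
pose H := iter n.+1 S h.
have HE k : H k = if (k < n.+1)%N then 0 else h (k - n.+1)%N by exact: iter_shiftE.
rewrite lincombE -/H (h2inner_finite (N := (n.+1 + N)%N)); last first.
  move=> k nk; rewrite HE hE ltnNge (leq_trans _ nk) ?leq_addr//=.
  by rewrite ltnNge leq_subRL ?nk// (leq_trans _ nk)// leq_addr.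
rewrite big_split_ord /= (_ : \sum_(i < n.+1) _ = 0) ?add0r; last first.
  by rewrite big1// => i _; rewrite HE /= ltn_ord mul0r.
rewrite -normc_conj conj_sum (reindex_inj rev_ord_inj) /=; congr (normc _).
apply: eq_bigr => i _; rewrite rmorphM /= conjcK /G; congr (_ * _).
  rewrite HE ltnNge leq_addr /= addKn hE ltn_ord.
  by rewrite subnSK// subKn// ltnW.
rewrite !iter_shiftE; have iN := ltn_ord i.
have -> : (n < N - i.+1)%N = (n.+1 + i < N)%N by lia.
by case: ifP => // _; congr ((u _)^*)%C; lia.
Qed.

End Orthonormal.

End Multipliers.

(** * Point evaluation in the disc *)

Section Evaluation.
Variable R : realType.
Local Notation C := R[i].
Local Notation normc := (@Normc.normc R).
Local Notation S := (@Defs.shift R).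
Implicit Types (a b c d u : nat -> C) (z w : C).

(** The reproducing kernel of $H^2$: evaluation at [z] is the inner product with it, so limits in
    norm pass to point values. *)
Definition szego z : nat -> C := fun n => z^*%C ^+ n.

Lemma geometric_sum_le (x : R) N : 0 <= x < 1 -> \sum_(n < N) x ^+ n <= (1 - x)^-1.
Proof.
move=> /andP[x0 x1]; have x1' : 0 < 1 - x by rewrite subr_gt0.
rewrite -[leRHS]mul1r ler_pdivlMr//; have := subrX1 x N; have := exprn_ge0 N x0.
move: (\sum_(_ < _) _) (x ^+ N) => s t; lra.
Qed.

Lemma H2_szego z : disc z -> H2 (szego z).
Proof.
rewrite /disc => z1; have x1 : 0 <= normc z ^+ 2 < 1.
  by rewrite sqr_ge0 expr_lt1 ?normc_ge0.
apply: (H2_bounded (M := (1 - normc z ^+ 2)^-1) _).1 => N.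
apply: le_trans (geometric_sum_le N x1); apply: ler_sum => n _.
by rewrite /szego normcX normc_conj -!exprM mulnC.
Qed.

Lemma psumE a z : psum a z = h2inner a (szego z).
Proof.
rewrite /psum /h2inner (_ : (fun n => a n * (szego z n)^*%C) = fun n => a n * z ^+ n)//.
by apply/funext => n; rewrite /szego rmorphXn /= conjcK.
Qed.

Lemma psum_cvg a z : H2 a -> disc z ->
  series (fun n => a n * z ^+ n) @ \oo --> psum a z.
Proof.
move=> Ha dz; rewrite psumE; have := h2inner_cvg Ha (H2_szego dz).
rewrite (_ : (fun n => a n * (szego z n)^*%C) = fun n => a n * z ^+ n)//.
by apply/funext => n; rewrite /szego rmorphXn /= conjcK.
Qed.

Lemma psum_shift a z : H2 a -> disc z -> psum (S a) z = z * psum a z.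
Proof.
move=> Ha dz; have Hz := H2_szego dz.
rewrite !psumE h2inner_shift_backshift//.
rewrite (_ : backshift _ = scale z^*%C (szego z)) ?h2innerZr ?conjcK//.
by apply/funext => n; rewrite /backshift /szego /scale exprS.
Qed.

Lemma psum_iter_shift k a z : H2 a -> disc z -> psum (iter k S a) z = z ^+ k * psum a z.
Proof.
move=> Ha dz; elim: k => [|k IH]; first by rewrite expr0 mul1r.
by rewrite iterS psum_shift ?IH ?exprS ?mulrA//; exact: H2_iter_shift.
Qed.

Lemma psum_add a b z : H2 a -> H2 b -> disc z -> psum (a + b) z = psum a z + psum b z.
Proof. by move=> Ha Hb dz; rewrite !psumE h2innerDl//; exact: H2_szego. Qed.

Lemma psum_scale k a z : H2 a -> disc z -> psum (scale k a) z = k * psum a z.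
Proof. by move=> Ha dz; rewrite !psumE h2innerZl//; exact: H2_szego. Qed.

Lemma psum_unit_seq z : disc z -> psum (@unit_seq R) z = 1.
Proof.
by move=> dz; rewrite psumE (h2inner_delta 0 (H2_szego dz)) /szego expr0 conjc1.
Qed.

Lemma psum_lincomb b c N z : H2 b -> disc z ->
  psum (lincomb b c N) z = psum b z * \sum_(k < N) c k * z ^+ k.
Proof.
move=> Hb dz; have Hz := H2_szego dz.
rewrite psumE h2inner_lincomb// mulr_sumr; apply: eq_bigr => k _.
by rewrite -psumE psum_iter_shift// mulrA mulrC.
Qed.

Lemma psum_conv b K c z : multiplier b K -> H2 c -> disc z ->
  psum (cauchy_prod b c) z = psum b z * psum c z.
Proof.
move=> bK Hc dz; have Hz := H2_szego dz; rewrite psumE.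
apply: complex_cvg_unique (cvg_h2inner_conv bK Hc Hz) _.
under eq_fun do rewrite -psumE (psum_lincomb _ _ (multiplier_H2 bK) dz).
by apply: cvg_complexZ; have := psum_cvg Hc dz; rewrite seriesEord.
Qed.

Lemma powers_bounded_le1 (x K : R) : 0 <= x -> (forall n, x ^+ n <= K) -> x <= 1.
Proof.
move=> x0 h; rewrite leNgt; apply/negP => x1.
pose y := x - 1; have y0 : 0 < y by rewrite subr_gt0.
have bern n : 1 + n%:R * y <= x ^+ n.
  elim: n => [|n IH]; first by rewrite mul0r addr0 expr0.
  rewrite exprS -natr1; have n0 : 0 <= n%:R :> R by [].
  have xE : x = 1 + y by rewrite /y addrC subrK.
  move: IH; move: (x ^+ n) (n%:R) n0 => p m m0 IH; rewrite xE; nra.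
have K0 : 0 <= K by apply: le_trans (h 0%N); rewrite expr0.
have [n hn] : exists n : nat, K / y < n%:R.
  by exists (Num.bound (K / y)); apply: archi_boundP; rewrite divr_ge0// ltW.
have := le_trans (bern n) (h n); rewrite ltr_pdivrMr// in hn; lra.
Qed.

(* The convolution powers of u have norm at most 1, so the powers of the value at z
   stay bounded. *)
Lemma orthonormal_le1 u z : shift_orthonormal u -> disc z -> normc (psum u z) <= 1.
Proof.
move=> ou dz; have uK := orthonormal_multiplier ou.
have Hz := H2_szego dz.
pose w n := iter n (cauchy_prod u) (@unit_seq R).
have wP n : [/\ H2 (w n), sqnorm (w n) <= 1 & psum (w n) z = psum u z ^+ n].
  elim: n => [|n [H1 H2n H3]].
    by split; [exact: H2_unit_seq|rewrite sqnorm_unit_seq|rewrite psum_unit_seq].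
  have [H4 H5] := conv_bound uK H1; rewrite mul1r in H5.
  split => //; first exact: le_trans H5 H2n.
  by rewrite /w iterS (psum_conv uK)// H3 exprS.
suff : normc (psum u z) ^+ 2 <= 1.
  by rewrite expr_le1// normc_ge0.
apply: (@powers_bounded_le1 _ (sqnorm (szego z))); first exact: sqr_ge0.
move=> n; rewrite -exprM mulnC exprM -normcX; have [H1 H2n <-] := wP n.
rewrite psumE; apply: le_trans (Cauchy_Schwarz H1 Hz) _.
by rewrite -[leRHS]mul1r ler_wpM2r// sqnorm_ge0.
Qed.

End Evaluation.

(** * Integration of real functions over compact intervals *)

Section IntervalIntegral.
Variable R : realType.
Local Notation mu := (@lebesgue_measure R).
Implicit Types (f g F : R -> R) (a b : R).

Definition itv_int a b f : R := \int[mu]_(x in `[a, b]) f x.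

Definition itv_integrable a b f : Prop := mu.-integrable `[a, b] (EFin \o f).

Lemma continuous_itv_integrable a b f : continuous f -> itv_integrable a b f.
Proof.
move=> cf; apply: continuous_compact_integrable; first exact: segment_compact.
exact: continuous_subspaceT.
Qed.

Lemma continuous_measurable f : continuous f -> measurable_fun setT f.
Proof. exact: continuous_measurable_fun. Qed.

Lemma is_derive_continuous F f : (forall x : R, is_derive x 1 F (f x)) -> continuous F.
Proof.
move=> dF x; apply: differentiable_continuous; apply/derivable1_diffP.
exact: ex_derive.
Qed.

Lemma itv_int_FTC F f a b : a < b -> (forall x : R, is_derive x 1 F (f x)) ->
  continuous f -> itv_int a b f = F b - F a.
Proof.
move=> ab dF cf; have cF := is_derive_continuous dF.
rewrite /itv_int /Rintegral (continuous_FTC2 (F := F))//.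
- exact: continuous_subspaceT.
- split.
  + by move=> x _; exact: ex_derive.
  + by apply: cvg_at_right_filter; exact: cF.
  + by apply: cvg_at_left_filter; exact: cF.
- by move=> x _; rewrite derive1E; case: (dF x).
Qed.

Lemma itv_intD a b f g : itv_integrable a b f -> itv_integrable a b g ->
  itv_int a b (fun x => f x + g x) = itv_int a b f + itv_int a b g.
Proof. exact: RintegralD. Qed.

Lemma itv_intB a b f g : itv_integrable a b f -> itv_integrable a b g ->
  itv_int a b (fun x => f x - g x) = itv_int a b f - itv_int a b g.
Proof. exact: RintegralB. Qed.

Lemma itv_intZ a b k f : itv_integrable a b f ->
  itv_int a b (fun x => k * f x) = k * itv_int a b f.
Proof. exact: RintegralZl. Qed.

Lemma itv_int_le a b f g : itv_integrable a b f -> itv_integrable a b g ->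
  (forall x, a <= x <= b -> f x <= g x) -> itv_int a b f <= itv_int a b g.
Proof.
move=> If Ig h; apply: le_Rintegral => // x /=; rewrite in_itv /=; exact: h.
Qed.

Lemma itv_integrableD a b f g : itv_integrable a b f -> itv_integrable a b g ->
  itv_integrable a b (fun x => f x + g x).
Proof.
move=> If Ig; rewrite /itv_integrable.
rewrite (_ : EFin \o _ = (EFin \o f) \+ (EFin \o g))%E//.
exact: integrableD.
Qed.

Lemma itv_integrableZ a b k f : itv_integrable a b f ->
  itv_integrable a b (fun x => k * f x).
Proof.
move=> If; rewrite /itv_integrable.
rewrite (_ : EFin \o _ = (fun x => k%:E * (EFin \o f) x)%E)//.
exact: integrableZl.
Qed.

Lemma itv_int_cst a b (k : R) : a < b -> itv_int a b (fun=> k) = k * (b - a).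
Proof.
move=> ab; have dF (x : R) : is_derive x 1 (fun x => k * x) k.
  by apply: is_derive_eq; rewrite /= [LHS]mulr1.
have ck : continuous (fun _ : R => k) by move=> x; exact: cvg_cst.
by rewrite (itv_int_FTC ab dF ck) mulrBr.
Qed.

Lemma itv_int_sum a b N (F : nat -> R -> R) : (forall k, itv_integrable a b (F k)) ->
  itv_integrable a b (fun x => \sum_(k < N) F k x) /\
  itv_int a b (fun x => \sum_(k < N) F k x) = \sum_(k < N) itv_int a b (F k).
Proof.
move=> IF; elim: N => [|N [IH1 IH2]].
  rewrite big_ord0 (_ : (fun x => _) = fun=> 0); last first.
    by apply/funext => x; rewrite big_ord0.
  split; first by apply: continuous_itv_integrable => x; exact: cvg_cst.
  by rewrite /itv_int /Rintegral integral0_eq.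
rewrite big_ord_recr /= (_ : (fun x => _) = fun x => \sum_(k < N) F k x + F N x).
  by rewrite itv_intD// IH2; split => //; exact: itv_integrableD.
by apply/funext => x; rewrite big_ord_recr.
Qed.

(** The dominating function takes extended values because the one needed for Fatou's theorem is a
    series of nonnegative functions, which may be infinite on a null set. *)
Lemma itv_int_dominated_ereal a b (f_ : nat -> R -> R) f (g : R -> \bar R) :
  (forall n, measurable_fun setT (f_ n)) -> measurable_fun setT f ->
  {ae mu, forall x, a <= x <= b -> f_ n x @[n --> \oo] --> f x} ->
  mu.-integrable `[a, b] g ->
  (forall n x, a <= x <= b -> (`|f_ n x|%:E <= g x)%E) ->
  itv_integrable a b f /\ itv_int a b (f_ n) @[n --> \oo] --> itv_int a b f.
Proof.
move=> mf_ mf cv Ig hg.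
have [] := @dominated_convergence _ _ _ mu `[a, b]%classic (measurable_itv _)
  (fun n => EFin \o f_ n) (EFin \o f) g.
- by move=> n; apply/measurable_EFinP; apply: measurable_funTS; exact: mf_.
- by apply/measurable_EFinP; apply: measurable_funTS; exact: mf.
- move: cv; apply: filterS; first exact: (ae_filter_ringOfSetsType mu).
  move=> x h /=; rewrite in_itv /= => /h h1.
  by apply: cvg_EFin; [exact: nearW|exact: h1].
- exact: Ig.
- by apply: aeW => x n /=; rewrite in_itv /=; exact: hg.
move=> If _ cvi; split => //.
have fin : (\int[mu]_(x in `[a, b]) (EFin \o f) x)%E \is a fin_num.
  exact: integrable_fin_num.
by apply: fine_cvg; rewrite fineK.
Qed.

Lemma itv_int_dominated a b (f_ : nat -> R -> R) f g :
  (forall n, measurable_fun setT (f_ n)) -> measurable_fun setT f ->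
  {ae mu, forall x, a <= x <= b -> f_ n x @[n --> \oo] --> f x} ->
  itv_integrable a b g ->
  (forall n x, a <= x <= b -> `|f_ n x| <= g x) ->
  itv_integrable a b f /\ itv_int a b (f_ n) @[n --> \oo] --> itv_int a b f.
Proof.
by move=> mf_ mf cv Ig hg; exact: (itv_int_dominated_ereal mf_ mf cv Ig).
Qed.

End IntervalIntegral.

(** * Parseval's identity on circles *)

Section CircleMeans.
Variable R : realType.
Local Notation C := R[i].
Local Notation normc := (@Normc.normc R).
Local Notation S := (@Defs.shift R).
Local Notation mu := (@lebesgue_measure R).
Local Notation twopi := (pi *+ 2 : R).
Implicit Types (a b c d u A : nat -> C) (z w : C).

Lemma expi0 : expi 0 = 1 :> C.
Proof. by rewrite /expi cos0 sin0. Qed.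

Lemma expiD (s t : R) : expi (s + t) = expi s * expi t :> C.
Proof. by rewrite /expi cosD sinD /=; congr (_ +i* _)%C; ring. Qed.

Lemma expiX (t : R) n : expi t ^+ n = expi (n%:R * t) :> C.
Proof.
elim: n => [|n IH]; first by rewrite expr0 mul0r expi0.
by rewrite exprS IH -expiD -natr1 mulrDl mul1r addrC.
Qed.

Lemma normc_expi (t : R) : normc (expi t) = 1.
Proof. by rewrite /= cos2Dsin2 sqrtr1. Qed.

Lemma Re_mul_expi w (t : R) k : complex.Re (w * expi t ^+ k) =
  complex.Re w * cos (k%:R * t) - complex.Im w * sin (k%:R * t).
Proof. by rewrite expiX; case: w. Qed.

Definition trigpoly A N (t : R) : C := \sum_(n < N) A n * expi t ^+ n.

Lemma continuous_Re_expi w k : continuous (fun t : R => complex.Re (w * expi t ^+ k)).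
Proof.
pose f (t : R) := complex.Re w * (- sin (k%:R * t) * k%:R) -
  complex.Im w * (cos (k%:R * t) * k%:R).
apply: (@is_derive_continuous _ _ f) => t.
under eq_fun do rewrite Re_mul_expi.
by apply: is_derive_eq; rewrite /f /= /GRing.scale /=; ring.
Qed.

Lemma continuous_Re_trigpoly w A N :
  continuous (fun t : R => complex.Re (w * trigpoly A N t)).
Proof.
rewrite (_ : (fun t => _) = fun t : R => \sum_(n < N) complex.Re ((w * A n) * expi t ^+ n)).
  move=> t; apply: (cvg_real_sum (f := fun n t => complex.Re ((w * A n) * expi t ^+ n))
    (l := fun n => complex.Re ((w * A n) * expi t ^+ n))) => n.
  exact: continuous_Re_expi.
apply/funext => t; rewrite /trigpoly mulr_sumr Re_sum.
by apply: eq_bigr => n _; rewrite mulrA.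
Qed.

(** The factors 1 and $i$ present both parts as [complex.Re (w * z)], so that
    [continuous_Re_trigpoly] alone yields the continuity of the squared modulus. *)
Lemma sqr_normc_ReIm z :
  normc z ^+ 2 = complex.Re (1 * z) ^+ 2 + complex.Re ('i%C * z) ^+ 2.
Proof. by rewrite sqr_normcE mul1r; case: z => x y /=; ring. Qed.

Lemma Re_mul2 z : complex.Re (2 * z) = 2 * complex.Re z.
Proof. by rewrite mulr_natl mulr2n; case: z => x y /=; ring. Qed.

Lemma continuous_sqr_normc_trigpoly A N :
  continuous (fun t : R => normc (trigpoly A N t) ^+ 2).
Proof.
rewrite (_ : (fun t => _) = fun t : R =>
  complex.Re (1 * trigpoly A N t) * complex.Re (1 * trigpoly A N t) +
  complex.Re ('i%C * trigpoly A N t) * complex.Re ('i%C * trigpoly A N t)); last first.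
  by apply/funext => t; rewrite sqr_normc_ReIm !expr2.
move=> t; have h1 := @continuous_Re_trigpoly 1 A N t.
have h2 := @continuous_Re_trigpoly 'i%C A N t.
by apply: cvgD; exact: cvgM.
Qed.

Lemma cos_period (a : R) k K : cos (k%:R * (a + twopi *+ K)) = cos (k%:R * a).
Proof.
rewrite mulrDr (_ : k%:R * (twopi *+ K) = twopi *+ (K * k)); last first.
  by rewrite mulr_natl [RHS]mulrnA.
exact: (periodicn (@cosD2pi R)).
Qed.

Lemma sin_period (a : R) k K : sin (k%:R * (a + twopi *+ K)) = sin (k%:R * a).
Proof.
rewrite mulrDr (_ : k%:R * (twopi *+ K) = twopi *+ (K * k)); last first.
  by rewrite mulr_natl [RHS]mulrnA.
exact: (periodicn (@sinD2pi R)).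
Qed.

Section Period.
Variables (a : R) (K : nat).
Hypothesis K0 : (0 < K)%N.
Let b := a + twopi *+ K.

Lemma lt_period : a < b.
Proof. by rewrite /b ltrDl pmulrn_lgt0// pmulrn_lgt0// pi_gt0. Qed.

Lemma itv_int_Re_expi w k : (0 < k)%N ->
  itv_int a b (fun t => complex.Re (w * expi t ^+ k)) = 0.
Proof.
move=> k0; pose F (t : R) := k%:R^-1 * (complex.Re w * sin (k%:R * t) +
  complex.Im w * cos (k%:R * t)).
have kn : k%:R != 0 :> R by rewrite pnatr_eq0 -lt0n.
have dF (t : R) : is_derive t 1 F (complex.Re (w * expi t ^+ k)).
  apply: is_derive_eq; rewrite Re_mul_expi /= /GRing.scale /=.
  by field.
rewrite (itv_int_FTC lt_period dF (@continuous_Re_expi w k)) /F /b.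
by rewrite cos_period// sin_period// subrr.
Qed.

(** A new top term adds $|A_N|^2$ and cross terms of the form $\mathrm{Re}(we^{ikt})$ with $k\ge1$,
    which have mean zero over whole periods. Any number of periods is allowed because Fatou's
    theorem is proved on intervals exhausting the line. *)
Lemma trigpoly_Parseval A N :
  itv_int a b (fun t => normc (trigpoly A N t) ^+ 2) =
  (b - a) * \sum_(n < N) normc (A n) ^+ 2.
Proof.
have cint f : continuous f -> itv_integrable a b f := @continuous_itv_integrable _ a b f.
elim: N => [|N IH].
  rewrite big_ord0 mulr0 (_ : (fun t => _) = fun=> 0).
    by rewrite (itv_int_cst _ lt_period) mul0r.
  by apply/funext => t; rewrite /trigpoly big_ord0 Normc.normc0 expr0n.
pose G n (t : R) := complex.Re ((2 * ((A n)^*%C * A N)) * expi t ^+ (N - n)).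
have E t : normc (trigpoly A N.+1 t) ^+ 2 =
    normc (trigpoly A N t) ^+ 2 + (normc (A N) ^+ 2 + \sum_(n < N) G n t).
  have EG : \sum_(n < N) G n t =
      2 * complex.Re ((trigpoly A N t)^*%C * (A N * expi t ^+ N)).
    rewrite /trigpoly conj_sum mulr_suml Re_sum mulr_sumr; apply: eq_bigr => n _.
    have EN : expi t ^+ N = expi t ^+ (N - n) * expi t ^+ n :> C.
      by rewrite -exprD subnK// ltnW.
    rewrite /G EN rmorphM /=.
    have e1 : (expi t ^+ n)^*%C * expi t ^+ n = 1.
      by rewrite mulrC mulc_conj normcX normc_expi expr1n expr1n.
    have -> : (A n)^*%C * (expi t ^+ n)^*%C * (A N * (expi t ^+ (N - n) * expi t ^+ n)) =
       ((A n)^*%C * A N * expi t ^+ (N - n)) * ((expi t ^+ n)^*%C * expi t ^+ n) by ring.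
    by rewrite e1 mulr1 -mulrA Re_mul2.
  have AN : normc (A N) ^+ 2 = normc (A N * expi t ^+ N) ^+ 2.
    by rewrite Normc.normcM normcX normc_expi expr1n mulr1.
  rewrite EG AN {1}/trigpoly big_ord_recr /= -/(trigpoly A N t).
  move: (trigpoly A N t) (A N * _) => z w; rewrite !sqr_normcE.
  by case: z w => x y [x' y'] /=; ring.
rewrite (_ : (fun t => _) = fun t => normc (trigpoly A N t) ^+ 2 +
   (normc (A N) ^+ 2 + \sum_(n < N) G n t)); last by apply/funext.
have IG n : itv_integrable a b (G n) by apply: cint; exact: continuous_Re_expi.
have IS := itv_int_sum N IG.
have Ic : itv_integrable a b (fun=> normc (A N) ^+ 2).
  by apply: cint => x; exact: cvg_cst.
rewrite itv_intD; last 2 first.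
- by apply: cint; exact: continuous_sqr_normc_trigpoly.
- by apply: itv_integrableD => //; exact: IS.1.
rewrite (itv_intD Ic IS.1) IS.2 IH (itv_int_cst _ lt_period).
rewrite (_ : \sum_(k < N) itv_int a b (G k) = 0); last first.
  by rewrite big1// => n _; apply: itv_int_Re_expi; rewrite subn_gt0.
by rewrite big_ord_recr /=; ring.
Qed.

End Period.

Lemma mean_square A (f : R -> C) (B : R) :
  (forall N, \sum_(n < N) normc (A n) <= B) ->
  (forall t, trigpoly A N t @[N --> \oo] --> f t) ->
  [/\ measurable_fun setT (fun t => normc (f t) ^+ 2),
      itv_integrable 0 twopi (fun t => normc (f t) ^+ 2) &
      series (fun n => normc (A n) ^+ 2) @ \oo -->
        twopi^-1 * itv_int 0 twopi (fun t => normc (f t) ^+ 2)].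
Proof.
move=> hB hf.
have B0 : 0 <= B by have := hB 0%N; rewrite big_ord0.
have cv t : normc (trigpoly A N t) ^+ 2 @[N --> \oo] --> normc (f t) ^+ 2.
  have h : normc (trigpoly A N t) @[N --> \oo] --> normc (f t).
    by apply: cvg_normc; exact: hf.
  exact: (cvgM h h).
have mt N : measurable_fun setT (fun t => normc (trigpoly A N t) ^+ 2).
  by apply: continuous_measurable; exact: continuous_sqr_normc_trigpoly.
have mf : measurable_fun setT (fun t => normc (f t) ^+ 2).
  by apply: (measurable_fun_cvg mt) => t _; exact: cv.
have [|||If cvi] := @itv_int_dominated _ 0 twopi _ _ (fun=> B ^+ 2) mt mf.
- by apply: aeW => t _; exact: cv.
- by apply: continuous_itv_integrable => x; exact: cvg_cst.
- move=> N t _; rewrite ger0_norm ?sqr_ge0// ler_pXn2r// ?nnegrE ?normc_ge0//.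
  apply: le_trans (hB N); apply: le_trans (normc_sum _ _ _) _.
  by apply: ler_sum => n _; rewrite Normc.normcM normcX normc_expi expr1n mulr1.
split => //.
have tp : 0 < twopi by rewrite pmulrn_lgt0// pi_gt0.
rewrite (_ : series _ = fun N => twopi^-1 * itv_int 0 twopi (fun t => normc (trigpoly A N t) ^+ 2)).
  exact: cvgMl_tmp.
apply/funext => N; rewrite seriesEord /=.
have := @trigpoly_Parseval 0 1 isT A N; rewrite mulr1n add0r subr0 => ->.
by rewrite mulKf// gt_eqF.
Qed.

End CircleMeans.

(** * Bounded analytic functions, inner functions and isometries *)

Section BoundedAnalytic.
Variable R : realType.
Local Notation C := R[i].
Local Notation normc := (@Normc.normc R).
Local Notation S := (@Defs.shift R).
Local Notation mu := (@lebesgue_measure R).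
Local Notation twopi := (pi *+ 2 : R).
Implicit Types (a b c d u A : nat -> C) (z w : C) (f g : C -> C).

Definition coefs a f : Prop := forall z, disc z -> series (fun n => a n * z ^+ n) @ \oo --> f z.

Lemma coefs_psum a : H2 a -> coefs a (psum a).
Proof. by move=> Ha z dz; exact: psum_cvg. Qed.

Lemma coefs_psumE a f z : coefs a f -> disc z -> f z = psum a z.
Proof. by move=> h dz; rewrite /psum (complex_cvg_lim (h z dz)). Qed.

Lemma disc_polar (r t : R) : 0 <= r < 1 -> disc (r%:C%C * expi t).
Proof.
move=> /andP[r0 r1].
by rewrite /disc Normc.normcM normc_expi mulr1 normc_real ger0_norm.
Qed.

(** Abel's lemma: convergence at a point [s] strictly between [r] and 1 bounds the terms there, and
    the powers of [r / s] give a geometric majorant. *)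
Lemma coefs_abs_summable a f (r : R) : coefs a f -> 0 <= r < 1 ->
  exists B : R, forall N, \sum_(n < N) normc (a n) * r ^+ n <= B.
Proof.
move=> af /andP[r0 r1]; pose s := (1 + r) / 2.
have [s0 s1 rs] : [/\ 0 < s, s < 1 & r < s] by rewrite /s; split; lra.
have ds : disc s%:C%C by rewrite /disc normc_real ger0_norm ?ltW.
have cv : normc (series (fun n => a n * s%:C%C ^+ n) N) @[N --> \oo] --> normc (f s%:C%C).
  by apply: cvg_normc; exact: af.
have /cvg_seq_bounded[D0 [_ hD0]] := cvgP _ cv.
pose D := D0 + 1.
have hD n : normc (series (fun n => a n * s%:C%C ^+ n) n) <= D.
  have := hD0 D; rewrite /D ltrDl ltr01 => /(_ isT n I) /=.
  by rewrite ger0_norm// normc_ge0.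
have D_ge0 : 0 <= D by apply: le_trans (hD 0%N); exact: normc_ge0.
have term n : normc (a n) * s ^+ n <= D + D.
  have -> : normc (a n) * s ^+ n = normc (a n * s%:C%C ^+ n).
    by rewrite Normc.normcM normcX normc_real ger0_norm ?ltW.
  have := seriesSB (fun n => a n * s%:C%C ^+ n) n => <-.
  apply: le_trans (le_normcD _ _) _; rewrite normcN; exact: lerD.
have q1 : 0 <= r / s < 1.
  by rewrite divr_ge0 ?(ltW s0)//= ltr_pdivrMr// mul1r.
exists ((D + D) * (1 - r / s)^-1) => N.
apply: (@le_trans _ _ (\sum_(n < N) (D + D) * (r / s) ^+ n)).
  apply: ler_sum => n _.
  have -> : r ^+ n = s ^+ n * (r / s) ^+ n.
    by rewrite -exprMn mulrC divfK// gt_eqF.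
  rewrite mulrA; apply: ler_wpM2r => //.
  by rewrite exprn_ge0// divr_ge0// ltW.
by rewrite -mulr_sumr; apply: ler_wpM2l; [exact: addr_ge0|exact: geometric_sum_le].
Qed.

Lemma mean_square_disc a f (r : R) : coefs a f -> 0 <= r < 1 ->
  [/\ measurable_fun setT (fun t => normc (f (r%:C%C * expi t)) ^+ 2),
      itv_integrable 0 twopi (fun t => normc (f (r%:C%C * expi t)) ^+ 2) &
      series (fun n => (normc (a n) * r ^+ n) ^+ 2) @ \oo -->
        twopi^-1 * itv_int 0 twopi (fun t => normc (f (r%:C%C * expi t)) ^+ 2)].
Proof.
move=> af r01; have /andP[r0 r1] := r01.
have [B hB] := coefs_abs_summable af r01.
pose A n := a n * r%:C%C ^+ n.
have nA n : normc (A n) = normc (a n) * r ^+ n.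
  by rewrite Normc.normcM normcX normc_real ger0_norm.
have [||m1 m2 m3] := @mean_square _ A (fun t => f (r%:C%C * expi t)) B.
- by move=> N; under eq_bigr do rewrite nA.
- move=> t; have := af _ (disc_polar t r01); rewrite seriesEord.
  rewrite (_ : (fun N => trigpoly A N t) =
    [sequence \sum_(k < n) a k * (r%:C%C * expi t) ^+ k]_n)//.
  by apply/funext => N; apply: eq_bigr => n _; rewrite /A exprMn mulrA.
split => //; rewrite (_ : (fun n => _ ^+ 2) = fun n => normc (A n) ^+ 2)//.
by apply/funext => n; rewrite nA.
Qed.

(** A sequence in $[0,1)$ tending to 1: dominated convergence is sequential, whereas radial limits
    are stated along a filter. *)
Definition radius (j : nat) : R := 1 - j.+1%:R^-1.

Lemma radius_itv j : 0 <= radius j < 1.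
Proof.
by rewrite /radius subr_ge0 invf_le1// ler1n /= gtrBl invr_gt0.
Qed.

Lemma radius_cvg : radius j @[j --> \oo] --> (1 : R).
Proof.
rewrite -[X in _ --> X]subr0; apply: cvgB; first exact: cvg_cst.
exact: cvg_harmonic.
Qed.

Lemma radius_sum_cvg a N :
  \sum_(n < N) (normc (a n) * radius j ^+ n) ^+ 2 @[j --> \oo] -->
  \sum_(n < N) normc (a n) ^+ 2.
Proof.
apply: (cvg_real_sum (f := fun n j => (normc (a n) * radius j ^+ n) ^+ 2)
  (l := fun n => normc (a n) ^+ 2)) => n.
have h : normc (a n) * radius j ^+ n @[j --> \oo] --> normc (a n).
  rewrite -[X in _ --> X]mulr1; apply: cvgMl_tmp.
  elim: n => [|n IH]; first exact: cvg_cst.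
  rewrite (_ : (fun j => _) = fun j => radius j * radius j ^+ n); last first.
    by apply/funext => j; rewrite exprS.
  have h2 : radius j * radius j ^+ n @[j --> \oo] --> 1 * (1 : R).
    exact: (cvgM radius_cvg IH).
  by rewrite mulr1 in h2.
exact: (cvgM h h).
Qed.

Lemma sum_radius_le a N (r : R) : 0 <= r < 1 ->
  \sum_(n < N) (normc (a n) * r ^+ n) ^+ 2 <= \sum_(n < N) normc (a n) ^+ 2.
Proof.
move=> /andP[r0 r1]; apply: ler_sum => n _; rewrite exprMn.
apply: ler_piMr; first exact: sqr_ge0.
by rewrite -exprM exprn_ile1// ltW.
Qed.

(** On each circle of radius below 1 the means of $|f|^2$ and $M^2|g|^2$ compare pointwise.
    Membership of [a] in [H2] is part of the conclusion, so the radius tends to 1 inside finite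
    partial sums only. *)
Lemma dominated_sqnorm a c f g (M : R) : coefs a f -> coefs c g -> H2 c ->
  (forall z, disc z -> normc (f z) <= M * normc (g z)) -> 0 <= M ->
  H2 a /\ sqnorm a <= M ^+ 2 * sqnorm c.
Proof.
move=> af cg Hc fg M0; apply: H2_bounded => N.
have key j : \sum_(n < N) (normc (a n) * radius j ^+ n) ^+ 2 <= M ^+ 2 * sqnorm c.
  have rj := radius_itv j.
  have [_ If cf] := mean_square_disc af rj; have [_ Ig cvg] := mean_square_disc cg rj.
  have lf := cvg_lim (@Rhausdorff R) cf; have lg := cvg_lim (@Rhausdorff R) cvg.
  apply: le_trans (ge0_sum_le_lim N _ (cvgP _ cf)) _.
    by move=> n; exact: sqr_ge0.
  rewrite lf.
  apply: (@le_trans _ _ (M ^+ 2 * (twopi^-1 * itv_int 0 twopi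
      (fun t => normc (g ((radius j)%:C%C * expi t)) ^+ 2)))).
    rewrite mulrCA ler_wpM2l//; first by rewrite invr_ge0 mulrn_wge0// pi_ge0.
    rewrite -itv_intZ//; apply: itv_int_le => //; first exact: itv_integrableZ.
    move=> t _; rewrite -exprMn ler_pXn2r ?nnegrE ?normc_ge0//.
      exact/fg/disc_polar.
    by rewrite mulr_ge0// normc_ge0.
  rewrite -lg ler_wpM2l ?sqr_ge0//; apply: lim_series_le_bound (cvgP _ cvg) _ => K.
  by apply: le_trans (sum_radius_le _ _ rj) _; exact: sum_le_sqnorm.
have cs := @radius_sum_cvg a N; rewrite -(cvg_lim (@Rhausdorff R) cs).
by apply: limr_le; [exact: cvgP cs|exact: nearW].
Qed.

Lemma coefs_inj a b : H2 a -> H2 b ->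
  (forall z, disc z -> psum a z = psum b z) -> a = b.
Proof.
move=> Ha Hb ab; have Hs := H2_sub Ha Hb.
(* With the constant [M = 0] the comparison says that a function vanishing on the disc has norm
   zero. *)
have [||_] := @dominated_sqnorm (a - b) (@unit_seq R) (psum (a - b)) (psum (@unit_seq R)) 0
  (coefs_psum Hs) (coefs_psum (@H2_unit_seq R)) (@H2_unit_seq R).
- move=> z dz; rewrite psumE h2innerBl//; last exact: H2_szego.
  by rewrite -!psumE ab// subrr mul0r Normc.normc0.
- by [].
rewrite expr0n mul0r => h; apply/eqP; rewrite -subr_eq0; apply/eqP.
exact: sqnorm_eq0.
Qed.

Lemma coefs_one : coefs (@unit_seq R) (fun=> 1).
Proof.
move=> z dz; rewrite -(psum_unit_seq dz); exact: psum_cvg (@H2_unit_seq R) dz.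
Qed.

Lemma Hinf_coefs f : Hinf f -> exists2 b, H2 b & forall z, disc z -> f z = psum b z.
Proof.
case=> -[b bf] [M fM]; exists b; last by move=> z; exact: coefs_psumE.
have M0 : 0 <= M.
  have d0 : disc (0 : C) by rewrite /disc Normc.normc0.
  by apply: le_trans (fM _ d0); exact: normc_ge0.
have [|//|//] := dominated_sqnorm (M := M) bf coefs_one (@H2_unit_seq R).
by move=> z dz; rewrite Normc.normc1 mulr1; exact: fM.
Qed.

(** The cofactor [Q] is a polynomial, hence continuous up to the circle, so the modulus of $fQ$
    tends radially to that of [Q] at every point where $f$ has a unimodular limit. The product of
    the bounds [M] and [B] dominates. *)
Lemma inner_isometry f b c N : inner f -> H2 b ->
  (forall z, disc z -> f z = psum b z) ->
  sqnorm (lincomb b c N) = \sum_(k < N) normc (c k) ^+ 2.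
Proof.
move=> [[_ [M fM]] bdry] Hb fb.
pose U := @unit_seq R; have HU : H2 U := @H2_unit_seq R.
pose P := lincomb U c N; have HP : H2 P by exact: H2_lincomb.
pose L := lincomb b c N; have HL : H2 L by exact: H2_lincomb.
pose Q z := \sum_(k < N) c k * z ^+ k.
have LE z : disc z -> psum L z = f z * Q z.
  by move=> dz; rewrite psum_lincomb// fb.
pose B := \sum_(k < N) normc (c k).
have QB z : normc z <= 1 -> normc (Q z) <= B.
  move=> z1; apply: le_trans (normc_sum _ _ _) _; apply: ler_sum => k _.
  rewrite Normc.normcM normcX; apply: ler_piMr; first exact: normc_ge0.
  by rewrite exprn_ile1// normc_ge0.
have B0 : 0 <= B by apply: sumr_ge0 => k _; exact: normc_ge0.
have M0 : 0 <= M.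
  have d0 : disc (0 : C) by rewrite /disc Normc.normc0.
  by apply: le_trans (fM _ d0); exact: normc_ge0.
pose F j (t : R) := normc (psum L ((radius j)%:C%C * expi t)) ^+ 2.
pose G (t : R) := normc (trigpoly c N t) ^+ 2.
have ms j := mean_square_disc (coefs_psum HL) (radius_itv j).
have mF j : measurable_fun setT (F j) by have [] := ms j.
have mG : measurable_fun setT G.
  by apply: continuous_measurable; exact: continuous_sqr_normc_trigpoly.
have [|||_ cvi] := @itv_int_dominated _ 0 twopi F G (fun=> (M * B) ^+ 2) mF mG.
- move: bdry; apply: filterS; first exact: (ae_filter_ringOfSetsType mu).
  move=> t [w [w1 fw]] _.
  have h1 : normc (f ((radius j)%:C%C * expi t)) @[j --> \oo] --> (1 : R).
    have : normc (f (r%:C%C * expi t)) @[r --> (1 : R)^'-] --> normc w.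
      by apply: cvg_normc; exact: fw.
    rewrite w1 => /cvg_at_leftP; apply; split.
      by move=> j; have /andP[] := radius_itv j.
    exact: radius_cvg.
  have hz : (radius j)%:C%C * expi t @[j --> \oo] --> expi t.
    rewrite -[X in _ --> X]mul1r; apply: cvg_complexM; last exact: cvg_complex_cst.
    by apply/cvg_complex_ReIm => /=; split; [exact: radius_cvg|exact: cvg_cst].
  have hX k : ((radius j)%:C%C * expi t) ^+ k @[j --> \oo] --> expi t ^+ k.
    by apply: cvg_complexX.
  have h2 : normc (Q ((radius j)%:C%C * expi t)) @[j --> \oo] --> normc (trigpoly c N t).
    apply: cvg_normc; apply: (cvg_complex_sum
      (f := fun k j => c k * ((radius j)%:C%C * expi t) ^+ k)
      (l := fun k => c k * expi t ^+ k)) => k.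
    exact: (@cvg_complexZ R nat \oo _ _ (c k) _ (hX k)).
  have h3 : normc (psum L ((radius j)%:C%C * expi t)) @[j --> \oo] --> normc (trigpoly c N t).
    rewrite -[X in _ --> X]mul1r.
    rewrite (_ : (fun j => _) = fun j => normc (f ((radius j)%:C%C * expi t)) *
      normc (Q ((radius j)%:C%C * expi t))); first exact: cvgM.
    apply/funext => j; rewrite LE ?Normc.normcM//.
    exact/disc_polar/radius_itv.
  exact: (cvgM h3 h3).
- by apply: continuous_itv_integrable => x; exact: cvg_cst.
- move=> j t _; have dz := disc_polar t (radius_itv j).
  rewrite /F ger0_norm ?sqr_ge0// ler_pXn2r ?nnegrE ?normc_ge0 ?mulr_ge0//.
  rewrite LE// Normc.normcM ler_pM ?normc_ge0//; first exact: fM.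
  by apply: QB; rewrite ltW.
have tp : 0 < twopi by rewrite pmulrn_lgt0// pi_gt0.
have cvS : twopi^-1 * itv_int 0 twopi (F j) @[j --> \oo] --> \sum_(k < N) normc (c k) ^+ 2.
  have := @trigpoly_Parseval _ 0 1 isT c N; rewrite mulr1n add0r subr0 -/G => EG.
  rewrite -[X in _ --> X](mulKf (_ : twopi != 0)) ?gt_eqF// -EG.
  exact: cvgMl_tmp.
have lS := cvg_lim (@Rhausdorff R) cvS.
(* Upper bound: a partial sum for [sqnorm L] is the limit of its versions damped by powers of the
   radius, each below a circle mean. Lower bound: damping keeps every circle mean below
   [sqnorm L]. *)
apply/le_anti/andP; split.
- apply: lim_series_le_bound (H2_cvg HL) _ => K.
  have cs := @radius_sum_cvg L K; rewrite -(cvg_lim (@Rhausdorff R) cs) -lS.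
  apply: ler_lim; [exact: cvgP cs|exact: cvgP cvS|apply: nearW => j].
  have [_ _ cm] := ms j; rewrite -(cvg_lim (@Rhausdorff R) cm).
  by apply: ge0_sum_le_lim (cvgP _ cm) => n; exact: sqr_ge0.
- rewrite -lS; apply: limr_le; [exact: cvgP cvS|apply: nearW => j].
  have [_ _ cm] := ms j; rewrite -(cvg_lim (@Rhausdorff R) cm).
  apply: lim_series_le_bound (cvgP _ cm) _ => K.
  by apply: le_trans (sum_radius_le _ _ (radius_itv j)) _; exact: sum_le_sqnorm.
Qed.

Lemma inner_orthonormal f b : inner f -> H2 b ->
  (forall z, disc z -> f z = psum b z) -> shift_orthonormal b.
Proof.
move=> fi Hb fb; have iso c N := inner_isometry c N fi Hb fb.
have b1 : sqnorm b = 1.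
  have := iso (@unit_seq R) 1%N; rewrite big_ord1 Normc.normc1 expr1n => <-.
  rewrite /lincomb big_ord1 /=; congr sqnorm.
  by apply/funext => n; rewrite /scale mul1r.
split => // k; set w := h2inner _ _.
have Hk := H2_iter_shift k.+1 Hb.
(* For the polynomial $1+xz^{k+1}$ this [x] makes the cross term equal to $2|w|^2$, so this one test
   of the isometry forces $w=0$. *)
pose x := w^*%C.
pose c n := if n == 0%N then 1 else if n == k.+1 then x else 0.
have cE : lincomb b c k.+2 = b + scale x (iter k.+1 S b).
  rewrite /lincomb big_ord_recr big_ord_recl /= big1 ?addr0.
    rewrite /c /= eqxx; congr (_ + _).
    by apply/funext => n; rewrite /scale mul1r.
  move=> i _; rewrite /c /= /bump /= add1n eqSS ltn_eqF//.
  by apply/funext => n; rewrite /scale mul0r.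
have sE : \sum_(j < k.+2) normc (c j) ^+ 2 = 1 + normc x ^+ 2.
  rewrite big_ord_recr /= big_ord_recl /= (_ : \sum_(i < k) _ = 0); last first.
    rewrite big1// => i _; rewrite (_ : c _ = 0) ?Normc.normc0 ?expr0n//.
    by rewrite /c /= /bump /= add1n eqSS ltn_eqF.
  transitivity (normc (c 0%N) ^+ 2 + normc (c k.+1) ^+ 2); first by rewrite addr0.
  rewrite (_ : c 0%N = 1)// Normc.normc1 expr1n (_ : c k.+1 = x)//.
  by rewrite /c /= eqxx.
have := iso c k.+2; rewrite cE sqnormD//; last exact: H2_scale.
rewrite sqnorm_scale// sqnorm_shift// b1 h2innerZr// h2innerC// -/w.
rewrite sE mulr1.
rewrite /x conjcK mulc_conj /= => h.
have {h} : normc w ^+ 2 = 0 by move: h; move: (normc w^*%C ^+ 2) (normc w ^+ 2) => p q; lra.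
by move/eqP; rewrite sqrf_eq0 normc_eq0 => /eqP.
Qed.

End BoundedAnalytic.

(** * The Poisson kernel and its cosine coefficients *)

Section PoissonKernel.
Variable R : realType.
Variable r : R.
Hypothesis r01 : 0 < r < 1.
Implicit Types s t : R.

Let r0 : 0 < r. Proof. by case/andP: r01. Qed.
Let r1 : r < 1. Proof. by case/andP: r01. Qed.

(** This is $|1-re^{is}|^2$. *)
Definition pden s : R := 1 - 2 * r * cos s + r ^+ 2.
Definition poisson s : R := (1 - r ^+ 2) * (pden s)^-1.
(** Minus the derivative of [poisson]: with this sign it is nonnegative on $[0,\pi]$ and defines a
    positive functional. *)
Definition dpoisson s : R := 2 * r * (1 - r ^+ 2) * sin s * (pden s ^+ 2)^-1.

Lemma pden_gt0 s : 0 < pden s.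
Proof. by rewrite /pden; have := cos_le1 s; have := r0; have := r1; nra. Qed.

Lemma pden_neq0 s : pden s != 0. Proof. by rewrite gt_eqF// pden_gt0. Qed.

Lemma poisson_ge0 s : 0 <= poisson s.
Proof.
rewrite /poisson mulr_ge0 ?invr_ge0 ?(ltW (pden_gt0 s))//.
by have := r0; have := r1; nra.
Qed.

Lemma dpoisson_ge0 s : 0 <= s <= pi -> 0 <= dpoisson s.
Proof.
move=> h; rewrite /dpoisson mulr_ge0 ?invr_ge0 ?sqr_ge0// mulr_ge0 ?sin_ge0_pi//.
by have := r0; have := r1; nra.
Qed.

Lemma is_derive_poisson s : is_derive s 1 poisson (- dpoisson s).
Proof.
have d0 := pden_neq0 s.
have dp : is_derive s 1 pden (2 * r * sin s).
  by apply: is_derive_eq; rewrite /= /GRing.scale /=; ring.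
have dv := is_deriveV d0 dp.
apply: is_derive_eq; rewrite /dpoisson /GRing.scale /=.
by field.
Qed.

Lemma continuous_poisson : continuous poisson.
Proof. exact: is_derive_continuous is_derive_poisson. Qed.

Lemma continuous_dpoisson : continuous dpoisson.
Proof.
move=> s; apply: cvgM.
  by apply: cvgM; [exact: cvg_cst|exact: continuous_sin].
have d0 : pden s ^+ 2 != 0 by rewrite sqrf_eq0 pden_neq0.
apply: cvgV => //; have c : pden x @[x --> s] --> pden s.
  apply: (@is_derive_continuous _ _ (fun s => 2 * r * sin s)) => t.
  by apply: is_derive_eq; rewrite /= /GRing.scale /=; ring.
exact: (cvgM c c).
Qed.

Lemma continuous_cosn n : continuous (fun s => cos (n%:R * s)).
Proof.
apply: (@is_derive_continuous _ _ (fun s => - sin (n%:R * s) * n%:R)) => s.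
by apply: is_derive_eq; rewrite /= /GRing.scale /=; ring.
Qed.

Lemma continuous_sinn n : continuous (fun s => sin (n%:R * s)).
Proof.
apply: (@is_derive_continuous _ _ (fun s => cos (n%:R * s) * n%:R)) => s.
by apply: is_derive_eq; rewrite /= /GRing.scale /=; ring.
Qed.

Lemma sin_natpi n : sin (n%:R * pi) = 0 :> R.
Proof.
elim: n => [|n IH]; first by rewrite mul0r sin0.
by rewrite -natr1 mulrDl mul1r sinD IH mul0r sinpi mulr0 addr0.
Qed.

Let pi0 : 0 < pi :> R. Proof. exact: pi_gt0. Qed.

Definition poisson_coef n : R := itv_int 0 pi (fun s => poisson s * cos (n%:R * s)).

Let intP n : itv_integrable 0 pi (fun s => poisson s * cos (n%:R * s)).
Proof.
apply: continuous_itv_integrable => s; apply: cvgM.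
  exact: continuous_poisson.
exact: continuous_cosn.
Qed.

Lemma itv_int_cosn n : itv_int 0 pi (fun s => cos (n.+1%:R * s)) = 0.
Proof.
have dF s : is_derive s 1 (fun s => n.+1%:R^-1 * sin (n.+1%:R * s)) (cos (n.+1%:R * s)).
  by apply: is_derive_eq; rewrite /= /GRing.scale /=; field.
rewrite (itv_int_FTC pi0 dF); last exact: continuous_cosn.
by rewrite sin_natpi !mulr0 sin0 mulr0 subrr.
Qed.

Lemma poisson_coef_bound n : `|poisson_coef n| <= poisson_coef 0.
Proof.
have I0 := intP 0; have In := intP n.
have le s : `|poisson s * cos (n%:R * s)| <= poisson s * cos (0%:R * s).
  rewrite mul0r cos0 mulr1 normrM ger0_norm ?poisson_ge0//.
  by apply: ler_piMr; [exact: poisson_ge0|rewrite ler_norml cos_geN1 cos_le1].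
rewrite ler_norml; apply/andP; split; last first.
  by apply: itv_int_le => // s _; apply: le_trans (le s); exact: ler_norm.
rewrite -mulN1r -itv_intZ//; apply: itv_int_le => //; first exact: itv_integrableZ.
by move=> s _; rewrite mulN1r; have := le s; rewrite ler_norml => /andP[].
Qed.

(** Multiplying the kernel by its denominator leaves the constant $1-r^2$, whose integral against
    $\cos((n+1)s)$ is zero; on the other side $2\cos s\cos((n+1)s)$ splits into the two neighbouring
    cosines. *)
Lemma poisson_coef_rec n : (1 + r ^+ 2) * poisson_coef n.+1 =
  r * (poisson_coef n.+2 + poisson_coef n).
Proof.
have E : (fun s => (1 - r ^+ 2) * cos (n.+1%:R * s)) = fun s =>
   (1 + r ^+ 2) * (poisson s * cos (n.+1%:R * s)) -
   r * (poisson s * cos (n.+2%:R * s) + poisson s * cos (n%:R * s)).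
  apply/funext => s; have d0 := pden_neq0 s.
  have -> : cos (n.+2%:R * s) = cos (n.+1%:R * s) * cos s - sin (n.+1%:R * s) * sin s.
    by rewrite -cosD -[n.+2%:R]natr1 mulrDl mul1r.
  have -> : cos (n%:R * s) = cos (n.+1%:R * s) * cos s + sin (n.+1%:R * s) * sin s.
    have -> : n%:R * s = n.+1%:R * s - s by rewrite -[n.+1%:R]natr1 mulrDl mul1r addrK.
    by rewrite cosB.
  have e : (pden s)^-1 * (1 - 2 * r * cos s + r ^+ 2) = 1 by exact: mulVf.
  rewrite /poisson -[LHS]mulr1 -[X in _ * X = _]e; move: (pden s)^-1 => q; ring.
have := itv_int_cosn n => h0.
have Ic : itv_integrable 0 pi (fun s => cos (n.+1%:R * s)).
  by apply: continuous_itv_integrable; exact: continuous_cosn.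
have := itv_intZ (1 - r ^+ 2) Ic; rewrite h0 mulr0 E itv_intB; last 2 first.
- by apply: itv_integrableZ; exact: intP.
- by apply: itv_integrableZ; apply: itv_integrableD; exact: intP.
rewrite itv_intZ; last exact: intP.
rewrite itv_intZ; last by apply: itv_integrableD; exact: intP.
rewrite itv_intD; [|exact: intP..].
by move/eqP; rewrite subr_eq0 => /eqP.
Qed.

Lemma poisson_coef_rec0 : (1 + r ^+ 2) * poisson_coef 0 = 2 * r * poisson_coef 1 + (1 - r ^+ 2) * pi.
Proof.
have E : (fun=> 1 - r ^+ 2) = fun s =>
   (1 + r ^+ 2) * (poisson s * cos (0%:R * s)) - (2 * r) * (poisson s * cos (1%:R * s)).
  apply/funext => s; have d0 := pden_neq0 s.
  rewrite mul0r cos0 mul1r /poisson.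
  have e : (pden s)^-1 * (1 - 2 * r * cos s + r ^+ 2) = 1 by exact: mulVf.
  rewrite -[LHS]mulr1 -[X in _ * X = _]e; move: (pden s)^-1 => q; ring.
have := itv_int_cst (1 - r ^+ 2) pi0; rewrite subr0 E itv_intB; last 2 first.
- by apply: itv_integrableZ; exact: intP.
- by apply: itv_integrableZ; exact: intP.
rewrite itv_intZ; last exact: intP.
rewrite itv_intZ; last exact: intP.
rewrite -/(poisson_coef _) -/(poisson_coef _) => <-; ring.
Qed.

(* The recurrence has the solutions r^n and r^-n; boundedness excludes the latter. *)
Lemma poisson_coefE n : poisson_coef n = pi * r ^+ n.
Proof.
pose J n := poisson_coef n.+1 - r * poisson_coef n.
have JS k : r * J k.+1 = J k.
  by rewrite /J; have := poisson_coef_rec k; move: (poisson_coef _) (poisson_coef _) (poisson_coef _) => x y z h; nra.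
have Jn k : J 0%N = r ^+ k * J k.
  by elim: k => [|k IH]; rewrite ?expr0 ?mul1r// IH -JS exprSr mulrA.
have J0 : J 0%N = 0.
  apply/eqP; rewrite -normr_le0.
  have bJ k : `|J 0%N| <= r ^+ k * (2 * poisson_coef 0).
    rewrite (Jn k) normrM ger0_norm ?exprn_ge0 ?(ltW r0)//.
    apply: ler_wpM2l; first by rewrite exprn_ge0 ?(ltW r0).
    apply: le_trans (ler_normB _ _) _; rewrite mulrDl !mul1r lerD ?poisson_coef_bound//.
    rewrite normrM (ger0_norm (ltW r0)); apply: le_trans (poisson_coef_bound k).
    by apply: ler_piMl; rewrite ?normr_ge0// ltW.
  have cv : r ^+ k * (2 * poisson_coef 0) @[k --> \oo] --> (0 : R).
    rewrite -(mul0r (2 * poisson_coef 0)); apply: cvgMr_tmp.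
    by apply: cvg_expr; rewrite gtr0_norm.
  rewrite -(cvg_lim (@Rhausdorff R) cv).
  by apply: limr_ge; [exact: cvgP cv|exact: nearW].
have Jk k : J k = 0.
  have := Jn k; rewrite J0 => /esym/eqP; rewrite mulf_eq0 expf_eq0 (gt_eqF r0) andbF /=.
  by move/eqP.
have E k : poisson_coef k.+1 = r * poisson_coef k.
  by have /eqP := Jk k; rewrite /J subr_eq0 => /eqP.
have E0 : poisson_coef 0 = pi.
  have := poisson_coef_rec0; rewrite E => h.
  have rr : 0 < 1 - r ^+ 2 by have := r0; have := r1; nra.
  have rn : 1 - r ^+ 2 != 0 by rewrite gt_eqF.
  by apply: (mulfI rn); move: h; move: (poisson_coef 0) => x; lra.
elim: n => [|n IH]; first by rewrite expr0 mulr1.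
by rewrite E IH exprS mulrCA.
Qed.

(** The integral of $\cos(nx)$ over $[-s,s]$. *)
Definition symint n s : R := if n is k.+1 then 2 * sin (k.+1%:R * s) / k.+1%:R else 2 * s.

Lemma continuous_symint n : continuous (symint n).
Proof.
case: n => [|n] s; first by apply: cvgMl_tmp.
apply: cvgMr_tmp; apply: cvgMl_tmp; exact: continuous_sinn.
Qed.

(** Integration by parts moves the derivative from the boundary function to the kernel: for
    $\phi(s)=\int_{t-s}^{t+s}f$ this is the Poisson integral of $f$ at $re^{it}$, up to a boundary
    term at $s=\pi$. *)
Definition poisson_functional (phi : R -> R) : R :=
  (2 * pi)^-1 * itv_int 0 pi (fun s => dpoisson s * phi s).

Lemma integrable_dpoisson phi : continuous phi ->
  itv_integrable 0 pi (fun s => dpoisson s * phi s).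
Proof.
move=> c; apply: continuous_itv_integrable => s.
by apply: cvgM; [exact: continuous_dpoisson|exact: c].
Qed.

Lemma poisson_functional_symintS n : poisson_functional (symint n.+1) = r ^+ n.+1.
Proof.
have n0 : n.+1%:R != 0 :> R by rewrite pnatr_eq0.
pose F s := poisson s * sin (n.+1%:R * s).
pose f s := n.+1%:R * (poisson s * cos (n.+1%:R * s)) - dpoisson s * sin (n.+1%:R * s).
have Id : itv_integrable 0 pi (fun s => dpoisson s * sin (n.+1%:R * s)).
  by apply: integrable_dpoisson; exact: continuous_sinn.
have dF s : is_derive s 1 F (f s).
  have := is_derive_poisson s => dP; apply: is_derive_eq.
  by rewrite /f /GRing.scale /=; ring.
have cf : continuous f.
  move=> s; apply: cvgB.
    by apply: cvgMl_tmp; apply: cvgM; [exact: continuous_poisson|exact: continuous_cosn].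
  by apply: cvgM; [exact: continuous_dpoisson|exact: continuous_sinn].
have := itv_int_FTC pi0 dF cf.
rewrite /F sin_natpi !mulr0 sin0 mulr0 subr0 itv_intB//; last first.
  by apply: itv_integrableZ; exact: intP.
rewrite itv_intZ; last exact: intP.
rewrite -/(poisson_coef _) poisson_coefE => /eqP; rewrite subr_eq0 => /eqP h.
rewrite /poisson_functional (_ : (fun s => _) = fun s => (2 / n.+1%:R) * (dpoisson s * sin (n.+1%:R * s))).
  have pn : pi != 0 :> R by rewrite gt_eqF.
  rewrite itv_intZ// -h; move: (r ^+ n.+1) (n.+1%:R) n0 pi pn => q N N0 p pn.
  by field; rewrite N0 pn.
by apply/funext => s; rewrite /symint; field.
Qed.

(** The defect $(1-r)/(1+r)$ is the value of the kernel at $\pi$, left by the integration by parts.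
    The other [symint n] vanish at $\pi$ and leave none. *)
Lemma poisson_functional_symint0 : poisson_functional (symint 0) = 1 - (1 - r) / (1 + r).
Proof.
pose F s := s * poisson s.
pose f s := poisson s * cos (0%:R * s) - dpoisson s * s.
have cid : continuous (fun s : R => s) by move=> s; exact: cvg_id.
have Id := integrable_dpoisson cid.
have dF s : is_derive s 1 F (f s).
  have := is_derive_poisson s => dP; apply: is_derive_eq.
  by rewrite /f /GRing.scale /= mul0r cos0; ring.
have cf : continuous f.
  move=> s; apply: cvgB.
    by apply: cvgM; [exact: continuous_poisson|exact: continuous_cosn].
  by apply: cvgM; [exact: continuous_dpoisson|exact: cid].
have := itv_int_FTC pi0 dF cf; rewrite itv_intB; [|exact: intP|exact: Id].
rewrite -/(poisson_coef _) poisson_coefE expr0 mulr1 /F mul0r subr0 => h.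
rewrite /poisson_functional (_ : (fun s => _) = fun s => 2 * (dpoisson s * s)); last first.
  by apply/funext => s; rewrite /symint; ring.
rewrite itv_intZ//.
have -> : itv_int 0 pi (fun s => dpoisson s * s) = pi - pi * poisson pi by lra.
rewrite /poisson /pden cospi.
have pn : pi != 0 :> R by rewrite gt_eqF.
have rn : 1 + r != 0 by rewrite gt_eqF// addr_gt0.
have -> : 1 - 2 * r * -1 + r ^+ 2 = (1 + r) ^+ 2 by ring.
by move: pi pn => p pn; field; rewrite pn rn.
Qed.

End PoissonKernel.

(** * Abel sums at the boundary from symmetric differences *)

Section AbelLimit.
Variable R : realType.
Implicit Types s t r : R.

(** Keeps [s - sin s] away from 0 as long as [s] is away from 0, so that a multiple of it can absorb
    any bounded error there. *)
Lemma sub_sin_lt s t : 0 <= s -> s < t -> t <= pi -> s - sin s < t - sin t.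
Proof.
move=> s0 st tp.
have [x xst E] : exists2 x, x \in `]s, t[%R & sin t - sin s = cos x * (t - s).
  by apply: (MVT st); apply: continuous_subspaceT; exact: continuous_sin.
move: xst; rewrite in_itv /= => /andP[sx xt].
have : cos x < 1.
  have x0 := le_lt_trans s0 sx; have xp := ltW (lt_le_trans xt tp).
  by rewrite -cos0 ltr_cos// in_itv /= ?lexx ?pi_ge0// xp ltW.
by move: E; nra.
Qed.

Variables (c : nat -> R) (B : R) (D : R -> R).
Hypothesis hB : forall N, \sum_(n < N) `|c n.+1| / n.+1%:R <= B.
Hypothesis hD : forall s, \sum_(n < N) c n * symint n s @[N --> \oo] --> D s.

Let W := 2 * pi * `|c 0%N| + 2 * B.

Lemma symint_sum_bound N s : 0 <= s <= pi -> `|\sum_(n < N) c n * symint n s| <= W.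
Proof.
move=> /andP[s0 sp]; have B0 : 0 <= B by have := hB 0; rewrite big_ord0.
case: N => [|N]; first by rewrite big_ord0 normr0 addr_ge0 ?mulr_ge0 ?pi_ge0.
rewrite big_ord_recl; apply: le_trans (ler_normD _ _) _; apply: lerD.
  rewrite normrM mulrC ler_wpM2r// /= ger0_norm ?mulr_ge0//.
  by rewrite ler_wpM2l.
apply: le_trans (ler_norm_sum _ _ _) _.
apply: le_trans (ler_wpM2l (_ : 0 <= 2) (hB N)) => //.
rewrite mulr_sumr; apply: ler_sum => n _ /=.
rewrite normrM mulrCA ler_wpM2l// normrM normrM normfV.
rewrite ger0_norm// [`|_%:R|]ger0_norm// ler_wpM2r ?invr_ge0//.
by rewrite -[leRHS]mulr1 ler_wpM2l// ler_norml sin_geN1 sin_le1.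
Qed.

Lemma symint_lim_bound s : 0 <= s <= pi -> `|D s| <= W.
Proof.
move=> sp; have h : `|\sum_(n < N) c n * symint n s| @[N --> \oo] --> `|D s|.
  by apply: cvg_norm; exact: hD.
rewrite -(cvg_lim (@Rhausdorff R) h).
by apply: limr_le; [exact: cvgP h|apply: nearW => N; exact: symint_sum_bound].
Qed.

Lemma measurable_symint_lim : measurable_fun setT D.
Proof.
apply: (measurable_fun_cvg (h := fun N s => \sum_(n < N) c n * symint n s)).
  move=> N; apply: continuous_measurable => s.
  apply: (cvg_real_sum (f := fun n s => c n * symint n s) (l := fun n => c n * symint n s)).
  by move=> n; apply: cvgMl_tmp; exact: continuous_symint.
by move=> s _; exact: hD.
Qed.

(** The functional maps each [symint n] to $r^n$, apart from the boundary term for [n = 0]; the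
    uniform bound [W] on the partial sums permits summing under the integral. *)
Lemma poisson_functional_lim r (A : R) : 0 < r < 1 ->
  \sum_(n < N) c n * r ^+ n @[N --> \oo] --> A ->
  itv_integrable 0 pi (fun s => dpoisson r s * D s) /\
  poisson_functional r D = A - (1 - r) / (1 + r) * c 0%N.
Proof.
move=> r01 hA.
pose f_ N s := dpoisson r s * \sum_(n < N) c n * symint n s.
have cs N : continuous (fun s => \sum_(n < N) c n * symint n s).
  move=> s; apply: (cvg_real_sum (f := fun n s => c n * symint n s)
    (l := fun n => c n * symint n s)).
  by move=> n; apply: cvgMl_tmp; exact: continuous_symint.
have mf N : measurable_fun setT (f_ N).
  apply: continuous_measurable => s; apply: cvgM; last exact: cs.
  exact: continuous_dpoisson.
have mD : measurable_fun setT (fun s => dpoisson r s * D s).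
  apply: measurable_funM; last exact: measurable_symint_lim.
  by apply: continuous_measurable; exact: continuous_dpoisson.
have [|||I cvI] := @itv_int_dominated _ 0 pi f_ (fun s => dpoisson r s * D s)
    (fun s => dpoisson r s * W) mf mD.
- by apply: aeW => s _; apply: cvgMl_tmp; exact: hD.
- by apply: integrable_dpoisson => // s; exact: cvg_cst.
- move=> N s sp; rewrite normrM ger0_norm ?dpoisson_ge0//.
  by rewrite ler_wpM2l ?dpoisson_ge0// symint_sum_bound.
split => //; pose k := (1 - r) / (1 + r).
have h1 : (2 * pi)^-1 * itv_int 0 pi (f_ N) @[N --> \oo] --> poisson_functional r D.
  exact: cvgMl_tmp.
(* Only nonempty partial sums contain the term of [c 0%N] that needs the correction, hence the index
   [N.+1]. *)
have E N : (2 * pi)^-1 * itv_int 0 pi (f_ N.+1) = \sum_(n < N.+1) c n * r ^+ n - k * c 0%N.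
  have Ik n : itv_integrable 0 pi (fun s => c n * (dpoisson r s * symint n s)).
    by apply: itv_integrableZ; apply: integrable_dpoisson => //; exact: continuous_symint.
  have -> : f_ N.+1 = fun s => \sum_(n < N.+1) c n * (dpoisson r s * symint n s).
    by apply/funext => s; rewrite /f_ mulr_sumr; apply: eq_bigr => n _; rewrite mulrCA.
  rewrite (itv_int_sum _ Ik).2 mulr_sumr.
  have Fn n : (2 * pi)^-1 * itv_int 0 pi (fun s => c n * (dpoisson r s * symint n s)) =
      c n * poisson_functional r (symint n).
    rewrite itv_intZ; first by rewrite mulrCA.
    by apply: integrable_dpoisson => //; exact: continuous_symint.
  under eq_bigr do rewrite Fn.
  rewrite !big_ord_recl /= poisson_functional_symint0// -/k expr0.
  rewrite mulrBr mulr1 [RHS]addrAC [k * _]mulrC; congr (_ + _).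
  by apply: eq_bigr => n _; rewrite poisson_functional_symintS.
have h2 : \sum_(n < N.+1) c n * r ^+ n - k * c 0%N @[N --> \oo] --> A - k * c 0%N.
  apply: cvgB; last exact: cvg_cst.
  by rewrite (cvg_shiftS (fun N => \sum_(n < N) c n * r ^+ n)).
have h3 : \sum_(n < N.+1) c n * r ^+ n - k * c 0%N @[N --> \oo] --> poisson_functional r D.
  rewrite (_ : (fun N => _) = fun N => (2 * pi)^-1 * itv_int 0 pi (f_ N.+1)).
    by rewrite (cvg_shiftS (fun N => (2 * pi)^-1 * itv_int 0 pi (f_ N))).
  by apply/funext => N; rewrite E.
by rewrite -(cvg_lim (@Rhausdorff R) h2) -(cvg_lim (@Rhausdorff R) h3).
Qed.

(* |D - 2 l s| <= eps (2 s) + K (2 s - 2 sin s) on [0, pi], and the positive functional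
   maps the two right-hand functions to 1 - (1 - r)/(1 + r) and to at most 1 - r. *)
Lemma Abel_limit (A : R -> R) (l : R) :
  (forall r, 0 < r < 1 -> \sum_(n < N) c n * r ^+ n @[N --> \oo] --> A r) ->
  (forall e : R, 0 < e -> exists2 d : R, 0 < d &
     forall s, 0 < s < d -> `|D s - l * (2 * s)| <= e * (2 * s)) ->
  A r @[r --> (1 : R)^'-] --> l.
Proof.
move=> hA hl; apply/cvgrPdist_le => e e0.
have e20 : 0 < e / 2 by rewrite divr_gt0.
have [d d0 hd] := hl _ e20.
pose d1 := Num.min (d / 2) pi.
have pi0 : 0 < pi :> R := pi_gt0 R.
have d10 : 0 < d1 by rewrite /d1 lt_min divr_gt0//= pi0.
have d1p : d1 <= pi by rewrite /d1 ge_min lexx orbT.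
have d1d : d1 < d by rewrite /d1 gt_min ltr_pdivrMr// mulr2n; lra.
pose g := d1 - sin d1.
have g0 : 0 < g.
  have := sub_sin_lt (lexx 0) d10 d1p; rewrite sin0 subr0; exact.
have D0 : D 0 = 0.
  have h : (fun N => \sum_(n < N) c n * symint n 0) @ \oo --> (0 : R).
    rewrite (_ : (fun N => _) = fun=> 0); first exact: cvg_cst.
    apply/funext => N; rewrite big1// => -[[|n] hn] _ /=; rewrite !mulr0// sin0.
    by rewrite mulr0 mul0r mulr0.
  by have := cvg_lim (@Rhausdorff R) (@hD 0); rewrite (cvg_lim (@Rhausdorff R) h) => <-.
(* On $[d_1,\pi]$ the error is at most the numerator, while $2(s-\sin s)\ge2g$. *)
pose K := (W + 2 * pi * `|l|) / (2 * g).
have B0 : 0 <= B by have := hB 0; rewrite big_ord0.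
have W0 : 0 <= W by rewrite /W addr_ge0 ?mulr_ge0 ?(ltW pi0).
have K0 : 0 <= K by rewrite /K divr_ge0 ?addr_ge0 ?mulr_ge0 ?(ltW pi0) ?(ltW g0).
have bound s : 0 <= s <= pi ->
    `|D s - l * symint 0 s| <= e / 2 * symint 0 s + K * (symint 0 s - symint 1 s).
  move=> /[dup] sp /andP[s0 spi]; rewrite /= divr1 mul1r.
  have ss : 0 <= s - sin s.
    have [->|sn] := eqVneq s 0; first by rewrite sin0 subr0.
    have := sub_sin_lt (lexx 0) (_ : 0 < s) spi; rewrite sin0 subr0 => /(_ _)/ltW; apply.
    by rewrite lt_def sn.
  have t2 : 0 <= K * (2 * s - 2 * sin s) by rewrite -mulrBr mulr_ge0// mulr_ge0.
  have [sd|ds] := ltP s d1.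
    have [->|sn] := eqVneq s 0.
      by rewrite D0 !mulr0 subr0 normr0 sin0 mulr0 subr0 mulr0 addr0.
    apply: le_trans (hd s _) _; last by rewrite lerDl.
    by rewrite lt_def sn s0 /= (lt_trans sd).
  apply: (@le_trans _ _ (W + 2 * pi * `|l|)).
    apply: le_trans (ler_normB _ _) _; apply: lerD; first exact: symint_lim_bound.
    rewrite normrM mulrC ler_wpM2r// ger0_norm ?mulr_ge0//.
    by rewrite ler_wpM2l.
  have gs : g <= s - sin s.
    move: ds; rewrite le_eqVlt => /predU1P[<-//|ds].
    by apply: ltW; exact: (sub_sin_lt (ltW d10) ds spi).
  apply: (@le_trans _ _ (K * (2 * g))); first by rewrite /K divfK// mulf_neq0// gt_eqF.
  rewrite -[leLHS]add0r; apply: lerD; first by rewrite !mulr_ge0// ltW.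
  by rewrite ler_wpM2l// -mulrBr ler_wpM2l.
(* Three errors, each at most a multiple of [1 - r]: [K] from the comparison function, [c 0%N] from
   the boundary term, and [l] from the defect of the functional on [symint 0]. The later [V + 1]
   only ensures a positive divisor. *)
pose V := K + `|c 0%N| + `|l|.
have V0 : 0 <= V by rewrite /V !addr_ge0.
have V1 : 0 < V + 1 by rewrite ltr_wpDl.
near=> r.
have r01 : 0 < r < 1 by apply/andP; split; near: r; [exact: nbhs_left_gt|exact: nbhs_left_lt].
have [r0 r1] := andP r01.
have [I E] := poisson_functional_lim r01 (hA r r01).
set k := (1 - r) / (1 + r) in E.
have k0 : 0 <= k by rewrite /k divr_ge0; lra.
have k1 : k <= 1 - r.
  rewrite /k ler_pdivrMr; last lra.
  by nra.
have p2 : 0 < 2 * pi :> R by rewrite mulr_gt0.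
have I0 := integrable_dpoisson r01 (@continuous_symint R 0).
have I1 := integrable_dpoisson r01 (@continuous_symint R 1).
have F0 := poisson_functional_symint0 r01.
have F1 := poisson_functional_symintS r01 0.
pose up s := (e / 2 + K) * (dpoisson r s * symint 0 s) - K * (dpoisson r s * symint 1 s).
have Iup : itv_integrable 0 pi up.
  rewrite /up; under eq_fun do rewrite -mulNr.
  by apply: itv_integrableD; exact: itv_integrableZ.
have Eup : (2 * pi)^-1 * itv_int 0 pi up = (e / 2 + K) * (1 - k) - K * r.
  rewrite /up itv_intB; [|exact: itv_integrableZ..].
  rewrite !itv_intZ// -[r in RHS]expr1 -F1 -F0 /poisson_functional; ring.
have EL : poisson_functional r D - l * (1 - k) = A r - k * c 0%N - l * (1 - k) by rewrite E.
have up1 : poisson_functional r D - l * (1 - k) <= (e / 2 + K) * (1 - k) - K * r.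
  rewrite -Eup -F0 lerBlDr /poisson_functional mulrCA -mulrDr ler_wpM2l ?invr_ge0 ?(ltW p2)//.
  rewrite -itv_intZ// -itv_intD//; last exact: itv_integrableZ.
  apply: itv_int_le => //; first by apply: itv_integrableD => //; exact: itv_integrableZ.
  move=> s sp; have := bound s sp; rewrite ler_norml => /andP[_ h].
  have q0 := dpoisson_ge0 r01 sp; rewrite /up.
  have := ler_wpM2l q0 h; move: (dpoisson r s) (D s) (symint 0 s) (symint 1 s) => q x y z; lra.
have up2 : - ((e / 2 + K) * (1 - k) - K * r) <= poisson_functional r D - l * (1 - k).
  rewrite -Eup -F0 lerBrDr -mulrN /poisson_functional [l * _]mulrCA -mulrDr ler_wpM2l ?invr_ge0 ?(ltW p2)//.
  rewrite -mulN1r -!itv_intZ// -itv_intD//; last 2 first.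
  - exact: itv_integrableZ.
  - exact: itv_integrableZ.
  apply: itv_int_le => //; first by apply: itv_integrableD => //; exact: itv_integrableZ.
  move=> s sp; have := bound s sp; rewrite ler_norml => /andP[h _].
  have q0 := dpoisson_ge0 r01 sp; rewrite /up.
  have := ler_wpM2l q0 h; move: (dpoisson r s) (D s) (symint 0 s) (symint 1 s) => q x y z; lra.
have key : `|A r - l| <= e / 2 + (K + `|c 0%N| + `|l|) * (1 - r).
  have c0 := ler_norm (c 0%N); have c0' := ler_norm (- c 0%N); rewrite normrN in c0'.
  have l0 := ler_norm l; have l0' := ler_norm (- l); rewrite normrN in l0'.
  rewrite EL in up1 up2; rewrite ler_norml; apply/andP; split; nra.
rewrite distrC; apply: le_trans key _.
rewrite [leRHS](splitr e) lerD2l.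
rewrite -/V.
have rV : 1 - e / 2 / (V + 1) < r.
  by near: r; apply: nbhs_left_gt; rewrite gtrBl divr_gt0.
apply: (@le_trans _ _ ((V + 1) * (1 - r))).
  by rewrite ler_wpM2r ?subr_ge0 ?(ltW r1)// lerDl.
by rewrite mulrC -ler_pdivlMr// lerBlDr -lerBlDl ltW.
Unshelve. all: by end_near. Qed.

End AbelLimit.

(** * Fatou's theorem on radial limits *)

Section Fatou.
Variable R : realType.
Local Notation C := R[i].
Local Notation normc := (@Normc.normc R).
Local Notation mu := (@lebesgue_measure R).
Local Notation twopi := (pi *+ 2 : R).
Variable a : nat -> C.
Hypothesis Ha : H2 a.
Implicit Types s t r : R.

Let cf n t : R := complex.Re (a n * expi t ^+ n).

Definition antideriv n t : R :=
  if n is k.+1 then k.+1%:R^-1 *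
    (complex.Re (a k.+1) * sin (k.+1%:R * t) + complex.Im (a k.+1) * cos (k.+1%:R * t))
  else complex.Re (a 0) * t.

Lemma is_derive_antideriv n t : is_derive t 1 (antideriv n) (cf n t).
Proof.
case: n => [|n] /=.
  by rewrite /cf expr0 mulr1; apply: is_derive_eq; rewrite /= /GRing.scale /= mulr1.
have n0 : n.+1%:R != 0 :> R by rewrite pnatr_eq0.
apply: is_derive_eq; rewrite /cf Re_mul_expi /GRing.scale /=.
by move: (n.+1%:R) n0 => q q0; field.
Qed.

(** The symmetric difference factors into a coefficient depending on [t] alone and a function of [s]
    alone, the shape that [Abel_limit] requires. *)
Lemma antideriv_symint n t s :
  antideriv n (t + s) - antideriv n (t - s) = cf n t * symint n s.
Proof.
case: n => [|n] /=; first by rewrite /cf expr0 mulr1; ring.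
rewrite /cf Re_mul_expi !mulrDr !sinD !cosD !mulrN !sinN !cosN.
move: (sin _) (cos _) (sin _) (cos _) (n.+1%:R^-1) => x1 x2 x3 x4 q; ring.
Qed.

Let Bw := sqnorm a + 2.

(** From $xy\le x^2+y^2$; the 2 in [Bw] bounds $\sum 1/n^2$. *)
Lemma weights_bound N : \sum_(n < N) normc (a n.+1) / n.+1%:R <= Bw.
Proof.
(* A telescoping bound: with $x=K+1$, the induction step leaves the surplus $1/(x(x+1)^2)$. *)
have sq K : \sum_(n < K.+1) (n.+1%:R^-1 : R) ^+ 2 <= 2 - K.+1%:R^-1.
  elim: K => [|K IH]; first by rewrite big_ord1 invr1 expr1n; lra.
  rewrite big_ord_recr /=; apply: le_trans (lerD IH (lexx _)) _.
  have k0 : 0 < K.+1%:R :> R by [].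
  rewrite -[K.+2%:R]natr1; move: (K.+1%:R) k0 => x k0.
  rewrite -subr_ge0 (_ : _ - _ = (x * (x + 1) ^+ 2)^-1).
    by rewrite invr_ge0 mulr_ge0 ?sqr_ge0// ltW.
  by field; rewrite !gt_eqF// addr_gt0.
apply: (@le_trans _ _ (\sum_(n < N) (normc (a n.+1) ^+ 2 + n.+1%:R^-1 ^+ 2))).
  apply: ler_sum => n _; move: (normc _) (n.+1%:R^-1) => x y.
  by have := sqr_ge0 (x - y); have := sqr_ge0 x; have := sqr_ge0 y; nra.
rewrite big_split /=; apply: lerD.
  apply: le_trans (sum_le_sqnorm N.+1 Ha).
  by rewrite big_ord_recl /= lerDr sqr_ge0.
case: N => [|N]; first by rewrite big_ord0.
by apply: le_trans (sq N) _; rewrite gerBl invr_ge0.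
Qed.

Lemma antideriv_bound n t : `|antideriv n.+1 t| <= 2 * (normc (a n.+1) / n.+1%:R).
Proof.
rewrite /= normrM normfV (@ger0_norm _ n.+1%:R)//.
rewrite [leRHS](_ : _ = n.+1%:R^-1 * (2 * normc (a n.+1))); last by rewrite mulrA mulrC.
rewrite ler_wpM2l ?invr_ge0//.
apply: le_trans (ler_normD _ _) _; rewrite !normrM mulrDl !mul1r; apply: lerD.
  rewrite -[leRHS]mulr1; apply: ler_pM => //; first exact: norm_Re_le.
  by rewrite ler_norml sin_geN1 sin_le1.
rewrite -[leRHS]mulr1; apply: ler_pM => //; first exact: norm_Im_le.
by rewrite ler_norml cos_geN1 cos_le1.
Qed.

Definition primitive t : R := limn (series (fun n => antideriv n t)).

Lemma primitive_cvg t : series (fun n => antideriv n t) @ \oo --> primitive t.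
Proof.
apply: normed_cvg.
apply: (@ge0_series_bounded_cvg _ _ (`|antideriv 0 t| + 2 * Bw)) => [n|[|N]].
- exact: normr_ge0.
- by rewrite big_ord0 addr_ge0// mulr_ge0// addr_ge0// sqnorm_ge0.
rewrite big_ord_recl lerD2l; apply: le_trans (ler_wpM2l (_ : 0 <= 2) (weights_bound N)) => //.
by rewrite mulr_sumr; apply: ler_sum => n _; exact: antideriv_bound.
Qed.

Lemma radial_limit_of_derivative t (l : R) : is_derive t 1 primitive l ->
  complex.Re (psum a (r%:C%C * expi t)) @[r --> (1 : R)^'-] --> l.
Proof.
move=> dp.
apply: (@Abel_limit _ (cf^~ t) Bw (fun s => primitive (t + s) - primitive (t - s))).
- move=> N; apply: le_trans (weights_bound N); apply: ler_sum => n _.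
  rewrite ler_wpM2r ?invr_ge0//; apply: le_trans (norm_Re_le _) _.
  by rewrite Normc.normcM normcX normc_expi expr1n mulr1.
- move=> s.
  rewrite (_ : (fun N => _) = fun N => series (fun n => antideriv n (t + s)) N -
     series (fun n => antideriv n (t - s)) N).
    by apply: cvgB; exact: primitive_cvg.
  apply/funext => N; rewrite !seriesEord /= -sumrB.
  by apply: eq_bigr => n _; rewrite antideriv_symint.
- move=> r /andP[r0 r1].
  have rr : 0 <= r < 1 by rewrite ltW.
  have [+ _] := (cvg_complex_ReIm _ _).1 (psum_cvg Ha (disc_polar t rr)).
  rewrite (_ : (fun x => complex.Re _) = fun N => \sum_(n < N) cf n t * r ^+ n)//.
  apply/funext => N; rewrite seriesEord /= Re_sum; apply: eq_bigr => n _.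
  rewrite /cf exprMn -rmorphXn mulrCA; case: (a n * _) => x y /=; ring.
- move=> e e0.
  have /cvgrPdist_le/(_ e e0) : h^-1 *: (primitive (h + t) - primitive t) @[h --> 0^'] --> l.
    case: dp => dd <-; rewrite (_ : (fun h => _) =
      fun h => h^-1 *: ((primitive \o shift t) (h *: 1) - primitive t)) //.
    by apply/funext => h; rewrite /= /shift [h *: 1]mulr1.
  case=> d /= d0 hd; exists d => // s /andP[s0 sd].
  have key h : h != 0 -> `|h| < d -> `|primitive (h + t) - primitive t - l * h| <= e * `|h|.
    move=> hn hd'; have := hd h; rewrite /= sub0r normrN => /(_ hd' hn).
    rewrite /GRing.scale /=; move: (primitive (h + t) - primitive t) => X hh.
    have -> : X - l * h = - h * (l - h^-1 * X) by field.
    by rewrite normrM normrN mulrC ler_wpM2r.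
  have sn : s != 0 by rewrite gt_eqF.
  have k1 := key s sn; have k2 := key (- s).
  rewrite oppr_eq0 normrN gtr0_norm// in k2; rewrite gtr0_norm// in k1.
  have {}k1 := k1 sd; have {}k2 := k2 sn sd.
  rewrite [t + s]addrC [t - s]addrC.
  move: k1 k2; rewrite !ler_norml => /andP[h1 h2] /andP[h3 h4].
  by apply/andP; split; lra.
Qed.

Section PartialSums.
Variable N_ : nat -> nat.
Hypothesis N_ge : forall k, (k <= N_ k)%N.
Hypothesis N_tail : forall k, sqnorm (tail a (N_ k)) <= 16^-1 ^+ k.

Let T k t : R := complex.Re (1 * trigpoly a (N_ k) t).
Let u k t : R := `|T k.+1 t - T k t|.

Lemma continuous_T k : continuous (T k).
Proof. exact: continuous_Re_trigpoly. Qed.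

Let cu k : continuous (u k).
Proof. by move=> t; apply: cvg_norm; apply: cvgB; exact: continuous_T. Qed.

Let d k : nat -> C := tail a (N_ k) - tail a (N_ k.+1).
Let M k := maxn (N_ k) (N_ k.+1).

Let trig_tail n K t : (n <= K)%N -> trigpoly a n t = trigpoly (a - tail a n) K t.
Proof.
move=> nK; rewrite /trigpoly.
rewrite -!(big_mkord xpredT (fun k => a k * expi t ^+ k)).
rewrite -(big_mkord xpredT (fun k => (a - tail a n) k * expi t ^+ k)).
rewrite [RHS](big_cat_nat (n := n) _ nK)//= [X in _ = _ + X](_ : _ = 0) ?addr0.
  rewrite big_nat [RHS]big_nat; apply: eq_bigr => k /andP[_ kn].
  by rewrite !fctE /tail kn subr0.
rewrite big_nat big1// => k /andP[nk _].
by rewrite !fctE /tail ltnNge nk subrr mul0r.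
Qed.

Let T_diff k t : T k.+1 t - T k t = complex.Re (trigpoly (d k) (M k) t).
Proof.
rewrite /T !mul1r (trig_tail t (leq_maxl (N_ k) (N_ k.+1))).
rewrite (trig_tail t (leq_maxr (N_ k) (N_ k.+1))) /trigpoly !Re_sum -sumrB.
apply: eq_bigr => n _; rewrite /d !fctE.
by rewrite -raddfB /= -mulrBl; congr (complex.Re (_ * _)); ring.
Qed.

Let sq_d k : \sum_(n < M k) normc (d k n) ^+ 2 <= 4 * 16^-1 ^+ k.
Proof.
have H1 := H2_tail (N_ k) Ha; have H2' := H2_tail (N_ k.+1) Ha.
apply: le_trans (sum_le_sqnorm _ (H2_sub H1 H2')) _.
rewrite sqnormB//.
have cs := Cauchy_Schwarz H1 H2'.
have h1 := N_tail k; have h2 := N_tail k.+1.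
have := norm_Re_le (h2inner (tail a (N_ k)) (tail a (N_ k.+1))).
have p1 := sqnorm_ge0 H1; have p2 := sqnorm_ge0 H2'.
have e0 : 0 <= 16^-1 ^+ k :> R by rewrite exprn_ge0.
have h2' : sqnorm (tail a (N_ k.+1)) <= 16^-1 ^+ k.
  by apply: le_trans h2 _; rewrite exprS ler_piMl// invf_le1//; lra.
have n0 := normc_ge0 (h2inner (tail a (N_ k)) (tail a (N_ k.+1))).
rewrite ler_norml => /andP[lo _].
have ub : normc (h2inner (tail a (N_ k)) (tail a (N_ k.+1))) <= 16^-1 ^+ k.
  rewrite -(@ler_pXn2r _ 2)// ?nnegrE//; apply: le_trans cs _.
  by rewrite expr2 ler_pM.
lra.
Qed.

Variable L : nat.
Hypothesis L0 : (0 < L)%N.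
(** The interval $[-2\pi L,2\pi L]$, written as a whole number of periods so that
    [trigpoly_Parseval] applies. *)
Let x0 : R := - (twopi *+ L).
Let b : R := x0 + twopi *+ L.*2.

Let L20 : (0 < L.*2)%N. Proof. by rewrite double_gt0. Qed.
Let x0b : x0 < b. Proof. exact: lt_period. Qed.

(** In $x\le1/q+qx^2$ the weight $q=4^k$ balances the two terms: the mean square of the difference
    is at most $4\cdot16^{-k}$, which leaves $(1+4)4^{-k}$. The rate $16^{-k}$ in [N_tail] is chosen
    to make this summable. *)
Let int_u k : itv_int x0 b (u k) <= 5 * (b - x0) * 4^-1 ^+ k.
Proof.
have Iu : itv_integrable x0 b (u k) by apply: continuous_itv_integrable; exact: cu.
pose f t := normc (trigpoly (d k) (M k) t) ^+ 2.
have If : itv_integrable x0 b f.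
  by apply: continuous_itv_integrable; exact: continuous_sqr_normc_trigpoly.
have Ic : itv_integrable x0 b (fun=> 4^-1 ^+ k).
  by apply: continuous_itv_integrable => x; exact: cvg_cst.
apply: (@le_trans _ _ (itv_int x0 b (fun t => 4^-1 ^+ k + 4 ^+ k * f t))).
  apply: itv_int_le => //; first by apply: itv_integrableD => //; exact: itv_integrableZ.
  move=> t _; rewrite /u T_diff.
  apply: le_trans (norm_Re_le _) _; rewrite /f.
  have q0 : 0 < 4 ^+ k :> R by rewrite exprn_gt0.
  rewrite exprVn; move: (4 ^+ k) (normc _) q0 (normc_ge0 (trigpoly (d k) (M k) t)) => q x q0 _.
  have -> : q^-1 + q * x ^+ 2 = x + q * (x - (2 * q)^-1) ^+ 2 + 3 / 4 * q^-1.
    by field; rewrite gt_eqF.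
  have q1 : 0 <= q^-1 by rewrite invr_ge0 ltW.
  have q2 : 0 <= q * (x - (2 * q)^-1) ^+ 2 by rewrite mulr_ge0 ?sqr_ge0// ltW.
  lra.
rewrite itv_intD//; last exact: itv_integrableZ.
rewrite itv_intZ// itv_int_cst// (trigpoly_Parseval _ L20).
have bx : 0 <= b - x0 by rewrite subr_ge0 ltW.
have h : 4 ^+ k * (4 * 16^-1 ^+ k) = 4 * 4^-1 ^+ k :> R.
  by rewrite mulrCA -exprMn; congr (_ * _ ^+ _); field.
have q0 : 0 <= 4 ^+ k :> R by rewrite exprn_ge0.
have h1 := ler_wpM2l bx (sq_d k).
have h2 := ler_wpM2l q0 h1.
apply: le_trans (lerD (lexx _) h2) _.
rewrite [4 ^+ k * _]mulrCA h; lra.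
Qed.

Let Phi t : \bar R := (\sum_(0 <= k <oo) (u k t)%:E)%E.

Let mu_u k : measurable_fun setT (EFin \o u k).
Proof. by apply/measurable_EFinP; apply: continuous_measurable; exact: cu. Qed.

Let mPhi : measurable_fun setT Phi.
Proof.
apply: (ge0_emeasurable_sum (P := xpredT)) => [k t _ _|k _]; last exact: mu_u.
by rewrite lee_fin normr_ge0.
Qed.

Let intPhi : mu.-integrable `[x0, b] Phi.
Proof.
apply/integrableP; split; first exact: measurable_funTS mPhi.
have Phi0 t : (0 <= Phi t)%E by apply: nneseries_ge0 => k _ _; rewrite lee_fin normr_ge0.
under eq_integral do rewrite gee0_abs//.
rewrite integral_nneseries//; last 2 first.
- by move=> k; apply: measurable_funTS; exact: mu_u.
- by move=> k t _; rewrite lee_fin normr_ge0.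
have Iu k : itv_integrable x0 b (u k) by apply: continuous_itv_integrable; exact: cu.
have e1 k : (\int[mu]_(x in `[x0, b]) (u k x)%:E = (itv_int x0 b (u k))%:E)%E.
  rewrite /itv_int /Rintegral fineK//; exact: integrable_fin_num (Iu k).
apply: (@le_lt_trans _ _ (\sum_(0 <= k <oo) (5 * (b - x0) * 4^-1 ^+ k)%:E)%E).
  apply: lee_nneseries => k _; rewrite ?e1 ?lee_fin; last exact: int_u.
  by move=> _; apply: Rintegral_ge0 => t _; exact: normr_ge0.
have cg : cvgn (series (fun k => 5 * (b - x0) * 4^-1 ^+ k)).
  by apply: (is_cvg_geometric_series (a := 5 * (b - x0)) (z := 4^-1)); rewrite gtr0_norm// invf_lt1//; lra.
rewrite (_ : (fun n => _) = EFin \o series (fun k => 5 * (b - x0) * 4^-1 ^+ k)).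
  by rewrite EFin_lim// ltry.
by apply/funext => n /=; rewrite sumEFin.
Qed.

Let good : set R := `[x0, b] `&` [set t | (Phi t < +oo)%E].

Let mgood : measurable good.
Proof.
apply: emeasurable_fun_infty_o => //; exact: measurable_funTS mPhi.
Qed.

Let T_sum k t : T k t = T 0 t + series (fun j => T j.+1 t - T j t) k.
Proof.
rewrite seriesEord /=; elim: k => [|k IH]; first by rewrite big_ord0 addr0.
by rewrite big_ord_recr /= addrA -IH addrC subrK.
Qed.

Let cvgT t : good t -> cvgn (T^~ t).
Proof.
move=> [_ /= h].
have cu' : cvgn (series (u^~ t)) by apply: nnseries_is_cvg => // k; exact: normr_ge0.
have cd : cvgn (series (fun j => T j.+1 t - T j t)) by exact: normed_cvg.
rewrite (_ : T^~ t = fun k => T 0 t + series (fun j => T j.+1 t - T j t) k).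
  by apply: is_cvgD => //; exact: is_cvg_cst.
by apply/funext => k; exact: T_sum.
Qed.

(** Setting the partial sums to zero off [good] makes them converge everywhere, so that [g] is
    measurable as an everywhere pointwise limit. *)
Let g t : R := limn (fun k => (T k \_ good) t).

Let cvg_restr t : (T k \_ good) t @[k --> \oo] --> g t.
Proof.
rewrite /g; have [tg|tg] := pselect (good t).
  rewrite (_ : (fun k => _) = T^~ t); first exact: cvgT.
  by apply/funext => k; rewrite patchE mem_set.
rewrite (_ : (fun k => _) = fun=> 0); first exact: is_cvg_cst.
by apply/funext => k; rewrite patchE memNset.
Qed.

Let mg : measurable_fun setT g.
Proof.
apply: (measurable_fun_cvg (h := fun k => T k \_ good)).
  move=> k; apply/(measurable_restrictT _ _).1 => //.
  by apply: measurable_funTS; apply: continuous_measurable; exact: continuous_T.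
by move=> t _; exact: cvg_restr.
Qed.

Let ae_good : {ae mu, forall t, x0 <= t <= b -> T k t @[k --> \oo] --> g t}.
Proof.
have : {ae mu, forall t, `[x0, b]%classic t -> Phi t \is a fin_num}.
  exact: (integrable_ae _ intPhi).
apply: filterS; first exact: (ae_filter_ringOfSetsType mu).
move=> t h tab; have Dt : `[x0, b]%classic t by rewrite /= in_itv.
have gt : good t by split=> //=; rewrite ltey_eq h.
have := @cvg_restr t; rewrite (_ : (fun k => (T k \_ good) t) = T^~ t)//.
by apply/funext => k; rewrite patchE mem_set.
Qed.

Let dominated_T k t : (`|T k t|%:E <= `|T 0 t|%:E + Phi t)%E.
Proof.
have h : `|T k t| <= `|T 0 t| + \sum_(j < k) u j t.
  rewrite T_sum seriesEord /=; apply: le_trans (ler_normD _ _) _.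
  by rewrite lerD2l; exact: ler_norm_sum.
apply: (@le_trans _ _ (`|T 0 t| + \sum_(j < k) u j t)%:E); first by rewrite lee_fin.
rewrite EFinD leeD2l// -sumEFin -(big_mkord xpredT (fun j => (u j t)%:E)).
by apply: nneseries_lim_ge => j _ _; rewrite lee_fin normr_ge0.
Qed.

(** Identifies [primitive], so far only the sum of a series, with an indefinite integral of an
    integrable function, which is what Lebesgue differentiation needs. The integrals of the partial
    sums are differences of partial sums of that series. *)
Let int_g y : x0 < y -> y <= b ->
  itv_integrable x0 y g /\ itv_int x0 y g = primitive y - primitive x0.
Proof.
move=> xy yb.
have mT k : measurable_fun setT (T k).
  by apply: continuous_measurable; exact: continuous_T.
have sub : `[x0, y]%classic `<=` `[x0, b]%classic.
  by move=> t /=; rewrite !in_itv /= => /andP[-> /le_trans ->].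
have [|||I cvI] := @itv_int_dominated_ereal _ x0 y T g (fun t => `|T 0 t|%:E + Phi t)%E mT mg.
- move: ae_good; apply: filterS; first exact: (ae_filter_ringOfSetsType mu).
  by move=> t h /andP[h1 h2]; apply: h; rewrite h1 (le_trans h2).
- apply: (@integrableS _ _ _ mu `[x0, b]%classic) => //; apply: integrableD => //.
  apply: continuous_itv_integrable => t; apply: cvg_norm; exact: continuous_T.
- by move=> k t _; exact: dominated_T.
split => //.
have E k : itv_int x0 y (T k) = series (fun n => antideriv n y) (N_ k) -
    series (fun n => antideriv n x0) (N_ k).
  have TE : T k = fun t => \sum_(n < N_ k) cf n t.
    by apply/funext => t; rewrite /T mul1r /trigpoly Re_sum.
  have Ic n : itv_integrable x0 y (cf n).
    by apply: continuous_itv_integrable; exact: continuous_Re_expi.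
  rewrite TE (itv_int_sum _ Ic).2 !seriesEord /= -sumrB; apply: eq_bigr => n _.
  exact: (itv_int_FTC xy (is_derive_antideriv n) (@continuous_Re_expi _ (a n) n)).
have Noo : N_ k @[k --> \oo] --> \oo.
  move=> A [m _ hm]; exists m => // k /= mk; apply: hm => /=.
  exact: leq_trans mk (N_ge k).
have h : itv_int x0 y (T k) @[k --> \oo] --> primitive y - primitive x0.
  rewrite (_ : (fun k => _) = fun k => series (fun n => antideriv n y) (N_ k) -
    series (fun n => antideriv n x0) (N_ k)); last by apply/funext.
  by apply: cvgB; apply: (cvg_comp _ _ Noo); exact: primitive_cvg.
by rewrite -(cvg_lim (@Rhausdorff R) h) -(cvg_lim (@Rhausdorff R) cvI).
Qed.

Lemma ae_derivable_primitive_itv :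
  {ae mu, forall t, x0 < t < b -> derivable primitive t 1}.
Proof.
have [Ib _] := int_g x0b (lexx b).
(* Extension by zero: [FTC1] is applied to a function that is locally integrable on the whole
   line. *)
pose gg := g \_ `[x0, b]%classic.
have loc : locally_integrable [set: R] gg by exact: integrable_locally.
have Igg y : mu.-integrable [set` Interval (BLeft x0) (BRight y)] (EFin \o gg).
  apply: (@integrableS _ _ _ mu setT) => //.
  by rewrite /gg -restrict_EFin; apply/(integrable_mkcond _ _).1.
have := FTC1 Igg loc; apply: filterS; first exact: (ae_filter_ringOfSetsType mu).
move=> t /= h /andP[xt tb]; have [|dF _] := h.
  by rewrite lte_fin.
apply: near_eq_derivable (_ : derivable (fun y => itv_int x0 y gg + primitive x0) t 1); last first.
  exact: derivableD.
near=> y.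
have xy : x0 < y by near: y; exact: lt_nbhsr.
have yb : y < b by near: y; exact: lt_nbhsl.
have [_] := int_g xy (ltW yb).
have -> : itv_int x0 y g = itv_int x0 y gg.
  apply: eq_Rintegral => z /[!inE] /=; rewrite in_itv /= => /andP[z1 z2].
  by rewrite /gg patchE mem_set//= in_itv /= z1 (le_trans z2)// ltW.
by move=> ->; rewrite subrK.
Unshelve. all: by end_near. Qed.

End PartialSums.

Lemma ae_derivable_primitive : {ae mu, forall t, derivable primitive t 1}.
Proof.
have exN k : exists N, (k <= N)%N /\ sqnorm (tail a N) <= 16^-1 ^+ k.
  have e0 : 0 < 16^-1 ^+ k :> R by rewrite exprn_gt0.
  have /cvgrPdist_le/(_ _ e0)[N _ hN] := sqnorm_tail_cvg Ha.
  exists (maxn k N); split; first exact: leq_maxl.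
  have := hN (maxn k N) (leq_maxr k N); rewrite /= sub0r normrN.
  by apply: le_trans; exact: ler_norm.
have [N_ hN] := choice exN.
have : {ae mu, forall t, forall L, - (twopi *+ L.+1) < t < - (twopi *+ L.+1) + twopi *+ L.+1.*2 ->
    derivable primitive t 1}.
  apply: ae_foralln => L; apply: (@ae_derivable_primitive_itv N_) => //.
  - by move=> k; have [] := hN k.
  - by move=> k; have [] := hN k.
apply: filterS; first exact: (ae_filter_ringOfSetsType mu).
move=> t h.
have tp : 1 <= twopi by rewrite mulr2n; have := pi_ge2 R; lra.
pose L := Num.bound `|t|.
apply: (h L).
have : `|t| < twopi *+ L.+1.
  apply: lt_le_trans (archi_boundP (normr_ge0 t)) _.
  rewrite -[leRHS]mulr_natl; apply: (@le_trans _ _ (L.+1%:R * 1)); last by rewrite ler_wpM2l.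
  by rewrite mulr1 ler_nat.
rewrite -addnn mulrnDr addrA addNr add0r ltr_norml; exact.
Qed.

Lemma Fatou_Re : {ae mu, forall t, exists l : R,
  complex.Re (psum a (r%:C%C * expi t)) @[r --> (1 : R)^'-] --> l}.
Proof.
apply: filterS ae_derivable_primitive; first exact: (ae_filter_ringOfSetsType mu).
move=> t /derivableP h; exists ('D_1 primitive t).
exact: radial_limit_of_derivative.
Qed.

End Fatou.

Lemma Fatou (R : realType) (a : nat -> R[i]) : H2 a ->
  {ae (@lebesgue_measure R), forall t : R, exists w : R[i],
    psum a ((r%:C)%C * expi t) @[r --> (1 : R)^'-] --> w}.
Proof.
(* The imaginary part of a number is the real part of its product with $-i$. *)
move=> Ha; have Hb := H2_scale (- 'i%C) Ha.
have FF := ae_filter_ringOfSetsType (@lebesgue_measure R).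
have := Fatou_Re Hb; have := Fatou_Re Ha; apply: filterS2 => t [x hx] [y hy]; exists (x +i* y)%C.
apply/cvg_complex_ReIm; split => //=.
move: hy; apply: cvg_trans; apply: near_eq_cvg; near=> r.
have r01 : 0 <= r < 1.
  by apply/andP; split; near: r; [exact: nbhs_left_ge|exact: nbhs_left_lt].
rewrite psum_scale//; last exact: disc_polar.
by case: (psum a _) => p q /=; ring.
Unshelve. all: by end_near. Qed.

(** * The model space and the adjoint of the compressed shift *)

Section ModelSpace.
Variable R : realType.
Local Notation C := R[i].
Local Notation normc := (@Normc.normc R).
Local Notation S := (@Defs.shift R).
Implicit Types (a b c d f g u x y : nat -> C) (z w : C).

Definition orth u : set (nat -> C) :=
  [set a | H2 a /\ forall k, h2inner a (iter k S u) = 0].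

Lemma iter_backshiftE k b n : iter k (@backshift R) b n = b (n + k)%N.
Proof.
elim: k b n => [|k IH] b n; first by rewrite addn0.
by rewrite iterS /backshift IH addSnnS.
Qed.

Lemma h2inner_approx f g : H2 f -> H2 g ->
  (forall e : R, 0 < e -> exists v, [/\ H2 v, h2inner v g = 0 & sqnorm (f - v) < e]) ->
  h2inner f g = 0.
Proof.
move=> Hf Hg h; apply/eqP; rewrite -normc_eq0 -sqrf_eq0; apply/eqP/le_anti.
rewrite sqr_ge0 andbT; apply/ler_addgt0Pr => e e0; rewrite add0r.
have Q : 0 < sqnorm g + 1 by rewrite ltr_wpDl// sqnorm_ge0.
have [|v [Hv v0 hv]] := h (e / (sqnorm g + 1)); first by rewrite divr_gt0.
have -> : h2inner f g = h2inner (f - v) g by rewrite h2innerBl// v0 subr0.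
apply: le_trans (Cauchy_Schwarz (H2_sub Hf Hv) Hg) _.
apply: (@le_trans _ _ (e / (sqnorm g + 1) * (sqnorm g + 1))).
  apply: ler_pM; rewrite ?sqnorm_ge0 ?(ltW hv) ?lerDl//; exact: H2_sub.
by rewrite divfK// gt_eqF.
Qed.

Section Orth.
Variable u : nat -> C.
Hypothesis ou : shift_orthonormal u.
Let uK := orthonormal_multiplier ou.

Lemma orth_cauchy_prod a c : orth u a -> H2 c -> h2inner (cauchy_prod u c) a = 0.
Proof.
move=> [Ha a0] Hc; apply: (h2inner_conv_eq0 uK) => // k.
by rewrite h2innerC ?a0 ?conjc0//; exact: orthonormal_H2.
Qed.

Lemma orth_backshift a : orth u a -> orth u (backshift a).
Proof.
move=> [Ha a0]; have Hb := H2_backshift Ha; split => // k.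
have Hk := orthonormal_H2 ou k.
rewrite h2innerC// -h2inner_shift_backshift// -iterS h2innerC//.
  by rewrite a0 !conjc0.
exact: H2_shift.
Qed.

Lemma orth_iter_backshift k a : orth u a -> orth u (iter k (@backshift R) a).
Proof. by move=> oa; elim: k => //= k IH; exact: orth_backshift. Qed.

(** Multiplication by [u] is isometric, so the projection onto $uH^2$ is explicit: [u] times the
    sequence of coefficients of [f] against the shifts of [u]. Existence is what guarantees that
    [projH] does not return its default value. *)
Lemma orth_projection f : H2 f ->
  exists g, orth u g /\ forall k, orth u k -> h2inner (fun n => f n - g n) k = 0.
Proof.
move=> Hf; pose d k := h2inner f (iter k S u).
have [Hd _] := Bessel ou Hf; have Hud := H2_conv uK Hd.
exists (f - cauchy_prod u d); split.
  split; first exact: H2_sub.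
  by move=> k; rewrite h2innerBl ?(h2inner_conv_shift ou) ?subrr//; exact: orthonormal_H2.
move=> k ok; rewrite (_ : (fun n => _) = cauchy_prod u d).
  exact: orth_cauchy_prod.
by apply/funext => n; rewrite !fctE opprB addrC subrK.
Qed.

End Orth.

Variables (m : C -> C) (mh : nat -> C).
Hypothesis om : shift_orthonormal mh.
Hypothesis mE : forall z, disc z -> m z = psum mh z.

Let Hmh : H2 mh. Proof. by case: om. Qed.

Lemma model_spaceE : model_space m = orth mh.
Proof.
apply/seteqP; split => a [Ha h]; split => //.
- move=> k; apply: h; split; first exact: H2_iter_shift.
  have Hk : H2 (iter k S (@unit_seq R)) by apply: H2_iter_shift; exact: H2_unit_seq.
  exists (iter k S (@unit_seq R)); split => // z dz.
  rewrite mE// !psum_iter_shift// ?psum_unit_seq// ?mulr1 1?mulrC//.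
  exact: H2_unit_seq.
- move=> b [Hb [f [Hf bE]]].
  have uK := orthonormal_multiplier om.
  have -> : b = cauchy_prod mh f.
    apply: coefs_inj => //; first exact: (H2_conv uK Hf).
    by move=> z dz; rewrite bE// (psum_conv uK)// mE.
  have HC := H2_conv uK Hf.
  by rewrite h2innerC// orth_cauchy_prod ?conjc0.
Qed.

Lemma projH_orth f : H2 f -> let g := projH (model_space m) f in
  orth mh g /\ forall k, orth mh k -> h2inner g k = h2inner f k.
Proof.
move=> Hf g; rewrite /g /projH model_spaceE; have [g0 hg0] := orth_projection om Hf.
pose A g := orth mh g /\ forall k, orth mh k -> h2inner (fun n => f n - g n) k = 0.
have [ort1 h] := xgetPex (fun=> 0) (ex_intro A g0 hg0).
split => // k ok; have := h k ok.
rewrite -[fun n => _]/(f - xget (fun=> 0) A) h2innerBl//; [|exact: ort1.1|exact: ok.1].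
by move/eqP; rewrite subr_eq0 => /eqP.
Qed.

Local Notation T := (compressed_shift m).

(** The model space is invariant under the backward shift, so the backward shift is the adjoint of
    [T] there; pairings with powers of [T] are computed on the other factor, without the
    projection. *)
Lemma compressed_shift_orth x y : orth mh x -> orth mh y ->
  orth mh (T x) /\ h2inner (T x) y = h2inner x (backshift y).
Proof.
move=> [Hx _] oy; have [ort h] := projH_orth (H2_shift Hx).
by split => //; rewrite h// h2inner_shift_backshift//; exact: oy.1.
Qed.

Lemma iter_compressed_shift k x y : orth mh x -> orth mh y ->
  orth mh (iter k (T \o T) x) /\
  h2inner (iter k (T \o T) x) y = h2inner x (iter k.*2 (@backshift R) y).
Proof.
move=> ox; elim: k y => [|k IH] y oy; first by [].
have oy1 := orth_backshift om oy; have oy2 := orth_backshift om oy1.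
have [ort1 _] := IH y oy.
have [ort2 e2] := compressed_shift_orth ort1 oy1.
have [ort3 e3] := compressed_shift_orth ort2 oy.
split; first by rewrite iterS.
rewrite iterS /= e3 e2; have [_ ->] := IH _ oy2.
by rewrite -!iterSr.
Qed.

End ModelSpace.

(** * Even inner divisors as an obstruction to cyclicity *)

Section EvenDivisors.
Variable R : realType.
Local Notation C := R[i].
Local Notation normc := (@Normc.normc R).
Local Notation S := (@Defs.shift R).
Implicit Types (a b c d f g u x y : nat -> C) (z w : C).

Lemma h2inner_disjoint a b : (forall n, a n = 0 \/ b n = 0) -> h2inner a b = 0.
Proof.
move=> h; apply: h2innerE; rewrite (_ : series _ = fun=> 0); first exact: cvg_complex_cst.
apply/funext => n; rewrite seriesEord /= big1// => i _.
by case: (h i) => ->; rewrite ?mul0r// conjc0 mulr0.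
Qed.

Definition even_seq a : Prop := forall n, odd n -> a n = 0.
Definition odd_seq a : Prop := forall n, ~~ odd n -> a n = 0.

Lemma iter_shift_odd k a n : even_seq a -> odd n != odd k -> iter k S a n = 0.
Proof.
move=> ea nk; rewrite iter_shiftE; case: ltnP => // kn; apply: ea.
by rewrite oddB//; move: nk; case: (odd n); case: (odd k).
Qed.

Lemma even_shift_orth k l a b : even_seq a -> even_seq b -> odd k != odd l ->
  h2inner (iter k S a) (iter l S b) = 0.
Proof.
move=> ea eb kl; apply: h2inner_disjoint => n.
have [nk|nk] := eqVneq (odd n) (odd k); last by left; exact: iter_shift_odd.
by right; apply: iter_shift_odd => //; rewrite nk.
Qed.

Definition alt a : nat -> C := fun n => (- 1) ^+ n * a n.

Lemma psum_alt a z : psum (alt a) z = psum a (- z).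
Proof.
rewrite /psum (_ : (fun n => alt a n * z ^+ n) = fun n => a n * (- z) ^+ n)//.
by apply/funext => n; rewrite /alt [in RHS]exprNn mulrAC mulrC.
Qed.

Lemma normc_alt a n : normc (alt a n) = normc (a n).
Proof.
by rewrite Normc.normcM normcX -[-1]/(- (1 : C)) normcN Normc.normc1 expr1n mul1r.
Qed.

Lemma H2_alt a : H2 a -> H2 (alt a) /\ sqnorm (alt a) <= sqnorm a.
Proof.
move=> Ha; apply: H2_bounded => N; under eq_bigr do rewrite normc_alt.
exact: sum_le_sqnorm.
Qed.

Lemma altE a n : alt a n = if odd n then - a n else a n.
Proof. by rewrite /alt -signr_odd; case: (odd n); rewrite ?expr1 ?mulN1r// expr0 mul1r. Qed.

Lemma disc_opp z : disc z -> disc (- z).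
Proof. by rewrite /disc normcN. Qed.

Lemma even_seq_of_psum a : H2 a -> (forall z, disc z -> psum a z = psum a (- z)) ->
  even_seq a.
Proof.
move=> Ha h n on; have [Hb _] := H2_alt Ha.
have E : a = alt a by apply: coefs_inj => // z dz; rewrite psum_alt; exact: h.
have := congr1 (fun f => f n) E; rewrite /= altE on => /eqP.
by rewrite -addr_eq0 -mulr2n mulrn_eq0 /= => /eqP.
Qed.

Lemma psum_even a z : even_seq a -> psum a (- z) = psum a z.
Proof.
move=> ea; rewrite -psum_alt; congr (psum _ z); apply/funext => n.
by rewrite altE; case: ifP => // on; rewrite ea// oppr0.
Qed.

Lemma constant_psum a : H2 a -> (forall n, a n.+1 = 0) -> forall z, disc z -> psum a z = a 0%N.
Proof.
move=> Ha h z dz; have -> : a = scale (a 0%N) (@unit_seq R).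
  apply/funext => -[|n]; rewrite /scale /unit_seq ?eqxx ?mulr1// h.
  by rewrite mulr0.
by rewrite psum_scale// ?psum_unit_seq ?/scale /unit_seq//=; exact: H2_unit_seq.
Qed.

(** Joint continuity is needed because a truncation of [x] changes both [x] and its Hankel image. *)
Lemma cvg_h2inner2 (a_ b_ : nat -> nat -> C) a b :
  (forall n, H2 (a_ n)) -> (forall n, H2 (b_ n)) -> H2 a -> H2 b ->
  sqnorm (a - a_ n) @[n --> \oo] --> (0 : R) ->
  sqnorm (b - b_ n) @[n --> \oo] --> (0 : R) ->
  h2inner (a_ n) (b_ n) @[n --> \oo] --> h2inner a b.
Proof.
move=> Ha_ Hb_ Ha Hb ca cb.
have c1 := cvg_h2inner Ha_ Ha Hb ca.
have small (c_ : nat -> nat -> C) (M : R) : (forall n, H2 (c_ n)) ->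
    (\forall n \near \oo, sqnorm (c_ n) <= M) ->
    h2inner (c_ n) (b - b_ n) @[n --> \oo] --> 0.
  move=> Hc cM; apply/cvg_complexP => e e0.
  have h0 : M * sqnorm (b - b_ n) @[n --> \oo] --> (0 : R).
    by rewrite -(mulr0 M); exact: cvgMl_tmp.
  have /cvgrPdist_lt/(_ (e ^+ 2))/(_ (exprn_gt0 _ e0)) := h0.
  apply: filterS2 cM => n Mn; rewrite sub0r normrN => hn.
  rewrite sub0r normcN -(@ltr_pXn2r _ 2)// ?nnegrE ?normc_ge0 ?ltW//.
  have Hd := H2_sub Hb (Hb_ n).
  apply: le_lt_trans hn; apply: le_trans (ler_norm _).
  apply: le_trans (Cauchy_Schwarz (Hc n) Hd) _.
  by rewrite ler_wpM2r// sqnorm_ge0.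
have Hd n := H2_sub Ha (Ha_ n).
have c2 : h2inner a (b - b_ n) @[n --> \oo] --> 0.
  by apply: (small (fun=> a) (sqnorm a)) => //; exact: nearW.
have c3 : h2inner (a - a_ n) (b - b_ n) @[n --> \oo] --> 0.
  apply: (small (fun n => a - a_ n) 1) => //.
  have /cvgrPdist_lt/(_ 1 ltr01) := ca; apply: filterS => n.
  by rewrite sub0r normrN => /ltW; apply: le_trans; exact: ler_norm.
have N1 : (- 1 : C) * h2inner a (b - b_ n) @[n --> \oo] --> (-1 : C) * 0.
  exact: (@cvg_complexZ R nat \oo _ _ (-1) _ c2).
apply: (cvg_complex_ext (cvg_complexD (cvg_complexD c1 N1) c3)) => [n|]; last first.
  by rewrite mulr0 !addr0.
have Hb' := H2_sub Hb (Hb_ n).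
rewrite (h2innerBl Ha (Ha_ n) Hb') mulN1r -addrA addKr.
by rewrite -h2innerBr// subKr.
Qed.

Section EvenInner.
Variable u : nat -> C.
Hypothesis ou : shift_orthonormal u.
Hypothesis eu : even_seq u.

Let Hu : H2 u. Proof. by case: ou. Qed.

(* The twisted Hankel image of x: its pairing with S^(2j) x is an antisymmetric sum. *)
Definition hankel x : nat -> C := fun k => h2inner u (iter k.+1 S x).

(** The shifts fall on [x] and not on the orthonormal family, so Bessel's inequality applies only in
    its reversed form. *)
Lemma hankel_bound x : H2 x -> H2 (hankel x) /\ sqnorm (hankel x) <= sqnorm x.
Proof.
move=> Hx; apply: H2_bounded => N.
have := Bessel_reverse ou 0 N (H2_shift Hx).
rewrite (sqnorm_shift 1 Hx); apply: le_trans; apply: ler_sum => k _.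
rewrite /hankel h2innerC//; last exact: H2_iter_shift.
by rewrite normc_conj iterSr.
Qed.

Lemma hankelB x y : H2 x -> H2 y -> hankel (x - y) = hankel x - hankel y.
Proof.
move=> Hx Hy; apply/funext => k.
rewrite -[RHS]/(hankel x k - hankel y k) /hankel -h2innerBr//; [|exact: H2_iter_shift..].
congr (h2inner u _); apply/funext => n; rewrite !fctE !iter_shiftE.
by case: ifP => // _; rewrite subrr.
Qed.

Lemma altB x y : alt (x - y) = alt x - alt y.
Proof. by apply/funext => n; rewrite /alt !fctE mulrBr. Qed.

(** Polynomial truncation makes the double sums finite, so their order can be exchanged; the
    truncation is removed by limits in norm. *)
Definition trunc x N : nat -> C := x - tail x N.

Lemma truncE x N n : trunc x N n = if (n < N)%N then x n else 0.
Proof. by rewrite /trunc !fctE /tail; case: ifP => _; rewrite ?subr0 ?subrr. Qed.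

Lemma h2inner_shift_trunc x N k b : H2 x -> H2 b ->
  h2inner (iter k S (trunc x N)) b = \sum_(n < N) x n * (b (n + k)%N)^*%C.
Proof.
move=> Hx Hb; have Ht : H2 (trunc x N) by apply: H2_sub => //; exact: H2_tail.
rewrite h2inner_iter_backshift// (h2inner_finite (N := N)).
  by apply: eq_bigr => n _; rewrite truncE ltn_ord iter_backshiftE.
by move=> n Nn; rewrite truncE ltnNge Nn.
Qed.

Lemma hankel_trunc x N k : H2 x ->
  hankel (trunc x N) k = \sum_(n < N) (x n)^*%C * u (n + k.+1)%N.
Proof.
move=> Hx; have Ht : H2 (trunc x N) by apply: H2_sub => //; exact: H2_tail.
rewrite /hankel h2innerC//; last exact: H2_iter_shift.
rewrite h2inner_shift_trunc// conj_sum; apply: eq_bigr => n _.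
by rewrite rmorphM /= conjcK.
Qed.

Variable x : nat -> C.
Hypothesis Hx : H2 x.

Let Ht N : H2 (trunc x N). Proof. by apply: H2_sub => //; exact: H2_tail. Qed.

Let y := alt (hankel x).
Let y_ N := alt (hankel (trunc x N)).

Let Hy : H2 y. Proof. by have [] := H2_alt (hankel_bound Hx).1. Qed.
Let Hy_ N : H2 (y_ N). Proof. by have [] := H2_alt (hankel_bound (Ht N)).1. Qed.

Let cvg_trunc : sqnorm (x - trunc x N) @[N --> \oo] --> (0 : R).
Proof.
rewrite (_ : (fun N => _) = fun N => sqnorm (tail x N)); first exact: sqnorm_tail_cvg.
by apply/funext => N; rewrite /trunc subKr.
Qed.

Let cvg_y : sqnorm (y - y_ N) @[N --> \oo] --> (0 : R).
Proof.
apply: (@squeeze_cvgr _ _ _ _ (fun=> 0) (fun N => sqnorm (x - trunc x N))).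
- apply: nearW => N; rewrite sqnorm_ge0 /=; last exact: H2_sub.
  have Hd := H2_sub Hx (Ht N).
  rewrite /y /y_ -altB -hankelB//.
  by apply: le_trans (H2_alt (hankel_bound Hd).1).2 _; exact: (hankel_bound Hd).2.
- exact: cvg_cst.
- exact: cvg_trunc.
Qed.

(** Evenness of [u] leaves only the terms with $n+k+1$ even, where the twist $(-1)^k$ equals
    $(-1)^{n+1}$ and no longer depends on [k]. The image of a truncation is thus a combination of
    backward shifts of [u], and $\langle B^{n+1}u,S^ju\rangle=\langle u,S^{n+1+j}u\rangle=0$ for the
    backward shift $B$. *)
Lemma hankel_orth : orth u y.
Proof.
split => // j; have Hj := orthonormal_H2 ou j.
apply: complex_cvg_unique (cvg_h2inner Hy_ Hy Hj cvg_y) _.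
rewrite (_ : (fun N => _) = fun=> 0); first exact: cvg_complex_cst.
apply/funext => N.
have HS n : H2 (iter n (@backshift R) u) by exact: H2_iter_backshift.
have -> : y_ N = \sum_(n < N) scale ((- 1) ^+ n.+1 * (x n)^*%C) (iter n.+1 (@backshift R) u).
  apply/funext => k; rewrite fct_sumE /y_ /alt hankel_trunc// mulr_sumr.
  apply: eq_bigr => n _; rewrite /scale iter_backshiftE mulrA.
  rewrite -[(k + n.+1)%N]addSnnS [(k.+1 + n)%N]addnC.
  have [on|en] := boolP (odd (n + k.+1)); first by rewrite eu// !mulr0.
  congr (_ * _ * _); rewrite -signr_odd -[RHS]signr_odd; congr (_ ^+ nat_of_bool _).
  by move: en; rewrite oddD /=; case: (odd n); case: (odd k).
rewrite h2inner_suml//; last by move=> n; apply: H2_scale; exact: HS.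
rewrite big1// => n _; rewrite h2innerZl; [|exact: HS|exact: Hj].
rewrite h2innerC; [|exact: HS|exact: Hj].
rewrite -h2inner_iter_backshift// -iterD addSn.
by case: ou => _ _ ->; rewrite conjc0 mulr0.
Qed.

Lemma hankel_annihilates j : h2inner (iter j.*2 S x) y = 0.
Proof.
have Hs N := H2_iter_shift j.*2 (Ht N).
have cs : sqnorm (iter j.*2 S x - iter j.*2 S (trunc x N)) @[N --> \oo] --> (0 : R).
  rewrite (_ : (fun N => _) = fun N => sqnorm (x - trunc x N)); first exact: cvg_trunc.
  apply/funext => N; rewrite -(sqnorm_shift j.*2 (H2_sub Hx (Ht N))); congr sqnorm.
  apply/funext => n; rewrite !fctE !iter_shiftE.
  by case: ifP => // _; rewrite subrr.
have := cvg_h2inner2 Hs Hy_ (H2_iter_shift j.*2 Hx) Hy cs cvg_y => h.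
apply: complex_cvg_unique h _.
rewrite (_ : (fun N => _) = fun=> 0); first exact: cvg_complex_cst.
apply/funext => N; rewrite h2inner_shift_trunc//.
pose F (i n : 'I_N) : C := (- 1) ^+ i * (x i * x n * (u (n + (i + j.*2).+1)%N)^*%C).
have -> : \sum_(i < N) x i * (y_ N (i + j.*2)%N)^*%C = \sum_(i < N) \sum_(n < N) F i n.
  apply: eq_bigr => i _; rewrite /y_ /alt hankel_trunc// rmorphM /= conj_sum.
  have -> : ((- 1 : C) ^+ (i + j.*2))^*%C = (- 1) ^+ i.
    by rewrite rmorphXn rmorphN1 exprD -mul2n exprM sqrrN expr1n expr1n mulr1.
  rewrite !mulr_sumr; apply: eq_bigr => n _; rewrite /F rmorphM /= conjcK.
  by move: (_ ^+ i) (_^*)%C => p q; ring.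
set s := \sum_(i < N) _; suff : s + s = 0.
  by move/eqP; rewrite -mulr2n mulrn_eq0 /= => /eqP.
(* The coefficient of [u] in [F i n] is symmetric in [i] and [n] and vanishes unless their parities
   differ; then $(-1)^i$ and $(-1)^n$ cancel. *)
rewrite {2}/s exchange_big /= /s -big_split /=.
rewrite big1// => i _; rewrite -big_split /= big1// => n _; rewrite /F.
have -> : (n + (i + j.*2).+1 = i + (n + j.*2).+1)%N by lia.
have [on|en] := boolP (odd (i + (n + j.*2).+1)).
  by rewrite eu// conjc0 !mulr0 addr0.
rewrite [x n * x i]mulrC -mulrDl -signr_odd -[in X in _ + X]signr_odd.
have -> : odd n = ~~ odd i.
  by move: en; rewrite oddD /= oddD odd_double; case: (odd n); case: (odd i).
by case: (odd i); rewrite !expr0 !expr1 ?subrr ?addNr mul0r.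
Qed.

End EvenInner.

(* If the twisted Hankel image of x vanishes, the backward shift of u is annihilated too. *)
Lemma exists_orth_annihilator u x : shift_orthonormal u -> even_seq u ->
  (exists n, u n.+1 != 0) -> H2 x ->
  exists y, [/\ orth u y, y <> 0 & forall j, h2inner (iter j.*2 S x) y = 0].
Proof.
move=> ou eu [n un] Hx; have Hu : H2 u by case: ou.
pose y := alt (hankel u x).
have [y0|y0] := pselect (y = 0); last first.
  by exists y; split => //; [exact: hankel_orth|exact: hankel_annihilates].
have Hb := H2_backshift Hu.
exists (backshift u); split.
- split => // k; have Hk := orthonormal_H2 ou k.
  rewrite h2innerC// -h2inner_shift_backshift// -iterS.
  by case: ou => _ _ ->; rewrite conjc0.
- by move=> b0; move: un; rewrite -[u n.+1]/(backshift u n) b0 eqxx.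
- move=> j; have Hj := H2_iter_shift j.*2 Hx.
  rewrite -h2inner_shift_backshift// h2innerC//; last exact: H2_shift.
  have : y j.*2 = 0 by rewrite y0.
  rewrite /y altE odd_double /hankel iterS => ->; exact: conjc0.
Qed.

End EvenDivisors.

(** * Beurling's theorem for even functions and the even divisor *)

Section EvenDivisorConstruction.
Variable R : realType.
Local Notation C := R[i].
Local Notation normc := (@Normc.normc R).
Local Notation S := (@Defs.shift R).
Implicit Types (a b c d f g u v x y : nat -> C) (z w : C).

Definition even_part a : nat -> C := fun n => if odd n then 0 else a n.

Lemma H2_even_part a : H2 a -> H2 (even_part a).
Proof.
move=> Ha; apply: (H2_bounded (M := sqnorm a) _).1 => N.
apply: le_trans (sum_le_sqnorm N Ha); apply: ler_sum => n _.
by rewrite /even_part; case: ifP => // _; rewrite Normc.normc0 expr0n sqr_ge0.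
Qed.

Lemma even_part_split a : a = even_part a + S (even_part (backshift a)).
Proof.
apply/funext => -[|n]; rewrite !fctE /even_part /= ?addr0//.
by rewrite /backshift; case: (odd n); rewrite ?addr0 ?add0r.
Qed.

Variables (mh y0 : nat -> C).
Hypothesis om : shift_orthonormal mh.
Hypothesis oy0 : orth mh y0.
Hypothesis y0_odd : odd_seq y0.
Hypothesis y0_neq0 : y0 <> 0.

Let Hmh : H2 mh. Proof. by case: om. Qed.

Let Y := [set y | orth mh y /\ odd_seq y].
Let L := [set f | [/\ H2 f, even_seq f & forall y, Y y -> h2inner (S f) y = 0]].

Let L_H2 f : L f -> H2 f. Proof. by case. Qed.
Let L_even f : L f -> even_seq f. Proof. by case. Qed.

Let L_add f g : L f -> L g -> L (f + g).
Proof.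
move=> [Hf ef hf] [Hg eg hg]; split; first exact: H2_add.
  by move=> n on; rewrite !fctE ef// eg// addr0.
move=> y Yy; have Hy := Yy.1.1.
rewrite (_ : S (f + g) = S f + S g); last by apply/funext => -[|n]; rewrite !fctE//= addr0.
by rewrite h2innerDl ?hf ?hg ?addr0//; exact: H2_shift.
Qed.

Let L_scale k f : L f -> L (scale k f).
Proof.
move=> [Hf ef hf]; split; first exact: H2_scale.
  by move=> n on; rewrite /scale ef// mulr0.
move=> y Yy; have Hy := Yy.1.1.
rewrite (_ : S (scale k f) = scale k (S f)); last first.
  by apply/funext => -[|n]; rewrite /scale//= mulr0.
by rewrite h2innerZl ?hf ?mulr0//; exact: H2_shift.
Qed.

Let L_zero : L 0.
Proof.
split=> [|//|y _]; first exact: H2_zero.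
rewrite (_ : S 0 = 0) ?h2inner0l//; by apply/funext => -[].
Qed.

Let L_sub f g : L f -> L g -> L (f - g).
Proof. by move=> Lf Lg; apply: L_add => //; rewrite oppE_scale; exact: L_scale. Qed.

(** On the other factor this is an even number of backward shifts, which preserve both the model
    space and oddness. *)
Let L_shift2 i f : L f -> L (iter i.*2 S f).
Proof.
move=> [Hf ef hf]; split; first exact: H2_iter_shift.
  by move=> n on; apply: iter_shift_odd => //; rewrite on odd_double.
move=> y [oy yo]; rewrite -iterS iterSr h2inner_iter_backshift//; [|exact: H2_shift|exact: oy.1].
apply: hf; split; first exact: orth_iter_backshift.
by move=> n en; rewrite iter_backshiftE yo// oddD odd_double addbF.
Qed.

Let L_closed f : H2 f ->
  (forall e : R, 0 < e -> exists2 v, L v & sqnorm (f - v) < e) -> L f.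
Proof.
move=> Hf h; split => //.
- move=> n on; rewrite -(h2inner_deltar n Hf).
  have Hd : H2 (iter n S (@unit_seq R)) by apply: H2_iter_shift; exact: H2_unit_seq.
  apply: h2inner_approx => // e /h[v Lv hv]; exists v; split => //; first exact: L_H2.
  by rewrite h2inner_deltar ?(L_even Lv)//; exact: L_H2.
- move=> y Yy; have Hy := Yy.1.1; have Hb := H2_backshift Hy.
  rewrite h2inner_shift_backshift//.
  apply: h2inner_approx => // e /h[v Lv hv]; exists v; split => //; first exact: L_H2.
  by rewrite -h2inner_shift_backshift//; [case: Lv => _ _; exact|exact: L_H2].
Qed.

Let me := even_part mh.
Let mo := even_part (backshift mh).

(** [y] is orthogonal to $zm=zm_e+z^2m_o$; the second term is even and drops out against the odd
    [y]. *)
Let L_me : L me.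
Proof.
have Hme : H2 me by exact: H2_even_part.
have Hmo : H2 mo by apply: H2_even_part; exact: H2_backshift.
split => //; first by move=> n on; rewrite /me /even_part on.
move=> y [[Hy oy] yo].
have E : S mh = S me + S (S mo).
  rewrite {1}(even_part_split mh); apply/funext => -[|n]//=.
  by rewrite !fctE addr0.
have h1 : h2inner (S mh) y = 0.
  rewrite h2innerC//; last exact: H2_shift.
  by rewrite (oy 1%N) conjc0.
have h2 : h2inner (S (S mo)) y = 0.
  apply: h2inner_disjoint => -[|[|n]]; [by left|by left|] => /=.
  have [on|en] := boolP (odd n); first by left; rewrite /mo /even_part on.
  by right; apply: yo; rewrite /= negbK.
move: h1; rewrite E h2innerDl ?h2 ?addr0//; [exact: H2_shift|].
by apply: H2_shift; exact: H2_shift.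
Qed.

(** Here the relation used is the orthogonality to [mh] itself, whose even part drops out. *)
Let L_mo : L mo.
Proof.
have Hme : H2 me by exact: H2_even_part.
have Hmo : H2 mo by apply: H2_even_part; exact: H2_backshift.
split => //; first by move=> n on; rewrite /mo /even_part on.
move=> y [[Hy oy] yo].
have h1 : h2inner mh y = 0 by rewrite h2innerC// (oy 0%N) conjc0.
have h2 : h2inner me y = 0.
  apply: h2inner_disjoint => n; have [on|en] := boolP (odd n).
    by left; rewrite /me /even_part on.
  by right; exact: yo.
move: h1; rewrite {1}(even_part_split mh) h2innerDl ?h2 ?add0r//.
exact: H2_shift.
Qed.

(* Beurling's argument inside the even functions: u is the normalised extremal element of L
   for the lowest order j of vanishing at 0. *)
Lemma exists_generator : exists u, [/\ shift_orthonormal u, even_seq u, L u &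
  forall f, L f -> exists2 d, H2 d & f = cauchy_prod u d].
Proof.
have exj : exists j, `[< exists2 f, L f & f j != 0 >].
  have [n hn] : exists n, mh n != 0.
    apply: contrapT => h; have m0 : mh = 0.
      by apply/funext => n; apply/eqP/negPn/negP => hn; apply: h; exists n.
    case: om => _ + _; rewrite m0 => h1; have := h2inner_self (@H2_zero R).
    by rewrite h2inner0l h1 => /eqP; rewrite eq_sym oner_eq0.
  move: hn; rewrite {1}(even_part_split mh) => hn.
  have [me0|me0] := eqVneq (me n) 0; last by exists n; apply/asboolP; exists me.
  case: n hn me0 => [|n] hn me0.
    by move: hn; rewrite -[X in X != 0]/(me 0%N + 0) me0 addr0 eqxx.
  exists n; apply/asboolP; exists mo => //.
  by move: hn; rewrite -[X in X != 0]/(me n.+1 + mo n) me0 add0r.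
case: (ex_minnP exj) => j /asboolP[f1 Lf1 f1j] jmin.
have low f n : L f -> (n < j)%N -> f n = 0.
  move=> Lf nj; apply/eqP/negPn/negP => fn.
  have : (j <= n)%N by apply: jmin; apply/asboolP; exists f.
  by rewrite leqNgt nj.
pose V := [set f | L f /\ f j = 0].
have sV : lin_subspace V.
  split.
  - by move=> f [/L_H2].
  - by split.
  - by move=> f g [Lf f0] [Lg g0]; split; [exact: L_add|rewrite !fctE f0 g0 addr0].
  - by move=> k f [Lf f0]; split; [exact: L_scale|rewrite /scale f0 mulr0].
have Hf1 := L_H2 Lf1.
have [y [Hy yV cl]] := projection_exists sV Hf1.
(* [f1 - y] is a norm limit of elements of [V], and both conditions defining [V] survive the limit;
   so [y] lies in [L] and keeps the nonzero coefficient of [f1] at order [j]. *)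
have Ld : L (f1 - y).
  apply: L_closed; first exact: H2_sub.
  by move=> e /cl[v [Lv _] hv]; exists v.
have dj : (f1 - y) j = 0.
  have Hd := L_H2 Ld; rewrite -(h2inner_deltar j Hd).
  have HD : H2 (iter j S (@unit_seq R)) by apply: H2_iter_shift; exact: H2_unit_seq.
  apply: h2inner_approx => // e /cl[v [Lv v0] hv]; exists v; split => //; first exact: L_H2.
  by rewrite h2inner_deltar//; exact: L_H2.
have Ly : L y by rewrite -[y](subKr f1); exact: L_sub.
have yj : y j != 0.
  by move: dj; rewrite !fctE => /eqP; rewrite subr_eq0 => /eqP <-.
have sy : 0 < sqnorm y.
  rewrite lt_def sqnorm_ge0// andbT; apply/eqP => s0.
  by move: yj; rewrite (sqnorm_eq0 Hy) ?s0// eqxx.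
pose u := scale ((Num.sqrt (sqnorm y))^-1)%:C%C y.
have Hu : H2 u by exact: H2_scale.
have Lu : L u by exact: L_scale.
have eu := L_even Lu.
have u1 : sqnorm u = 1.
  rewrite sqnorm_scale// normc_real ger0_norm ?invr_ge0 ?sqrtr_ge0//.
  by rewrite exprVn sqr_sqrtr ?(ltW sy)// mulVf// gt_eqF.
have uV v : V v -> h2inner u v = 0.
  by move=> Vv; rewrite h2innerZl ?yV ?mulr0//; exact: L_H2 Vv.1.
(* A positive even shift raises the order of vanishing beyond [j]. Being orthogonal to [V], [u] is
   thus orthogonal to all such shifts of elements of [L], its own included. *)
have shiftV i f : L f -> V (iter i.+1.*2 S f).
  move=> Lf; split; first exact: L_shift2.
  rewrite iter_shiftE; case: ltnP => // ij; apply: low => //.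
  by rewrite ltn_subrL /= (leq_trans _ ij).
have ou : shift_orthonormal u.
  split => // k; have [ok|ek] := boolP (odd k).
    have -> : k.+1 = (k.+1./2).-1.+1.*2 by case: k ok => // k ok; lia.
    by rewrite (h2innerC (H2_iter_shift _ Hu) Hu) uV ?conjc0//; exact: shiftV.
  by apply: (even_shift_orth (l := 0)) => //=; rewrite ek.
exists u; split => // f Lf; have Hf := L_H2 Lf.
have uK := orthonormal_multiplier ou.
pose d k := h2inner f (iter k S u).
have [Hd _] := Bessel ou Hf; exists d => //.
have HC := H2_conv uK Hd.
have d_odd k : odd k -> d k = 0.
  move=> ok; apply: (even_shift_orth (k := 0)) => //; first exact: L_even.
  by rewrite ok.
have Llin N : L (lincomb u d N).
  rewrite /lincomb; elim/big_ind: _ => // k _.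
  have [ok|ek] := boolP (odd k).
    rewrite d_odd// (_ : scale 0 _ = 0)//.
    by apply/funext => n; rewrite /scale mul0r.
  apply: L_scale; rewrite -[nat_of_ord k]odd_double_half (negbTE ek) add0n.
  exact: L_shift2.
have LC : L (cauchy_prod u d).
  apply: L_closed => // e e0.
  have /cvgrPdist_lt/(_ e e0)[N _ /(_ N (leqnn N))] := sqnorm_conv_cvg uK Hd.
  rewrite sub0r normrN => /(le_lt_trans (ler_norm _)) hN.
  by exists (lincomb u d N).
pose f' := f - cauchy_prod u d.
have Lf' : L f' by exact: L_sub.
have Hf' := L_H2 Lf'.
suff : f' = 0 by move/eqP; rewrite subr_eq0 => /eqP.
(* Orders of opposite parity pair to zero. For $n\le k$ the pairing is a coefficient of [f'] against
   a shift of [u], removed by construction; for $n>k$ a positive even shift of [f'] lies in [V]. *)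
apply: (uncorrelated_eq0 ou) => // n k.
have base i : h2inner f' (iter i S u) = 0.
  by rewrite h2innerBl ?(h2inner_conv_shift ou) ?subrr//; exact: orthonormal_H2.
have [nk|nk] := eqVneq (odd n) (odd k); last first.
  by apply: even_shift_orth => //; exact: L_even.
have [le_nk|lt_kn] := leqP n k.
  rewrite -(subnKC le_nk) iterD h2inner_iter_shift//; exact: orthonormal_H2.
have [i iE] : exists i, (n - k = i.+1.*2)%N.
  exists ((n - k)./2.-1); have : ~~ odd (n - k) by rewrite oddB ?(ltnW lt_kn)// nk addbb.
  by move: lt_kn; lia.
rewrite -(subnKC (ltnW lt_kn)) iE iterD h2inner_iter_shift//; last exact: H2_iter_shift.
by rewrite (h2innerC (H2_iter_shift _ Hf') Hu) uV ?conjc0//; exact: shiftV.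
Qed.

Lemma exists_even_divisor : exists u q, [/\ shift_orthonormal u, even_seq u,
  shift_orthonormal q, (forall z, disc z -> psum mh z = psum u z * psum q z) &
  exists n, u n.+1 != 0].
Proof.
have [u [ou eu Lu div]] := exists_generator.
have Hu : H2 u by case: ou.
have uK := orthonormal_multiplier ou.
have [d1 Hd1 E1] := div _ L_me; have [d2 Hd2 E2] := div _ L_mo.
(* With $m_e=ud_1$ and $m_o=ud_2$, the cofactor in $m=m_e+zm_o$ is $d_1+zd_2$. Its shifts inherit
   orthonormality from those of [mh], since multiplication by [u] preserves inner products. *)
pose q := d1 + S d2.
have HS2 := H2_shift Hd2.
have Hq : H2 q by exact: H2_add.
have pq z : disc z -> psum mh z = psum u z * psum q z.
  move=> dz; rewrite (even_part_split mh) -/me -/mo E1 E2.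
  have h1 := H2_conv uK Hd1; have h2 := H2_conv uK Hd2.
  rewrite psum_add// ?psum_shift// ?(psum_conv uK)//; last exact: H2_shift.
  by rewrite /q psum_add// psum_shift// mulrDr mulrCA.
have conv_q k : cauchy_prod u (iter k S q) = iter k S mh.
  have Hk := H2_iter_shift k Hq.
  apply: coefs_inj; [exact: (H2_conv uK Hk)|exact: H2_iter_shift|].
  by move=> z dz; rewrite (psum_conv uK)// !psum_iter_shift// pq// mulrCA.
exists u, q; split => //.
  split => // [|k].
    have := h2inner_conv ou Hq Hq; rewrite (conv_q 0%N) !h2inner_self//=.
    by case: om => _ -> _ [].
  rewrite -(h2inner_conv ou (H2_iter_shift k.+1 Hq) Hq) conv_q (conv_q 0%N).
  by case: om => _ _; exact.
apply: contrapT => h.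
have uc n : u n.+1 = 0 by apply/eqP/negPn/negP => hn; apply: h; exists n.
have u0 : u 0%N != 0.
  apply/eqP => u0; have : u = 0 by apply/funext => -[|n]; rewrite ?u0 ?uc.
  move=> uz; case: ou => _ + _; rewrite uz => h1.
  have := h2inner_self (@H2_zero R); rewrite h2inner0l h1 => /eqP.
  by rewrite eq_sym oner_eq0.
(* A constant [u] would put every even monomial into [L]; then $z^{2i+1}$ would be orthogonal to
   [y0] for all $i$, and the odd coefficients of [y0] would vanish. *)
have L1 : L (@unit_seq R).
  rewrite (_ : @unit_seq R = scale (u 0%N)^-1 u); first exact: L_scale.
  apply/funext => -[|n]; rewrite /scale /unit_seq /= ?mulVf// uc mulr0//.
apply: y0_neq0; apply/funext => n; have [on|en] := boolP (odd n); last exact: y0_odd.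
have [_ _ /(_ y0)] := L_shift2 n./2 L1.
rewrite -iterS (_ : n./2.*2.+1 = n); last first.
  by rewrite -[RHS]odd_double_half on.
rewrite h2inner_delta ?(oy0.1)//; last exact: oy0.1.
by move=> h1; apply/eqP; rewrite -conjc_eq0 h1.
Qed.

End EvenDivisorConstruction.

(** * Cyclicity, odd functions and the two implications *)

Section Main.
Variable R : realType.
Local Notation C := R[i].
Local Notation normc := (@Normc.normc R).
Local Notation S := (@Defs.shift R).
Variables (m : C -> C) (mh : nat -> C).
Hypothesis im : inner m.
Hypothesis om : shift_orthonormal mh.
Hypothesis mE : forall z, disc z -> m z = psum mh z.

Local Notation T := (compressed_shift m).

Let Hmh : H2 mh. Proof. by case: om. Qed.

(** The hypothesis involves the shift without projection because, for [y] in the model space,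
    $T^{2j}x$ and $S^{2j}x$ have the same pairing with [y]. *)
Lemma cyclic_annihilator_eq0 x y : cyclic_vector (T \o T) (model_space m) x ->
  orth mh y -> (forall j, h2inner (iter j.*2 S x) y = 0) -> y = 0.
Proof.
rewrite /cyclic_vector (model_spaceE om mE) => -[ox cyc] oy ann.
have [Hy _] := oy; have [Hx _] := ox.
have [y0|y0] := eqVneq (sqnorm y) 0; first by apply: sqnorm_eq0; rewrite ?y0.
have ny : 0 < h2norm y by rewrite h2normE sqrtr_gt0 lt_def y0 sqnorm_ge0.
(* An approximant [v] orthogonal to [y] and closer to it than $\|y\|$ is impossible:
   $\|y\|^2=\langle y-v,y\rangle\le\|y-v\|\,\|y\|$. *)
have [N [c]] := cyc y oy _ ny.
pose e k := iter k (T \o T) x.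
have oe k : orth mh (e k) by have [] := iter_compressed_shift om mE k ox oy.
have He k : H2 (e k) by have [] := oe k.
have Hs : forall k : 'I_N, H2 (scale (c k) (e k)) by move=> k; exact: H2_scale.
pose v := \sum_(k < N) scale (c k) (e k).
have Hv : H2 v by exact: H2_sum.
rewrite (_ : (fun n => _) = y - v); last first.
  by apply/funext => n; rewrite !fctE /v fct_sumE.
have v0 : h2inner v y = 0.
  rewrite /v h2inner_suml// big1// => k _; rewrite h2innerZl//.
  have [_ ->] := iter_compressed_shift om mE k ox oy.
  by rewrite -h2inner_iter_backshift// ann mulr0.
move=> hlt; have := normc_h2inner_le (H2_sub Hy Hv) Hy.
rewrite h2innerBl// v0 subr0 h2inner_self// normc_real ger0_norm ?sqnorm_ge0//.
rewrite -sqr_h2norm// expr2 ler_pM2r// => hle.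
by have := le_lt_trans hle hlt; rewrite ltxx.
Qed.

Lemma cyclic_of_no_odd : (forall y, orth mh y -> odd_seq y -> y = 0) ->
  multiplicity_free (T \o T) (model_space m).
Proof.
move=> no_odd; exists (projH (model_space m) (@unit_seq R)).
have [ox hx] := projH_orth om mE (@H2_unit_seq R).
set x := projH _ _ in ox hx *.
rewrite /cyclic_vector (model_spaceE om mE); split => // h oh eps eps0.
have [Hh h0] := oh.
pose e k := iter k (T \o T) x.
have oe k : orth mh (e k) by have [] := iter_compressed_shift om mE k ox oh.
have He k : H2 (e k) by have [] := oe k.
pose V := [set v | exists (N : nat) (c : nat -> C), v = \sum_(k < N) scale (c k) (e k)].
have Hs (c : nat -> C) N : forall k : 'I_N, H2 (scale (c k) (e k)) by move=> k; exact: H2_scale.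
have VH : V `<=` @H2 R by move=> _ [N [c ->]]; exact: H2_sum.
have pad (c : nat -> C) N M : (N <= M)%N -> \sum_(k < N) scale (c k) (e k) =
    \sum_(k < M) scale (if (k < N)%N then c k else 0) (e k).
  move=> NM; rewrite (big_ord_widen _ (fun k => scale (c k) (e k)) NM) big_mkcond /=.
  apply: eq_bigr => k _; case: ifP => // _.
  by apply/funext => n; rewrite /scale mul0r.
have sV : lin_subspace V.
  split => //.
  - by exists 0%N, (fun=> 0); rewrite big_ord0.
  - move=> _ _ [N [c ->]] [N' [c' ->]].
    exists (maxn N N'), (fun k => (if (k < N)%N then c k else 0) + (if (k < N')%N then c' k else 0)).
    rewrite (pad c _ _ (leq_maxl N N')) (pad c' _ _ (leq_maxr N N')) -big_split /=.
    by apply: eq_bigr => k _; apply/funext => n; rewrite !fctE /scale mulrDl.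
  - move=> z _ [N [c ->]]; exists N, (fun k => z * c k); apply/funext => n.
    rewrite /scale !fct_sumE mulr_sumr; apply: eq_bigr => k _.
    by rewrite mulrA.
have [y [Hy yV cl]] := projection_exists sV Hh.
have orthV v : V v -> orth mh v.
  move=> Vv; split; first exact: VH.
  case: Vv => N [c ->] k; rewrite h2inner_suml//; last exact: orthonormal_H2.
  rewrite big1// => i _; rewrite h2innerZl//; last exact: orthonormal_H2.
  by have [_ ->] := oe i; rewrite mulr0.
have oy : orth mh y.
  split => // k; have Hk := orthonormal_H2 om k.
  have Hd := H2_sub Hh Hy.
  have : h2inner (h - y) (iter k S mh) = 0.
    apply: h2inner_approx => // d /cl[v Vv hv]; exists v.
    by have [? ?] := orthV v Vv; split.
  by rewrite h2innerBl// h0 sub0r => /eqP; rewrite oppr_eq0 => /eqP.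
(* Since [x] is the projection of 1, the pairing of $T^nx$ with [y] for even $n$ is the conjugate of
   the coefficient of [y] of order $n$; orthogonality to the orbit therefore makes [y] odd. *)
have y0 : y = 0.
  apply: no_odd => // n en.
  have Ve : V (e n./2).
    exists n./2.+1, (fun k => (k == n./2)%:R); rewrite big_ord_recr /= eqxx big1 ?add0r.
      by apply/funext => i; rewrite /scale mul1r.
    move=> k _; rewrite ltn_eqF//; apply/funext => i.
    by rewrite /scale mul0r.
  have := yV _ Ve; rewrite h2innerC//.
  have [_ ->] := iter_compressed_shift om mE n./2 ox oy.
  have nE : n./2.*2 = n by rewrite -[RHS]odd_double_half (negbTE en).
  rewrite nE hx; last exact: orth_iter_backshift.
  have Hb := H2_iter_backshift n Hy.
  rewrite -[@unit_seq R]/(iter 0 S (@unit_seq R)) h2inner_delta// conjcK.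
  by rewrite iter_backshiftE.
have e2 : 0 < eps ^+ 2 by rewrite exprn_gt0.
have [v [N [c vE]] hv] := cl _ e2.
exists N, c; rewrite (_ : (fun n => _) = h - y - v); last first.
  by apply/funext => n; rewrite y0 subr0 !fctE vE fct_sumE.
rewrite h2normE -(@ltr_pXn2r _ 2)// ?nnegrE ?sqrtr_ge0 ?ltW//.
rewrite sqr_sqrtr// sqnorm_ge0//; apply: H2_sub; [exact: H2_sub|].
by apply: VH; exists N, c.
Qed.

Lemma orthonormal_divisor_inner u q : shift_orthonormal u -> shift_orthonormal q ->
  (forall z, disc z -> psum mh z = psum u z * psum q z) -> inner (psum u).
Proof.
move=> ou oq mq; have Hu : H2 u by case: ou.
split.
  split; first by exists u; exact: coefs_psum.
  by exists 1 => z; exact: orthonormal_le1.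
have FF := ae_filter_ringOfSetsType (@lebesgue_measure R).
have := Fatou Hu; have := im.2; apply: filterS2 => t [w' [w1 hw']] [w hw].
exists w; split => //.
have hn : normc (psum u (r%:C%C * expi t)) @[r --> (1 : R)^'-] --> normc w.
  by apply: cvg_normc; exact: hw.
have hm : normc (m (r%:C%C * expi t)) @[r --> (1 : R)^'-] --> normc w'.
  by apply: cvg_normc; exact: hw'.
rewrite w1 in hm.
have near01 : \forall r \near (1 : R)^'-, 0 <= r < 1.
  near=> r; apply/andP; split; near: r; [exact: nbhs_left_ge|exact: nbhs_left_lt].
apply/le_anti/andP; split.
  rewrite -(cvg_lim (@Rhausdorff R) hn); apply: limr_le; first exact: cvgP hn.
  by apply: filterS near01 => r r01; apply: orthonormal_le1 => //; exact: disc_polar.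
rewrite -(cvg_lim (@Rhausdorff R) hm) -(cvg_lim (@Rhausdorff R) hn).
apply: ler_lim; [exact: cvgP hm|exact: cvgP hn|].
apply: filterS near01 => r r01; have dz := disc_polar t r01.
rewrite mE// mq// Normc.normcM; apply: ler_piMr; first exact: normc_ge0.
exact: orthonormal_le1.
Unshelve. all: by end_near. Qed.

End Main.

Theorem theorem2 (R : realType) (m : R[i] -> R[i]) :
  inner m -> dim_ge2 (model_space m) ->
  (multiplicity_free (compressed_shift m \o compressed_shift m) (model_space m) <->
   ~ exists p : R[i] -> R[i],
       inner_divisor p m /\
       (exists z w, disc z /\ disc w /\ p z <> p w) /\
       (forall l, disc l -> p l = p (- l))).
Proof.
move=> im _; have [mh Hmh mE] := Hinf_coefs im.1.
have om := inner_orthonormal im Hmh mE.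
split.
- move=> [x cyc] [p [[ip [q [Hq mpq]]] [[z [w [dz [dw pzw]]]] pe]]].
  have [u Hu pE] := Hinf_coefs ip.1.
  have ou := inner_orthonormal ip Hu pE.
  have uK := orthonormal_multiplier ou.
  have [b Hb qE] := Hinf_coefs Hq.
  have eu : even_seq u.
    by apply: even_seq_of_psum => // v dv; rewrite -(pE _ dv) -(pE _ (disc_opp dv)) pe.
  have un : exists n, u n.+1 != 0.
    apply: contrapT => h; apply: pzw; rewrite !pE// !constant_psum// => n;
      by apply/eqP/negPn/negP => hn; apply: h; exists n.
  have Hx : H2 x by case: cyc => + _; rewrite (model_spaceE om mE) => -[].
  have [y [oy y0 ann]] := exists_orth_annihilator ou eu un Hx.
  apply: y0; apply: (cyclic_annihilator_eq0 om mE cyc) => //.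
  (* $H(p)\subset H(m)$: every shift of [mh] is [u] times the same shift of the cofactor, hence
     orthogonal to [y]. *)
  have [Hy _] := oy; split => // k.
  have Hk := H2_iter_shift k Hb; have HC := H2_conv uK Hk.
  have -> : iter k (@Defs.shift R) mh = cauchy_prod u (iter k (@Defs.shift R) b).
    apply: coefs_inj => //; first exact: H2_iter_shift.
    move=> v dv; rewrite (psum_conv uK)// !psum_iter_shift//.
    by rewrite -mE// mpq// pE// qE// mulrCA.
  by rewrite h2innerC// (orth_cauchy_prod ou)// conjc0.
- move=> nop; apply: (cyclic_of_no_odd om mE) => y oy yo; apply: contrapT => y0.
  apply: nop; have [u [q [ou eu oq mq [n un]]]] := exists_even_divisor om oy yo y0.
  have Hu : H2 u by case: ou.
  have Hq : H2 q by case: oq.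
  exists (psum u); split.
    split; first exact: (orthonormal_divisor_inner im mE ou oq mq).
    exists (psum q); split; last by move=> z dz; rewrite mE// mq.
    split; first by exists q; exact: coefs_psum.
    by exists 1 => z; exact: orthonormal_le1.
  split; last by move=> l _; rewrite psum_even.
  (* If no two points separate the values, all of them equal the value at 0, and uniqueness of
     coefficients makes [u] a multiple of the constant 1. *)
  apply: contrapT => h; have d0 : disc (0 : R[i]) by rewrite /disc Normc.normc0.
  have E : u = scale (psum u 0) (@unit_seq R).
    have HU := @H2_unit_seq R; apply: coefs_inj => //; first exact: H2_scale.
    move=> z dz; rewrite psum_scale// psum_unit_seq// mulr1.
    by apply: contrapT => hz; apply: h; exists z, 0.
  by move: un; rewrite E /scale /unit_seq /= mulr0 eqxx.
Qed.
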